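(* Let $p_1>2$ be such that, with $p=p_1$ and $p'=\frac{p}{p-1}$, $$\frac{2\pi_{p'}}{\pi^2(p-1)}\left[2+\frac{\pi^2}{2}(p-2)\right]\left[\left(1-\frac{1}{2^{p'}}\right)\zeta(p')-1\right]=\frac{8}{\pi\,\pi_p}.$$ Then, for every $s>1$ ($s<\infty$) and every $p$ with $2\le p\le p_1$, the family $\{\cos_p(n\pi_p\,\cdot)\}_{n=0}^\infty$ forms a Schauder basis of $L_s(0,1)$.
   Context: For $1<p<\infty$ let $F_p(y)=\int_0^y(1-t^p)^{-1/p}\,dt$ for $y\in[0,1]$, and $\pi_p:=2F_p(1)=\frac{2\pi}{p\sin(\pi/p)}$. The function $\sin_p:[0,\frac{\pi_p}{2}]\to[0,1]$ is the inverse of $F_p$, extended to $\mathbb{R}$ by $\sin_p(-x)=-\sin_p(x)$ and $\sin_p(\frac{\pi_p}{2}-x)=\sin_p(\frac{\pi_p}{2}+x)$ (so it is $2\pi_p$-periodic). Define $\cos_p x:=\frac{d}{dx}\sin_p x$ for all $x\in\mathbb{R}$. $\cos_p(n\pi_p\,\cdot)$ denotes the function $x\mapsto\cos_p(n\pi_p x)$ on $(0,1)$. The Schauder basis is ordered by $n=0,1,2,\dots$. $\zeta$ is the Riemann zeta function. *)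

(* Defs.v *)
From HB Require Import structures.
From mathcomp Require Import all_boot all_order all_algebra.
From mathcomp Require Import all_classical all_reals all_analysis.
From mathcomp Require Import ring lra.

Set Implicit Arguments.
Unset Strict Implicit.
Unset Printing Implicit Defensive.

Import Order.TTheory GRing.Theory Num.Theory.
Import numFieldNormedType.Exports.

Local Open Scope classical_set_scope.
Local Open Scope ring_scope.

(* At t = 1 the integrand takes the junk value 0 `^ (- p^-1) = 0; a single point
   does not affect the Lebesgue integral. *)
Definition F_p (R : realType) (p y : R) : R :=
  \int[lebesgue_measure]_(t in `[0, y]) (1 - t `^ p) `^ (- p^-1).

Definition pi_p (R : realType) (p : R) : R := 2 * F_p p 1.

Definition F_p_inv (R : realType) (p : R) : R -> R :=
  'pinv_(fun=> 0 : R) (`[0, 1] : set R) (F_p p).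

(* The two extension rules f (- x) = - f x and
   f (pi_p / 2 - x) = f (pi_p / 2 + x) give f (x + pi_p) = - f x, hence the
   closed form below, where x = k * pi_p + r with - pi_p / 2 <= r < pi_p / 2.
   The lemmas sin_pN, sin_p_sym and sin_pE recover the defining properties. *)
Definition sin_p (R : realType) (p x : R) : R :=
  let k := Num.floor (x / pi_p p + 2^-1) in
  let r := x - k%:~R * pi_p p in
  (-1) ^ k * (Num.sg r * F_p_inv p `|r|).

Lemma sin_p_red (R : realType) (p : R) (k : int) (r : R) :
  0 < pi_p p -> - (pi_p p / 2) <= r < pi_p p / 2 ->
  sin_p p (k%:~R * pi_p p + r) = (-1) ^ k * (Num.sg r * F_p_inv p `|r|).
Proof.
move=> w0 /andP[r1 r2]; rewrite /sin_p.
have -> : Num.floor ((k%:~R * pi_p p + r) / pi_p p + 2^-1) = k.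
  apply: floor_def; rewrite mulrDl mulfK ?gt_eqF// intrD -addrA lerDl ltrD2l.
  have -> : r / pi_p p + 2^-1 = (r + pi_p p / 2) / pi_p p.
    by field; rewrite gt_eqF.
  by rewrite ler_pdivlMr// mul0r ltr_pdivrMr// mul1r; apply/andP; split; lra.
by rewrite addrAC subrr add0r.
Qed.

Lemma sin_pP (R : realType) (p x : R) : 0 < pi_p p ->
  exists (k : int) (r : R),
    - (pi_p p / 2) <= r < pi_p p / 2 /\ x = k%:~R * pi_p p + r.
Proof.
move=> w0; pose k := Num.floor (x / pi_p p + 2^-1).
exists k, (x - k%:~R * pi_p p); split; last by rewrite addrC subrK.
have := floor_itv (x / pi_p p + 2^-1); rewrite -/k intrD => /andP[k1 k2].
have xE : x = x / pi_p p * pi_p p by rewrite divfK ?gt_eqF.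
have := ler_wpM2r (ltW w0) k1; have := k2; rewrite -(ltr_pM2r w0) !mulrDl -xE.
by move=> *; apply/andP; split; lra.
Qed.

Lemma sin_pD (R : realType) (p x : R) : 0 < pi_p p ->
  sin_p p (x + pi_p p) = - sin_p p x.
Proof.
move=> w0; have [k [r [rP ->]]] := sin_pP x w0.
have -> : k%:~R * pi_p p + r + pi_p p = (k + 1)%:~R * pi_p p + r.
  by rewrite intrD; ring.
by rewrite !sin_p_red// expfzDr ?oppr_eq0 ?oner_eq0// expr1z; ring.
Qed.

Lemma sin_pN (R : realType) (p x : R) : 0 < pi_p p ->
  sin_p p (- x) = - sin_p p x.
Proof.
move=> w0; have [k [r [rP ->]]] := sin_pP x w0; have /andP[r1 r2] := rP.
have signN (n : int) : (-1) ^ (- n) = (-1) ^ n :> R.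
  by rewrite -exprz_inv invrN1.
have [r3|r3] := ltP (- (pi_p p / 2)) r.
  have -> : - (k%:~R * pi_p p + r) = (- k)%:~R * pi_p p + - r.
    by rewrite intrN; ring.
  rewrite !sin_p_red//; last by apply/andP; split; lra.
  by rewrite sgrN normrN signN; ring.
have rE : r = - (pi_p p / 2) by apply/eqP; rewrite eq_le r1 r3.
have -> : - (k%:~R * pi_p p + r) = (- k + 1)%:~R * pi_p p + r.
  by rewrite intrD intrN rE; field.
by rewrite !sin_p_red// expfzDr ?oppr_eq0 ?oner_eq0// signN expr1z; ring.
Qed.

Lemma sin_p_sym (R : realType) (p x : R) : 0 < pi_p p ->
  sin_p p (pi_p p / 2 - x) = sin_p p (pi_p p / 2 + x).
Proof.
move=> w0; have -> : pi_p p / 2 + x = - (pi_p p / 2 - x) + pi_p p by field.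
by rewrite sin_pD// sin_pN// opprK.
Qed.

Lemma sin_pE (R : realType) (p x : R) : 0 < pi_p p -> 0 < x <= pi_p p / 2 ->
  sin_p p x = F_p_inv p x.
Proof.
move=> w0 /andP[x0 xw]; have [x1|x1] := ltP x (pi_p p / 2).
  have -> : x = 0%:~R * pi_p p + x by rewrite mul0r add0r.
  rewrite sin_p_red//; last by apply/andP; split; lra.
  by rewrite mul0r add0r expr0z gtr0_sg// gtr0_norm// !mul1r.
have {xw x1}xE : x = pi_p p / 2 by apply/eqP; rewrite eq_le xw x1.
have -> : sin_p p x = sin_p p (1%:~R * pi_p p + - x).
  by congr sin_p; rewrite mul1r xE; field.
rewrite sin_p_red//; last by apply/andP; split; lra.
by rewrite expr1z sgrN gtr0_sg// normrN gtr0_norm//; ring.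
Qed.

Definition cos_p (R : realType) (p : R) : R -> R := derive1 (sin_p p).

Definition zeta (R : realType) (s : R) : R := limn (series (riemannR s)).

Definition lebesgue01 (R : realType) : {measure set (measurableTypeR R) -> \bar R} :=
  mrestr (@lebesgue_measure R) (measurable_itv `]0, 1[).

(* Functions stand for their classes modulo mu-a.e. equality: both clauses only
   depend on the classes of e n and f, since the seminorm does. *)
Definition schauder_basis (d : measure_display) (T : measurableType d)
    (R : realType) (mu : {measure set T -> \bar R}) (s : R) (e : nat -> T -> R) :
    Prop :=
  (forall n, e n \in Lfun mu s%:E) /\
  (forall f : T -> R, f \in Lfun mu s%:E ->
     exists! c : nat -> R,
       (fun N : nat =>
          'N[mu]_s%:E[EFin \o (fun x => f x - \sum_(n < N) c n * e n x)%R])%E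
         @ \oo --> 0%E).

(* Main.v *)
Require Import Defs.
From HB Require Import structures.
From mathcomp Require Import all_boot all_order all_algebra.
From mathcomp Require Import all_classical all_reals all_analysis.
From mathcomp Require Import measurable_realfun.
From mathcomp Require Import ring lra.

Set Implicit Arguments.
Unset Strict Implicit.
Unset Printing Implicit Defensive.

Import Order.TTheory GRing.Theory Num.Theory.
Import numFieldNormedType.Exports.

Local Open Scope classical_set_scope.
Local Open Scope ring_scope.

(* Write [cos_p p (pi_p p * x)] as an absolutely convergent cosine series
   [\sum_k tau k * cos (k * pi * x)], so that the n-th function of the family is
   the same series dilated by n.

   The cosine system is a Schauder basis of L_s: the partial sum operator is a
   combination of modulated conjugations, and conjugation is bounded on L_s for
   [1 < s <= 2] by the convexity argument of M. Riesz, the integral of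
   [C * (u ^+ 2 + e) `^ a - (u ^+ 2 + v ^+ 2 + e) `^ a] being nonincreasing along
   the Poisson flow; duality gives [s > 2].  Since dilations are isometries of
   L_s on even 2-periodic functions, the bound [\sum_(k >= 2) `|tau k| < `|tau 1|]
   transfers boundedness of partial sums and completeness from the cosine system
   to the dilated family.

   With [c = (p - 1) * pi_p p], the concavity of [cos_p] near its zero and the
   estimate [cos_p x `^ (p - 1) <= (p - 1) * (pi_p p / 2 - x)] give
   [`|tau j| <= 4 / pi * (c / pi) `^ (p - 1)^-1 * j `^ (- p')] for odd j, the even
   coefficients vanish, and [tau 1 >= 8 / (pi * pi_p p)].  Summing, the bound
   follows from [(c / (2 * pi)) `^ p' < 2 / pi], which holds for [p <= 25 / 9];
   and the equation defining [p1] forces [p1 <= 25 / 9]. *)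

(** * Calculus *)

(** The map sending each cosine to its perturbed counterpart is never built as an operator on L_s,
    nor inverted there: [nrm_dilation] covers continuous even 2-periodic functions, so all estimates
    are made on finite sums. The n-th perturbed function has only frequencies that are multiples of
    [n], so the coefficients [b] of f come from its cosine coefficients by a triangular system.
    Grouping the frequencies [k * n <= N] writes the cosine partial sum of f as a combination of
    dilates by [k] of [\sum_(1 <= n < (N %/ k).+1) b n * cosw n]. The term [k = 1] dominates, so
    strong induction on [N] bounds these sums, and with them the partial sums of the perturbed
    expansion. The threshold 25/9 is a meeting point of two crude estimates: it must be large enough
    for the equation to fail beyond it and small enough for the coefficient condition to hold below
    it. There p' = 25/16, and powers with this exponent are bounded by comparing integer powers. *)

Section derivation_rules.
Context {R : realType}.
Implicit Types (f g : R -> R) (x a b : R).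

Lemma drv_cst c x : is_derive x 1 (fun=> c : R) 0.
Proof. exact: is_derive_cst. Qed.

Lemma drv_id x : is_derive x 1 (fun t => t : R) 1.
Proof. exact: is_derive_id. Qed.

Lemma drvD f g x a b : is_derive x 1 f a -> is_derive x 1 g b ->
  is_derive x 1 (fun t => f t + g t) (a + b).
Proof. by move=> fa gb; exact: is_deriveD. Qed.

Lemma drvB f g x a b : is_derive x 1 f a -> is_derive x 1 g b ->
  is_derive x 1 (fun t => f t - g t) (a - b).
Proof. by move=> fa gb; exact: is_deriveB. Qed.

Lemma drvN f x a : is_derive x 1 f a -> is_derive x 1 (fun t => - f t) (- a).
Proof. by move=> fa; exact: is_deriveN. Qed.

Lemma drvM f g x a b : is_derive x 1 f a -> is_derive x 1 g b ->
  is_derive x 1 (fun t => f t * g t) (f x * b + g x * a).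
Proof. by move=> fa gb; exact: is_deriveM. Qed.

Lemma drvZ c f x a : is_derive x 1 f a ->
  is_derive x 1 (fun t => c * f t) (c * a).
Proof.
move=> fa; apply: is_derive_eq (drvM (drv_cst c x) fa) _.
by rewrite mulr0 addr0.
Qed.

Lemma drv_sqr f x a : is_derive x 1 f a ->
  is_derive x 1 (fun t => f t ^+ 2) (2 * f x * a).
Proof.
move=> fa; rewrite (_ : (fun t => _) = (fun t => f t * f t)); last first.
  by apply/funext => t; rewrite expr2.
by apply: is_derive_eq (drvM fa fa) _; ring.
Qed.

Lemma drv_comp f g x a b : is_derive x 1 g b -> is_derive (g x) 1 f a ->
  is_derive x 1 (fun t => f (g t)) (a * b).
Proof. by move=> gb fa; apply: is_derive_eq (is_derive1_comp fa gb) _. Qed.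

Lemma drv_powR f x a r : is_derive x 1 f a -> 0 < f x ->
  is_derive x 1 (fun t => f t `^ r) (r * f x `^ (r - 1) * a).
Proof. by move=> fa f0; exact: (drv_comp fa (is_derive1_powR r f0)). Qed.

Lemma drv_affine c d x : is_derive x 1 (fun t => c * t + d : R) c.
Proof.
apply: is_derive_eq (drvD (drvZ c (drv_id x)) (drv_cst d x)) _.
by rewrite mulr1 addr0.
Qed.

Lemma drv_sum n (h : 'I_n -> R -> R) (dh : 'I_n -> R) x :
  (forall i, is_derive x 1 (h i) (dh i)) ->
  is_derive x 1 (fun t => \sum_(i < n) h i t) (\sum_(i < n) dh i).
Proof.
move=> H; rewrite (_ : (fun t => _) = \sum_(i < n) h i); last first.
  by apply/funext => t; rewrite fct_sumE.
exact: is_derive_sum.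
Qed.

Lemma drv_continuous f x a : is_derive x 1 f a -> {for x, continuous f}.
Proof.
by move=> [fx _]; apply: differentiable_continuous; exact/derivable1_diffP.
Qed.

Lemma drv_continuousT f df : (forall x, is_derive x 1 f (df x)) -> continuous f.
Proof. by move=> H x; exact: drv_continuous (H x). Qed.

Lemma drv_ge0_homo f df a b : (forall x, a < x < b -> is_derive x 1 f (df x)) ->
  (forall x, a < x < b -> 0 <= df x) -> {within `[a, b], continuous f} ->
  forall x y, a <= x -> x <= y -> y <= b -> f x <= f y.
Proof.
move=> fd d0 cf; apply: ger0_derive1_ndecr => //.
- by move=> x; rewrite in_itv/= => /fd[].
- by move=> x; rewrite in_itv/= => xab; rewrite derive1E; have [_ ->] := fd _ xab; exact: d0.
Qed.

End derivation_rules.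

Section continuity_rules.
Context {R : realType}.
Implicit Types (f g : R -> R) (x : R).

Lemma ct_cst (k : R) : continuous (fun _ : R => k).
Proof. by move=> x; exact: cvg_cst. Qed.

Lemma ct_id : continuous (fun x : R => x).
Proof. by move=> x; exact: cvg_id. Qed.

Lemma ctD f g : continuous f -> continuous g -> continuous (fun x => f x + g x).
Proof. by move=> cf cg x; apply: continuousD; [exact: cf|exact: cg]. Qed.

Lemma ctB f g : continuous f -> continuous g -> continuous (fun x => f x - g x).
Proof. by move=> cf cg x; apply: continuousB; [exact: cf|exact: cg]. Qed.

Lemma ctN f : continuous f -> continuous (fun x => - f x).
Proof. by move=> cf x; apply: continuousN; exact: cf. Qed.

Lemma ctM f g : continuous f -> continuous g -> continuous (fun x => f x * g x).
Proof. by move=> cf cg x; apply: continuousM; [exact: cf|exact: cg]. Qed.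

Lemma ct_sqr f : continuous f -> continuous (fun x => f x ^+ 2).
Proof. by move=> cf; exact: ctM. Qed.

Lemma ct_comp f g : continuous f -> continuous g -> continuous (fun x => f (g x)).
Proof.
by move=> cf cg x; apply: (@continuous_comp _ _ _ g f); [exact: cg|exact: cf].
Qed.

Lemma ct_norm f : continuous f -> continuous (fun x => `|f x|).
Proof. by move=> cf; apply: ct_comp => //; exact: norm_continuous. Qed.

Lemma ct_cos f : continuous f -> continuous (fun x => cos (f x)).
Proof. by move=> cf; apply: ct_comp => //; exact: continuous_cos. Qed.

Lemma ct_sin f : continuous f -> continuous (fun x => sin (f x)).
Proof. by move=> cf; apply: ct_comp => //; exact: continuous_sin. Qed.

Lemma ct_powR r f : continuous f -> (forall x, 0 < f x) ->
  continuous (fun x => f x `^ r).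
Proof.
move=> cf f0 x; apply: (@continuous_comp _ _ _ f (fun t => t `^ r)); first exact: cf.
exact: drv_continuous (is_derive1_powR r (f0 x)).
Qed.

Lemma ct_sum n (h : 'I_n -> R -> R) : (forall i, continuous (h i)) ->
  continuous (fun x => \sum_(i < n) h i x).
Proof.
move=> ch; elim: n h ch => [|n IH] h ch.
  by under eq_fun do rewrite big_ord0; exact: ct_cst.
under eq_fun do rewrite big_ord_recr/=.
by apply: ctD; [apply: (IH (fun i => h (widen_ord (leqnSn n) i)))|].
Qed.

End continuity_rules.

Arguments ct_cst {R} k.
Arguments ct_id {R}.

Section interval_integrals.
Context {R : realType}.
Notation mu := (@lebesgue_measure R).
Implicit Types (f g F : R -> R) (x a b : R).

Lemma itv_integrable f a b : {within `[a, b], continuous f} ->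
  mu.-integrable `[a, b] (EFin \o f).
Proof.
by move=> cf; apply: continuous_compact_integrable => //; exact: segment_compact.
Qed.

Lemma cont_integrable f a b : continuous f -> mu.-integrable `[a, b] (EFin \o f).
Proof. by move=> cf; apply/itv_integrable/continuous_subspaceT. Qed.

Lemma itv_FTC f F a b : a <= b -> {within `[a, b], continuous F} ->
  {within `[a, b], continuous f} ->
  (forall x, a < x < b -> is_derive x 1 F (f x)) ->
  \int[mu]_(x in `[a, b]) f x = F b - F a.
Proof.
rewrite le_eqVlt => /predU1P[<- _ _ _|ab cF cf Ff].
  by rewrite set_itv1 Rintegral_set1 subrr.
have [_ FFa FFb] := (continuous_within_itvP _ ab).1 cF.
rewrite /Rintegral (@continuous_FTC2 _ f F)//.
- split => //.
  by move=> x; rewrite in_itv/= => /Ff[].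
- by move=> x; rewrite in_itv/= => xab; rewrite derive1E; have [_ ->] := Ff _ xab.
Qed.

Lemma cont_FTC f F a b : a <= b -> continuous f ->
  (forall x, is_derive x 1 F (f x)) ->
  \int[mu]_(x in `[a, b]) f x = F b - F a.
Proof.
move=> ab cf Ff; apply: itv_FTC => //; apply: continuous_subspaceT => //.
exact: drv_continuousT Ff.
Qed.

Lemma cont_le_Rintegral f g a b : continuous f -> continuous g ->
  (forall x, a <= x <= b -> f x <= g x) ->
  \int[mu]_(x in `[a, b]) f x <= \int[mu]_(x in `[a, b]) g x.
Proof.
have mA : measurable (`[a, b] : set (measurableTypeR R)) by [].
move=> cf cg fg; apply: (le_Rintegral mA); [exact: cont_integrable|exact: cont_integrable|].
by move=> x /=; rewrite in_itv/=; exact: fg.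
Qed.

Lemma Rintegral_itv_cst a b (c : R) : a <= b ->
  \int[mu]_(x in `[a, b]) c = c * (b - a).
Proof.
move=> ab; rewrite Rintegral_cst//; congr (_ * _).
have := @lebesgue_measure_itv R `[a, b]; rewrite /= lte_fin => ->.
case: ifPn => [_|]; first by rewrite -EFinB.
by rewrite -leNgt /= => ba; apply/eqP; rewrite eq_sym subr_eq0 eq_le ba ab.
Qed.

(** The constant [K] is the dominating function, so a bound on [df] that is uniform near [t] is all
    that has to be supplied. *)
Lemma drv_Rintegral (f df : R -> R -> R) (u v K t : R) :
  u < t < v ->
  (forall s, continuous (f s)) ->
  (forall s x : R, 0 <= x <= 1 -> is_derive s 1 (f^~ x) (df s x)) ->
  (forall s x, u < s < v -> 0 <= x <= 1 -> `|df s x| <= K) ->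
  is_derive t 1 (fun s => \int[mu]_(x in `[0, 1]) f s x)
    (\int[mu]_(x in `[0, 1]) df t x).
Proof.
move=> utv cf fd dK.
have It : [set` `]u, v[] t by rewrite /= in_itv/=.
have mB : measurable (`[0, 1] : set (measurableTypeR R)) by [].
have intf x : [set` `]u, v[] x -> mu.-integrable `[0, 1] (EFin \o f x).
  by move=> _; exact: cont_integrable.
have derf x y : [set` `]u, v[] x -> [set` `[0 : R, 1]] y -> derivable (f ^~ y) x 1.
  by move=> _ /=; rewrite in_itv/= => y01; have [] := fd x y y01.
have pE x y : [set` `[0 : R, 1]] y -> partial1of2 f x y = df x y.
  by rewrite /= in_itv/= => y01; rewrite partial1of2E; have [_ ->] := fd x y y01.
have K0 : 0 <= K by apply: le_trans (dK t 0 utv _) => //; rewrite lexx ler01.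
have iK : mu.-integrable `[0, 1] (EFin \o (fun=> K)).
  by apply: cont_integrable => x; exact: cvg_cst.
have ub x y : [set` `]u, v[] x -> [set` `[0 : R, 1]] y -> `|partial1of2 f x y| <= K.
  move=> xuv y01; rewrite pE//; apply: dK; [|move: y01]; last by rewrite /= in_itv.
  by move: xuv; rewrite /= in_itv.
split.
  exact: (@derivable_under_integral _ _ _ mu f _ mB t u v It intf derf (fun=> K)).
rewrite -derive1E.
rewrite (@differentiation_under_integral _ _ _ mu f _ mB t u v It intf derf (fun=> K))//.
by apply: eq_Rintegral => x; rewrite inE => x01; rewrite /= pE.
Qed.

End interval_integrals.

(** * The inequality of M. Riesz *)

Section regularized_power.
Context {R : realType}.
Implicit Types (C e a y z t : R).

(** For [a = s / 2] and [e = 0] this is [C * |y|^s - |y + i z|^s]. The shift [e > 0] makes both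
    powers smooth where [y] or [y + i z] vanishes. *)
Definition regpow C e a y z : R :=
  C * (y ^+ 2 + e) `^ a - (y ^+ 2 + z ^+ 2 + e) `^ a.

(** Derivative of [regpow] along a curve with velocity [(y1, z1)]; [regpow2] adds the acceleration
    [(y2, z2)]. Free velocities let one formula serve for the variable [t] and for the variable
    [x]. *)
Definition regpow1 C e a y z y1 z1 : R :=
  2 * a * (C * (y ^+ 2 + e) `^ (a - 1) * (y * y1) -
           (y ^+ 2 + z ^+ 2 + e) `^ (a - 1) * (y * y1 + z * z1)).

Definition regpow2 C e a y z y1 z1 y2 z2 : R :=
  2 * a * (C * (2 * (a - 1) * (y ^+ 2 + e) `^ (a - 1 - 1) * (y * y1) ^+ 2 +
                (y ^+ 2 + e) `^ (a - 1) * (y1 ^+ 2 + y * y2)) -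
           (2 * (a - 1) * (y ^+ 2 + z ^+ 2 + e) `^ (a - 1 - 1) *
              (y * y1 + z * z1) ^+ 2 +
            (y ^+ 2 + z ^+ 2 + e) `^ (a - 1) *
              (y1 ^+ 2 + z1 ^+ 2 + y * y2 + z * z2))).

Lemma sqrDe_gt0 e y : 0 < e -> 0 < y ^+ 2 + e.
Proof. by move=> e0; rewrite ltr_wpDl// sqr_ge0. Qed.

Lemma sqr2De_gt0 e y z : 0 < e -> 0 < y ^+ 2 + z ^+ 2 + e.
Proof. by move=> e0; rewrite ltr_wpDl// addr_ge0// sqr_ge0. Qed.

Lemma drv_regpow C e a (y z : R -> R) t y1 z1 : 0 < e ->
  is_derive t 1 y y1 -> is_derive t 1 z z1 ->
  is_derive t 1 (fun t => regpow C e a (y t) (z t))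
    (regpow1 C e a (y t) (z t) y1 z1).
Proof.
move=> e0 dy dz; rewrite /regpow.
have dq := drvD (drv_sqr dy) (drv_cst e t).
have dr := drvD (drvD (drv_sqr dy) (drv_sqr dz)) (drv_cst e t).
have d1 := drvZ C (drv_powR a dq (sqrDe_gt0 (y t) e0)).
have d2 := drv_powR a dr (sqr2De_gt0 (y t) (z t) e0).
by apply: is_derive_eq (drvB d1 d2) _; rewrite /regpow1; ring.
Qed.

Lemma drv_regpow1 C e a (y z y1 z1 : R -> R) t y2 z2 : 0 < e ->
  is_derive t 1 y (y1 t) -> is_derive t 1 z (z1 t) ->
  is_derive t 1 y1 y2 -> is_derive t 1 z1 z2 ->
  is_derive t 1 (fun t => regpow1 C e a (y t) (z t) (y1 t) (z1 t))
    (regpow2 C e a (y t) (z t) (y1 t) (z1 t) y2 z2).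
Proof.
move=> e0 dy dz dy1 dz1; rewrite /regpow1.
have dq := drvD (drv_sqr dy) (drv_cst e t).
have dr := drvD (drvD (drv_sqr dy) (drv_sqr dz)) (drv_cst e t).
have dm := drvM dy dy1.
have dn := drvM dz dz1.
have d1 := drvM (drvZ C (drv_powR (a - 1) dq (sqrDe_gt0 (y t) e0))) dm.
have d2 := drvM (drv_powR (a - 1) dr (sqr2De_gt0 (y t) (z t) e0)) (drvD dm dn).
by apply: is_derive_eq (drvZ (2 * a) (drvB d1 d2)) _; rewrite /regpow2; ring.
Qed.

Lemma ler_ppowR r (x y : R) : 0 <= r -> 0 <= x -> x <= y -> x `^ r <= y `^ r.
Proof.
move=> r0 x0 xy; have := @ge0_ler_powR R r r0 x y.
by rewrite !nnegrE x0 (le_trans x0 xy) xy => ->.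
Qed.

Lemma ler_npowR r (x y : R) : r <= 0 -> 0 < x -> x <= y -> y `^ r <= x `^ r.
Proof.
move=> r0 x0 xy; have y0 := lt_le_trans x0 xy.
rewrite -[r]opprK (powRN y) (powRN x) lef_pV2 ?posrE ?powR_gt0//.
by apply: ler_ppowR; rewrite ?oppr_ge0// ltW.
Qed.

Lemma powR_sub1 (x r : R) : 0 < x -> x * x `^ (r - 1) = x `^ r.
Proof.
move=> x0; rewrite powRB; last by rewrite (gt_eqF x0) implybT.
by rewrite powRr1 ?ltW// mulrC divfK ?gt_eqF.
Qed.

(* The Laplacian of [regpow], evaluated along an analytic function *)
Lemma regpow_laplacian_ge0 C e a y z y1 z1 y2 z2 : 0 < e -> 2^-1 < a <= 1 ->
  C = 2 / (2 * a - 1) ->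
  0 <= regpow2 C e a y z (- y1) (- z1) y2 z2 +
       regpow2 C e a y z (- z1) y1 (- y2) (- z2).
Proof.
move=> e0 /andP[a1 a2] CE0.
have q0 := sqrDe_gt0 y e0; have r0 := sqr2De_gt0 y z e0.
set q := y ^+ 2 + e in q0; set r := y ^+ 2 + z ^+ 2 + e in r0.
have aq : q * q `^ (a - 1 - 1) = q `^ (a - 1) by rewrite powR_sub1.
have ar : r * r `^ (a - 1 - 1) = r `^ (a - 1) by rewrite powR_sub1.
have C0 : 0 < C by rewrite CE0 divr_gt0//; lra.
have CE : C * (2 * a - 1) = 2 by rewrite CE0 divfK// gt_eqF//; lra.
have E0 : 0 <= y1 ^+ 2 + z1 ^+ 2 by rewrite addr_ge0// sqr_ge0.
pose Q := q `^ (a - 1 - 1); pose P := r `^ (a - 1 - 1).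
have Q0 : 0 < Q by exact: powR_gt0.
have P0 : 0 < P by exact: powR_gt0.
have qr : r `^ (a - 1) <= q `^ (a - 1).
  by apply: ler_npowR; rewrite ?/q ?/r; [lra|exact: q0|rewrite lerD2r lerDl sqr_ge0].
(* The accelerations in the two directions are opposite and cancel, while by the Cauchy-Riemann
   equations the squared mixed terms add up to [y ^+ 2] and [y ^+ 2 + z ^+ 2] times
   [y1 ^+ 2 + z1 ^+ 2]. *)
have -> : regpow2 C e a y z (- y1) (- z1) y2 z2 +
       regpow2 C e a y z (- z1) y1 (- y2) (- z2) =
    2 * a * (y1 ^+ 2 + z1 ^+ 2) *
      (C * (q `^ (a - 1) - 2 * (1 - a) * Q * y ^+ 2) -
       (2 * r `^ (a - 1) - 2 * (1 - a) * P * (y ^+ 2 + z ^+ 2))).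
  by rewrite /regpow2 -/q -/r -/Q -/P; ring.
rewrite mulr_ge0//; first by rewrite mulr_ge0//; lra.
rewrite subr_ge0.
(* As [a <= 1], the [P] term is dropped and [r] is replaced by the smaller [q]; the value of [C]
   makes the remaining inequality follow from [y ^+ 2 <= q]. *)
apply: (@le_trans _ _ (2 * r `^ (a - 1))).
  by rewrite gerBl mulr_ge0//; [rewrite mulr_ge0//; [lra|exact: ltW]|rewrite addr_ge0 ?sqr_ge0].
apply: (@le_trans _ _ (2 * q `^ (a - 1))); first by rewrite ler_pM2l.
have -> : 2 * q `^ (a - 1) = C * ((2 * a - 1) * q `^ (a - 1)) by rewrite mulrA CE.
rewrite ler_pM2l// -aq -/Q.
have yq : y ^+ 2 <= q by rewrite lerDl ltW.
have : (1 - a) * Q * y ^+ 2 <= (1 - a) * Q * q.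
  by apply: ler_wpM2l => //; rewrite mulr_ge0//; [lra|exact: ltW].
lra.
Qed.

Section continuity.
Variables (C e a : R) (y z y1 z1 y2 z2 : R -> R).
Hypotheses (e0 : 0 < e) (cy : continuous y) (cz : continuous z)
  (cy1 : continuous y1) (cz1 : continuous z1)
  (cy2 : continuous y2) (cz2 : continuous z2).

Let cq r : continuous (fun x => (y x ^+ 2 + e) `^ r).
Proof. by apply: ct_powR => [|x]; [exact/ctD/ct_cst/ct_sqr|exact: sqrDe_gt0]. Qed.

Let cr r : continuous (fun x => (y x ^+ 2 + z x ^+ 2 + e) `^ r).
Proof.
by apply: ct_powR => [|x]; [apply/ctD/ct_cst/ctD; exact: ct_sqr|exact: sqr2De_gt0].
Qed.

Lemma continuous_regpow1 : continuous (fun x => regpow1 C e a (y x) (z x) (y1 x) (z1 x)).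
Proof.
exact: (ctM (ct_cst (2 * a)) (ctB (ctM (ctM (ct_cst C) (@cq (a - 1))) (ctM cy cy1))
  (ctM (@cr (a - 1)) (ctD (ctM cy cy1) (ctM cz cz1))))).
Qed.

Lemma continuous_regpow2 : continuous
  (fun x => regpow2 C e a (y x) (z x) (y1 x) (z1 x) (y2 x) (z2 x)).
Proof.
have k2 (w d : R -> R) : continuous w -> continuous d ->
    continuous (fun x => 2 * (a - 1) * w x * d x ^+ 2).
  by move=> cw cd; exact: (ctM (ctM (ct_cst _) cw) (ct_sqr cd)).
have cyy := ctM cy cy1; have czz := ctM cz cz1.
have cy2' := ctM cy cy2; have cz2' := ctM cz cz2.
exact: (ctM (ct_cst (2 * a)) (ctB
  (ctM (ct_cst C) (ctD (k2 _ _ (@cq (a - 1 - 1)) cyy)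
    (ctM (@cq (a - 1)) (ctD (ct_sqr cy1) cy2'))))
  (ctD (k2 _ _ (@cr (a - 1 - 1)) (ctD cyy czz))
    (ctM (@cr (a - 1)) (ctD (ctD (ctD (ct_sqr cy1) (ct_sqr cz1)) cy2') cz2'))))).
Qed.

End continuity.

End regularized_power.

(** * Harmonic extensions of trigonometric polynomials *)

Section damped_trig_sums.
Context {R : realType}.
Variables (M : nat) (c : nat -> R) (phi : R).
Implicit Types (t x : R) (j m : nat).

Lemma sin_natpi k : sin (k%:R * pi) = 0 :> R.
Proof.
elim: k => [|k IH]; first by rewrite mul0r sin0.
by rewrite -natr1 mulrDl mul1r sinDpi IH oppr0.
Qed.

(** With [z = x + i * t], [dcos 0] and [dsin 0] are the real and imaginary parts of [\sum_m c m *
    exp (i * (m * pi * z - phi))]; [j] counts differentiations, up to signs. The phase is 0 for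
    cosine polynomials and [pi / 2] for sine polynomials. *)
Definition dcos j t x : R := \sum_(m < M) c m * (m%:R * pi) ^+ j *
  (expR (- (m%:R * pi) * t) * cos (m%:R * pi * x - phi)).

Definition dsin j t x : R := \sum_(m < M) c m * (m%:R * pi) ^+ j *
  (expR (- (m%:R * pi) * t) * sin (m%:R * pi * x - phi)).

Lemma drv_expRZ (k : R) t : is_derive t 1 (fun t => expR (k * t)) (k * expR (k * t)).
Proof.
have := drv_comp (drvZ k (drv_id t)) (is_derive_expR (k * t)).
by move=> h; apply: is_derive_eq h _; rewrite mulr1 mulrC.
Qed.

Lemma drv_cos_affine (k d : R) x :
  is_derive x 1 (fun x => cos (k * x + d)) (- (k * sin (k * x + d))).
Proof.
have := drv_comp (drv_affine k d x) (is_derive_cos (k * x + d)).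
by move=> h; apply: is_derive_eq h _; rewrite mulNr mulrC.
Qed.

Lemma drv_sin_affine (k d : R) x :
  is_derive x 1 (fun x => sin (k * x + d)) (k * cos (k * x + d)).
Proof.
have := drv_comp (drv_affine k d x) (is_derive_sin (k * x + d)).
by move=> h; apply: is_derive_eq h _; rewrite mulrC.
Qed.

Lemma drv_dcos_t j t x : is_derive t 1 (fun t => dcos j t x) (- dcos j.+1 t x).
Proof.
rewrite /dcos -sumrN; apply: drv_sum => m.
have h := drvM (drv_expRZ (- (m%:R * pi)) t) (drv_cst (cos (m%:R * pi * x - phi)) t).
by apply: is_derive_eq (drvZ _ h) _; rewrite exprS; ring.
Qed.

Lemma drv_dsin_t j t x : is_derive t 1 (fun t => dsin j t x) (- dsin j.+1 t x).
Proof.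
rewrite /dsin -sumrN; apply: drv_sum => m.
have h := drvM (drv_expRZ (- (m%:R * pi)) t) (drv_cst (sin (m%:R * pi * x - phi)) t).
by apply: is_derive_eq (drvZ _ h) _; rewrite exprS; ring.
Qed.

Lemma drv_dcos_x j t x : is_derive x 1 (dcos j t) (- dsin j.+1 t x).
Proof.
rewrite /dcos -sumrN; apply: drv_sum => m.
have h := drvZ (expR (- (m%:R * pi) * t)) (drv_cos_affine (m%:R * pi) (- phi) x).
by apply: is_derive_eq (drvZ _ h) _; rewrite exprS; ring.
Qed.

Lemma drv_dsin_x j t x : is_derive x 1 (dsin j t) (dcos j.+1 t x).
Proof.
rewrite /dsin; apply: drv_sum => m.
have h := drvZ (expR (- (m%:R * pi) * t)) (drv_sin_affine (m%:R * pi) (- phi) x).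
by apply: is_derive_eq (drvZ _ h) _; rewrite exprS; ring.
Qed.

Lemma continuous_dcos j t : continuous (dcos j t).
Proof. exact: (drv_continuousT (drv_dcos_x j t)). Qed.

Lemma continuous_dsin j t : continuous (dsin j t).
Proof. exact: (drv_continuousT (drv_dsin_x j t)). Qed.

(** The factor [expR (m%:R * pi)] covers all [t >= -1]: derivatives at [t = 0] are two-sided, so
    slightly negative times occur. *)
Definition dbound j : R :=
  \sum_(m < M) `|c m| * (m%:R * pi) ^+ j * expR (m%:R * pi).

Lemma dbound_ge0 j : 0 <= dbound j.
Proof.
apply: sumr_ge0 => m _; rewrite mulr_ge0 ?expR_ge0// mulr_ge0// exprn_ge0//.
by rewrite mulr_ge0// pi_ge0.
Qed.

Lemma mpi_ge0 m : 0 <= m%:R * pi :> R.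
Proof. by rewrite mulr_ge0// pi_ge0. Qed.

Lemma dsum_bound (tr : R -> R) j t x : (forall x, `|tr x| <= 1) -> -1 <= t ->
  `|\sum_(m < M) c m * (m%:R * pi) ^+ j *
    (expR (- (m%:R * pi) * t) * tr (m%:R * pi * x - phi))| <= dbound j.
Proof.
move=> tr1 t1; apply: le_trans (ler_norm_sum _ _ _) _; apply: ler_sum => m _.
rewrite !normrM normrX (ger0_norm (mpi_ge0 m)) ler_wpM2l//.
  by rewrite mulr_ge0// exprn_ge0// mpi_ge0.
rewrite (ger0_norm (expR_ge0 _)) -[leRHS]mulr1 ler_pM ?expR_ge0// ler_expR.
by have := mpi_ge0 m; nra.
Qed.

Lemma dcos_bound j t x : -1 <= t -> `|dcos j t x| <= dbound j.
Proof. by apply: dsum_bound => y; exact: cos_max. Qed.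

Lemma dsin_bound j t x : -1 <= t -> `|dsin j t x| <= dbound j.
Proof. by apply: dsum_bound => y; exact: sin_max. Qed.

(** Only the term [m = 0] fails to decay like [expR (- (pi * t))]. Differentiation kills it, and for
    [j = 0] the last hypothesis does. *)
Lemma dsum_decay (tr : R -> R) j t x : (forall x, `|tr x| <= 1) -> 0 <= t ->
  (j == 0)%N ==> (c 0%N * tr (- phi) == 0) ->
  `|\sum_(m < M) c m * (m%:R * pi) ^+ j *
    (expR (- (m%:R * pi) * t) * tr (m%:R * pi * x - phi))| <=
  dbound j * expR (- (pi * t)).
Proof.
move=> tr1 t0 j0; apply: le_trans (ler_norm_sum _ _ _) _.
rewrite /dbound mulr_suml; apply: ler_sum => -[[|m] mM] _ /=.
  rewrite [leLHS](_ : _ = 0).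
    rewrite mulr_ge0 ?expR_ge0// mulr_ge0 ?expR_ge0// mulr_ge0// exprn_ge0//.
    by rewrite mul0r.
  case: j j0 => [/=|j _]; last by rewrite mul0r expr0n/= mulr0 mul0r normr0.
  move=> /eqP h; rewrite !mul0r sub0r expr0 mulr1 oppr0 mul0r expR0 mul1r.
  by rewrite h normr0.
rewrite !normrM normrX (ger0_norm (mpi_ge0 _)) -!mulrA ler_wpM2l//.
rewrite ler_wpM2l ?exprn_ge0 ?mpi_ge0// (ger0_norm (expR_ge0 _)).
rewrite -expRD -[leRHS]mulr1 ler_pM ?expR_ge0// ler_expR.
have := pi_ge0 R; have m0 : 0 <= m%:R :> R by [].
rewrite -natr1 => pi0.
have h1 : 0 <= m%:R * (pi * t) by rewrite mulr_ge0// mulr_ge0.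
have h2 : 0 <= m%:R * (pi : R) by rewrite mulr_ge0.
lra.
Qed.

Lemma dcos_decay j t x : 0 <= t -> (0 < j)%N ->
  `|dcos j t x| <= dbound j * expR (- (pi * t)).
Proof.
by move=> t0 j0; apply: dsum_decay => //; [exact: cos_max|case: j j0].
Qed.

Lemma dsin_decay j t x : 0 <= t -> c 0%N * sin phi = 0 ->
  `|dsin j t x| <= dbound j * expR (- (pi * t)).
Proof.
move=> t0 c0; apply: dsum_decay => //; first exact: sin_max.
by rewrite sinN mulrN c0 oppr0 eqxx implybT.
Qed.

End damped_trig_sums.

Section riesz.
Context {R : realType}.
Notation mu := (@lebesgue_measure R).
Implicit Types (t x : R).
Variables (M : nat) (c : nat -> R) (phi e a C : R).
Hypotheses (CE : C = 2 / (2 * a - 1)) (e0 : 0 < e) (a12 : 2^-1 < a <= 1).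
Hypotheses (cs0 : cos phi * sin phi = 0) (c0 : c 0%N * sin phi = 0).

Let u := dcos M c phi.
Let v := dsin M c phi.
Let B := 1 + dbound M c 0 + dbound M c 1 + dbound M c 2.

Let C0 : 0 < C.
Proof. by case/andP: a12 => a1 a2; rewrite CE divr_gt0//; lra. Qed.

Let B0 : 0 < B.
Proof. by rewrite /B; have := dbound_ge0 M c; move=> h; have := h 0%N; have := h 1%N; have := h 2%N; lra. Qed.

Let K0 : 0 <= 2 * e `^ (a - 1) * B * (C + 1).
Proof.
exact: (mulr_ge0 (mulr_ge0 (mulr_ge0 (ler0n _ 2) (powR_ge0 _ _)) (ltW B0))
  (addr_ge0 (ltW C0) ler01)).
Qed.

(** Being linear in the velocities, the bound inherits the exponential decay of [u 1] and [v 1] as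
    [t] grows. *)
Lemma regpow1_bound y z y1 z1 b : `|y| <= b -> `|z| <= b ->
  `|regpow1 C e a y z y1 z1| <=
    2 * e `^ (a - 1) * b * (C + 1) * (`|y1| + `|z1|).
Proof.
move=> yb zb; have b0 : 0 <= b := le_trans (normr_ge0 y) yb.
have /andP[a1 a2] := a12; have am : a - 1 <= 0 by lra.
have q0 := sqrDe_gt0 y e0; have r0 := sqr2De_gt0 y z e0.
have qE : (y ^+ 2 + e) `^ (a - 1) <= e `^ (a - 1).
  by apply: ler_npowR => //; rewrite lerDr sqr_ge0.
have rE : (y ^+ 2 + z ^+ 2 + e) `^ (a - 1) <= e `^ (a - 1).
  by apply: ler_npowR => //; rewrite lerDr addr_ge0// sqr_ge0.
have E0 : 0 < e `^ (a - 1) by exact: powR_gt0.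
have Y : `|y * y1| <= b * `|y1| by rewrite normrM ler_wpM2r.
have Z : `|z * z1| <= b * `|z1| by rewrite normrM ler_wpM2r.
rewrite /regpow1 normrM (ger0_norm (_ : 0 <= 2 * a)); last by lra.
apply: (@le_trans _ _ (2 * (e `^ (a - 1) * b * (C + 1) * (`|y1| + `|z1|)))); last first.
  by rewrite !mulrA.
apply: ler_pM; [lra|exact: normr_ge0|lra|].
apply: le_trans (ler_normB _ _) _; rewrite !normrM.
rewrite (ger0_norm (ltW C0)) !(ger0_norm (powR_ge0 _ _)).
have h1 : C * (y ^+ 2 + e) `^ (a - 1) * (`|y| * `|y1|) <= C * e `^ (a - 1) * (b * `|y1|).
  apply: ler_pM.
  - by rewrite mulr_ge0 ?powR_ge0 ?(ltW C0).
  - exact: mulr_ge0.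
  - by rewrite ler_pM2l.
  - exact: ler_wpM2r.
have h2 : (y ^+ 2 + z ^+ 2 + e) `^ (a - 1) * `|y * y1 + z * z1| <=
    e `^ (a - 1) * (b * `|y1| + b * `|z1|).
  apply: ler_pM; rewrite ?powR_ge0//.
  by apply: le_trans (ler_normD _ _) _; exact: lerD.
apply: le_trans (lerD h1 h2) _.
have -> : e `^ (a - 1) * b * (C + 1) * (`|y1| + `|z1|) =
  C * e `^ (a - 1) * (b * `|y1|) + e `^ (a - 1) * (b * `|y1| + b * `|z1|) +
  C * e `^ (a - 1) * (b * `|z1|) by ring.
by rewrite lerDl !mulr_ge0// ?ltW.
Qed.

Lemma regpow2_bound b : 0 <= b -> exists K, forall y z y1 z1 y2 z2,
  `|y| <= b -> `|z| <= b -> `|y1| <= b -> `|z1| <= b -> `|y2| <= b -> `|z2| <= b ->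
  `|regpow2 C e a y z y1 z1 y2 z2| <= K.
Proof.
move=> b0; pose E1 := e `^ (a - 1); pose E2 := e `^ (a - 1 - 1).
exists (2 * (C * (2 * E2 * (b * b) ^+ 2 + E1 * (b * b + b * b)) +
  (2 * E2 * (b * b + b * b) ^+ 2 + E1 * (b * b + b * b + b * b + b * b)))).
move=> y z y1 z1 y2 z2 yb zb y1b z1b y2b z2b.
have /andP[a1 a2] := a12; have am : a - 1 <= 0 by lra.
have am' : a - 1 - 1 <= 0 by lra.
have q0 := sqrDe_gt0 y e0; have r0 := sqr2De_gt0 y z e0.
have qE : e <= y ^+ 2 + e by rewrite lerDr sqr_ge0.
have rE : e <= y ^+ 2 + z ^+ 2 + e by rewrite lerDr addr_ge0// sqr_ge0.
have pb (s t : R) : `|s| <= b -> `|t| <= b -> `|s * t| <= b * b.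
  by move=> sb tb; rewrite normrM ler_pM.
have sb (s : R) : `|s| <= b -> `|s ^+ 2| <= b * b by move=> h; rewrite expr2 pb.
have E1M (w d k : R) : e <= w -> `|d| <= k -> `|w `^ (a - 1) * d| <= E1 * k.
  move=> ew dk; rewrite normrM (ger0_norm (powR_ge0 _ _)) ler_pM ?powR_ge0//.
  exact: ler_npowR.
have E2M (w d k : R) : e <= w -> `|d| <= k ->
    `|2 * (a - 1) * w `^ (a - 1 - 1) * d ^+ 2| <= 2 * E2 * k ^+ 2.
  move=> ew dk; rewrite normrM normrX; apply: ler_pM => //.
    rewrite normrM (ger0_norm (powR_ge0 _ _)) ler_pM ?powR_ge0//.
      by rewrite ler_norml; apply/andP; split; lra.
    exact: ler_npowR.
  by rewrite lerXn2r ?nnegrE// (le_trans _ dk).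
rewrite /regpow2 normrM ler_pM//; first by rewrite ger0_norm; lra.
apply: le_trans (ler_normB _ _) _; apply: lerD.
  rewrite normrM (ger0_norm (ltW C0)) ler_pM2l//.
  apply: le_trans (ler_normD _ _) _; apply: lerD; first by rewrite E2M// pb.
  by rewrite E1M//; apply: le_trans (ler_normD _ _) _; apply: lerD; [exact: sb|exact: pb].
apply: le_trans (ler_normD _ _) _; apply: lerD.
  by rewrite E2M//; apply: le_trans (ler_normD _ _) _; apply: lerD; exact: pb.
rewrite E1M//; do 3 (apply: le_trans (ler_normD _ _) _; apply: lerD; last by [exact: pb|exact: sb]).
exact: sb.
Qed.

Let J t : R := \int[mu]_(x in `[0, 1]) regpow C e a (u 0 t x) (v 0 t x).
Let J1 t : R := \int[mu]_(x in `[0, 1])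
  regpow1 C e a (u 0 t x) (v 0 t x) (- u 1 t x) (- v 1 t x).
Let J2 t : R := \int[mu]_(x in `[0, 1])
  regpow2 C e a (u 0 t x) (v 0 t x) (- u 1 t x) (- v 1 t x) (u 2 t x) (v 2 t x).

Let drv_u1 j t x : is_derive t 1 (fun t => - u j t x) (u j.+1 t x).
Proof. by rewrite -[X in is_derive _ _ _ X]opprK; apply: drvN; exact: drv_dcos_t. Qed.

Let drv_v1 j t x : is_derive t 1 (fun t => - v j t x) (v j.+1 t x).
Proof. by rewrite -[X in is_derive _ _ _ X]opprK; apply: drvN; exact: drv_dsin_t. Qed.

Let uB j t x : (j <= 2)%N -> -1 <= t -> `|u j t x| <= B.
Proof.
move=> j2 t1; apply: le_trans (dcos_bound _ _ _ _ _ t1) _; rewrite /B.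
have := dbound_ge0 M c; move=> h; have := h 0%N; have := h 1%N; have := h 2%N.
by move: j j2 => [|[|[|//]]] _; lra.
Qed.

Let vB j t x : (j <= 2)%N -> -1 <= t -> `|v j t x| <= B.
Proof.
move=> j2 t1; apply: le_trans (dsin_bound _ _ _ _ _ t1) _; rewrite /B.
have := dbound_ge0 M c; move=> h; have := h 0%N; have := h 1%N; have := h 2%N.
by move: j j2 => [|[|[|//]]] _; lra.
Qed.

Let drv_regpow_x t x : is_derive x 1 (fun x => regpow C e a (u 0 t x) (v 0 t x))
  (regpow1 C e a (u 0 t x) (v 0 t x) (- v 1 t x) (u 1 t x)).
Proof. by apply: drv_regpow => //; [exact: drv_dcos_x|exact: drv_dsin_x]. Qed.

Let drv_regpow1_x t x :
  is_derive x 1 (fun x => regpow1 C e a (u 0 t x) (v 0 t x) (- v 1 t x) (u 1 t x))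
  (regpow2 C e a (u 0 t x) (v 0 t x) (- v 1 t x) (u 1 t x) (- u 2 t x) (- v 2 t x)).
Proof.
by apply: drv_regpow1 => //; [exact: drv_dcos_x|exact: drv_dsin_x|
  apply: drvN; exact: drv_dsin_x|exact: drv_dcos_x].
Qed.

Let dJ t : -1 < t -> is_derive t 1 J (J1 t).
Proof.
move=> t1; pose k := 2 * e `^ (a - 1) * B * (C + 1) * (B + B).
apply: (@drv_Rintegral R (fun t x => regpow C e a (u 0 t x) (v 0 t x))
  (fun t x => regpow1 C e a (u 0 t x) (v 0 t x) (- u 1 t x) (- v 1 t x))
  (-1) (t + 1) k) => [|s|s x _|s x /andP[s1 _] _].
- by rewrite t1 ltrDl/=.
- exact: drv_continuousT (drv_regpow_x s).
- by apply: drv_regpow => //; [exact: drv_dcos_t|exact: drv_dsin_t].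
- apply: le_trans (regpow1_bound _ _ (@uB 0%N s x isT (ltW s1)) (@vB 0%N s x isT (ltW s1))) _.
  rewrite ler_wpM2l//.
  rewrite !normrN; apply: lerD; first exact: (@uB 1%N s x isT (ltW s1)).
  exact: (@vB 1%N s x isT (ltW s1)).
Qed.

Let cu j t : continuous (u j t). Proof. exact: continuous_dcos. Qed.
Let cv j t : continuous (v j t). Proof. exact: continuous_dsin. Qed.
Let cNu j t : continuous (fun x => - u j t x).
Proof. exact: ctN. Qed.
Let cNv j t : continuous (fun x => - v j t x).
Proof. exact: ctN. Qed.

Let cJ1 t : continuous
  (fun x => regpow1 C e a (u 0 t x) (v 0 t x) (- u 1 t x) (- v 1 t x)).
Proof. exact: continuous_regpow1. Qed.

Let dJ1 t : -1 < t -> is_derive t 1 J1 (J2 t).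
Proof.
move=> t1; have [k kP] := regpow2_bound (ltW B0).
apply: (@drv_Rintegral R
  (fun t x => regpow1 C e a (u 0 t x) (v 0 t x) (- u 1 t x) (- v 1 t x))
  (fun t x => regpow2 C e a (u 0 t x) (v 0 t x) (- u 1 t x) (- v 1 t x) (u 2 t x) (v 2 t x))
  (-1) (t + 1) k) => [|s|s x _|s x /andP[s1 _] _].
- by rewrite t1 ltrDl/=.
- exact: cJ1.
- by apply: drv_regpow1 => //; [exact: drv_dcos_t|exact: drv_dsin_t].
- by apply: kP; rewrite ?normrN; (apply: uB || apply: vB); rewrite // ltW.
Qed.

(** [phi] is a multiple of [pi / 2], so at the endpoints either all [dcos j] or all [dsin j]
    vanish. *)
Let boundary t x : x = 0 \/ x = 1 ->
  u 0 t x * v 1 t x = 0 /\ v 0 t x * u 1 t x = 0.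
Proof.
move=> x01; have sx (m : nat) : sin (m%:R * pi * x) = 0.
  by case: x01 => ->; rewrite ?mulr0 ?mulr1 ?sin0 ?sin_natpi.
have [s0|s0] := eqVneq (sin phi) 0.
  have vj j : v j t x = 0.
    by rewrite /v /dsin big1// => m _; rewrite sinB sx s0 mul0r mulr0 subrr !mulr0.
  by rewrite !vj mulr0 mul0r.
have cphi : cos phi = 0.
  by move/eqP: cs0; rewrite mulf_eq0 (negbTE s0) orbF => /eqP.
have uj j : u j t x = 0.
  by rewrite /u /dcos big1// => m _; rewrite cosB sx cphi mul0r mulr0 addr0 !mulr0.
by rewrite !uj mulr0 mul0r.
Qed.

(** The second [x]-derivative [h] integrates to 0 by the boundary conditions, so adding it turns the
    integrand of [J2] into the Laplacian, which is nonnegative. *)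
Let J2_ge0 t : 0 <= J2 t.
Proof.
pose h x := regpow2 C e a (u 0 t x) (v 0 t x) (- v 1 t x) (u 1 t x) (- u 2 t x) (- v 2 t x).
have ch : continuous h by exact: continuous_regpow2.
have h0 : \int[mu]_(x in `[0, 1]) h x = 0.
  rewrite (cont_FTC ler01 ch (drv_regpow1_x t)) /regpow1.
  have [a1 b1] := boundary t (or_intror erefl : 1 = 0 \/ 1 = 1 :> R).
  have [a0 b0] := boundary t (or_introl erefl : 0 = 0 \/ 0 = 1 :> R).
  by rewrite !mulrN a1 a0 b1 b0; ring.
have -> : J2 t = \int[mu]_(x in `[0, 1])
    (regpow2 C e a (u 0 t x) (v 0 t x) (- u 1 t x) (- v 1 t x) (u 2 t x) (v 2 t x) + h x).
  rewrite RintegralD//; first by rewrite h0 addr0.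
    by apply: cont_integrable; exact: continuous_regpow2.
  exact: cont_integrable.
by apply: Rintegral_ge0 => x _; exact: regpow_laplacian_ge0.
Qed.

Let J1_homo t t' : 0 <= t -> t <= t' -> J1 t <= J1 t'.
Proof.
move=> t0 tt'; apply: (@drv_ge0_homo R J1 J2 (- 2^-1) (t' + 1)) => //.
- by move=> x /andP[x1 _]; apply: dJ1; lra.
- apply: continuous_in_subspaceT => x; rewrite inE/= in_itv/= => /andP[x1 _].
  by apply: (drv_continuous (dJ1 _)); lra.
- lra.
- lra.
Qed.

(** [J1] is nondecreasing and bounded above by a multiple of [expR (- (pi * t))], so it cannot be
    positive anywhere on [t >= 0]. *)
Let J1_le0 t : 0 <= t -> J1 t <= 0.
Proof.
move=> t0; rewrite leNgt; apply/negP => Jt.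
pose k := 2 * e `^ (a - 1) * B * (C + 1) * (B + B).
have k0 : 0 <= k by exact: mulr_ge0 K0 (addr_ge0 (ltW B0) (ltW B0)).
have pi0 := pi_gt0 R.
have Bj j : (j <= 2)%N -> dbound M c j <= B.
  rewrite /B => j2; have := dbound_ge0 M c; move=> h; have := h 0%N.
  by have := h 1%N; have := h 2%N; move: j j2 => [|[|[|//]]] _; lra.
have bnd t' : 0 <= t' -> J1 t' <= k * expR (- (pi * t')).
  move=> t'0; apply: (@le_trans _ _ (\int[mu]_(x in `[0, 1]) (k * expR (- (pi * t'))))).
    apply: cont_le_Rintegral.
    - exact: cJ1.
    - by move=> x; exact: cvg_cst.
    - move=> x _; apply: le_trans (ler_norm _) _.
      have t'1 : -1 <= t' by lra.
      apply: le_trans (regpow1_bound _ _ (@uB 0%N t' x isT t'1) (@vB 0%N t' x isT t'1)) _.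
      rewrite /k -[leRHS]mulrA ler_wpM2l//.
      rewrite mulrDl !normrN; apply: lerD.
        apply: le_trans (dcos_decay M c phi x t'0 (isT : (0 < 1)%N)) _.
        by rewrite ler_wpM2r ?expR_ge0// Bj.
      apply: le_trans (dsin_decay M 1 x t'0 c0) _.
      by rewrite ler_wpM2r ?expR_ge0// Bj.
  by rewrite Rintegral_itv_cst// subr0 mulr1.
(* At this [T], [expR (pi * T) >= 1 + pi * T] already makes [k * expR (- (pi * T))] smaller than
   [J1 t]. *)
pose T := t + k / (pi * J1 t).
have T0 : t <= T by rewrite lerDl divr_ge0// mulr_ge0 ?ltW.
have := le_trans (J1_homo t0 T0) (bnd T (le_trans t0 T0)).
rewrite expRN ler_pdivlMr ?expR_gt0// leNgt => /negP; apply.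
apply: (@lt_le_trans _ _ (J1 t * (1 + pi * T))); last first.
  by rewrite ler_pM2l// expR_ge1Dx.
have aux (i q r w : R) : 0 < i -> 0 < w -> i * (1 + w * (r + q / (w * i))) = q + i + w * r * i.
  by move=> i0 w0; field; rewrite (gt_eqF i0) (gt_eqF w0).
rewrite /T aux//.
by rewrite -addrA ltrDl ltr_wpDr// mulr_ge0// ?mulr_ge0// ltW.
Qed.

Let J_nincr t : 0 <= t -> J t <= J 0.
Proof.
move=> t0; rewrite -lerN2.
apply: (@drv_ge0_homo R (fun t => - J t) (fun t => - J1 t) 0 t) => //.
- by move=> x /andP[x1 _]; apply/drvN/dJ; lra.
- by move=> x /andP[x1 _]; rewrite oppr_ge0 J1_le0// ltW.
- apply: continuous_in_subspaceT => x; rewrite inE/= in_itv/= => /andP[x1 _].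
  by apply: (drv_continuous (drvN (dJ _))); lra.
Qed.

(** For large [t] the decay of [v] gives [v ^+ 2 <= e]; the second power is then at most 2^a times
    the first one, and 2^a <= 2 <= [C]. *)
Let J_ge0 : exists2 t, 0 <= t & 0 <= J t.
Proof.
have /andP[a1 a2] := a12; have pi0 := pi_gt0 R.
pose k := B / Num.sqrt e.
have k0 : 0 <= k by rewrite divr_ge0// ?sqrtr_ge0 ?(ltW B0).
exists (k / pi); first by rewrite divr_ge0// ltW.
set t := k / pi; have t0 : 0 <= t by rewrite divr_ge0// ltW.
apply: Rintegral_ge0 => x _; rewrite /regpow subr_ge0.
have vt : `|v 0 t x| <= Num.sqrt e.
  apply: le_trans (dsin_decay M 0 x t0 c0) _.
  rewrite expRN ler_pdivrMr ?expR_gt0//.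
  apply: (@le_trans _ _ (Num.sqrt e * (1 + pi * t))); last first.
    by rewrite ler_wpM2l ?sqrtr_ge0// expR_ge1Dx.
  have -> : pi * t = k by rewrite /t mulrC divfK ?gt_eqF.
  rewrite mulrDr mulr1 /k mulrC divfK ?sqrtr_eq0 -?ltNge//.
  rewrite (le_trans (_ : _ <= B)) ?lerDr ?sqrtr_ge0// /B.
  by have := dbound_ge0 M c; move=> h; have := h 0%N; have := h 1%N; have := h 2%N; lra.
have ve : v 0 t x ^+ 2 <= e.
  rewrite -real_normK ?num_real// -[leRHS](sqr_sqrtr (ltW e0)).
  by rewrite lerXn2r ?nnegrE ?sqrtr_ge0.
have C2 : 2 <= C by rewrite CE ler_pdivlMr; lra.
have q0 := sqrDe_gt0 (u 0 t x) e0.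
apply: (@le_trans _ _ ((2 * (u 0 t x ^+ 2 + e)) `^ a)).
  apply: ler_ppowR; [lra| |].
    by rewrite ltW// sqr2De_gt0.
  by have := sqr_ge0 (u 0 t x); lra.
rewrite powRM//; last exact: ltW.
apply: ler_wpM2r; first exact: powR_ge0.
by apply: le_trans C2; apply: ler1_powR => //; lra.
Qed.

Lemma regpow_integral_ge0 :
  0 <= \int[mu]_(x in `[0, 1]) regpow C e a (u 0 0 x) (v 0 0 x).
Proof. by have [t t0 Jt] := J_ge0; exact: le_trans (J_nincr t0). Qed.

End riesz.

Section power_facts.
Context {R : realType}.
Implicit Types (x y a r t : R).

Lemma powRD_le (x y a : R) : 0 <= x -> 0 <= y -> 0 < a <= 1 ->
  (x + y) `^ a <= x `^ a + y `^ a.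
Proof.
move=> x0 y0 /andP[a0 a1].
move: x0; rewrite le_eqVlt => /predU1P[<-|x0].
  by rewrite add0r lerDr powR_ge0.
move: y0; rewrite le_eqVlt => /predU1P[<-|y0].
  by rewrite addr0 lerDl powR_ge0.
rewrite -(powR_sub1 a (addr_gt0 x0 y0)) -(powR_sub1 a x0) -(powR_sub1 a y0) mulrDl.
by apply: lerD; rewrite ler_pM2l//; apply: ler_npowR; rewrite ?subr_le0// ?lerDl ?lerDr ltW.
Qed.

Lemma powR_small (r eps : R) : 0 < r -> 0 < eps ->
  exists2 d, 0 < d & forall x, 0 <= x -> x <= d -> x `^ r <= eps.
Proof.
move=> r0 e0; exists (eps `^ r^-1); first exact: powR_gt0.
move=> x x0 xd; apply: le_trans (ler_ppowR (ltW r0) x0 xd) _.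
by rewrite -powRrM mulVf ?gt_eqF// powRr1// ltW.
Qed.

Lemma ct_norm_powR (f : R -> R) r : 0 < r -> continuous f ->
  continuous (fun x => `|f x| `^ r).
Proof.
move=> r0 cf; apply: (@ct_comp _ (fun t => `|t| `^ r)) => // x.
have [->|x0] := eqVneq x 0; last first.
  apply: (@continuous_comp _ _ _ (fun t => `|t|) (fun t => t `^ r)).
    exact: norm_continuous.
  by apply: drv_continuous (is_derive1_powR r _); rewrite normr_gt0.
apply/cvgrPdist_le => /= eps e0; rewrite normr0 powR0 ?gt_eqF//.
have [d d0 dP] := powR_small r0 e0.
near=> y; rewrite sub0r normrN ger0_norm ?powR_ge0//; apply: dP => //.
Unshelve. all: by end_near. Qed.

(** Young's inequality for y^a and 1, with the exponents [a^-1] and [(1 - a)^-1]. *)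
Lemma powR_bernoulli (a y : R) : 0 < a <= 1 -> 0 <= y -> y `^ a <= 1 + a * (y - 1).
Proof.
move=> /andP[a0 a1]; rewrite le_eqVlt => /predU1P[<-|y0].
  by rewrite powR0 ?gt_eqF//; lra.
move: a1; rewrite le_eqVlt => /predU1P[->|a1].
  by rewrite powRr1; [lra|exact: ltW].
have q0 : 0 < (1 - a)^-1 by rewrite invr_gt0 subr_gt0.
have p0 : 0 < a^-1 by rewrite invr_gt0.
have := @conjugate_powR R (y `^ a) 1 a^-1 (1 - a)^-1 (powR_ge0 _ _) ler01.
have -> : (y `^ a) `^ a^-1 = y.
  by rewrite -powRrM mulfV ?gt_eqF// powRr1// ltW.
rewrite !invrK powR1 => /(_ p0 q0); rewrite addrC subrK => /(_ erefl); lra.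
Qed.

End power_facts.

Section riesz_inequality.
Context {R : realType}.
Notation mu := (@lebesgue_measure R).

Theorem riesz_le2 (s : R) (M : nat) (c : nat -> R) (phi : R) : 1 < s <= 2 ->
  cos phi * sin phi = 0 -> c 0%N * sin phi = 0 ->
  \int[mu]_(x in `[0, 1]) `|\sum_(m < M) c m * sin (m%:R * pi * x - phi)| `^ s <=
  2 / (s - 1) *
  \int[mu]_(x in `[0, 1]) `|\sum_(m < M) c m * cos (m%:R * pi * x - phi)| `^ s.
Proof.
move=> /andP[s1 s2] cs0 c0; pose a := s / 2; pose C := 2 / (s - 1).
have a12 : 2^-1 < a <= 1 by apply/andP; rewrite /a; split; lra.
have [a1 a2] := andP a12.
have CE : C = 2 / (2 * a - 1) by rewrite /C; congr (_ / _); rewrite /a; field.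
have C0 : 0 < C by rewrite divr_gt0//; lra.
set u := fun x => \sum_(m < M) c m * cos (m%:R * pi * x - phi).
set v := fun x => \sum_(m < M) c m * sin (m%:R * pi * x - phi).
have uE x : dcos M c phi 0 0 x = u x.
  by rewrite /dcos /u; apply: eq_bigr => m _; rewrite mulr0 expR0 mul1r expr0 mulr1.
have vE x : dsin M c phi 0 0 x = v x.
  by rewrite /dsin /v; apply: eq_bigr => m _; rewrite mulr0 expR0 mul1r expr0 mulr1.
have cu : continuous u by rewrite -(_ : dcos M c phi 0 0 = u); [exact: continuous_dcos|exact/funext].
have cv : continuous v by rewrite -(_ : dsin M c phi 0 0 = v); [exact: continuous_dsin|exact/funext].
have s0 : 0 < s by lra.
have cus := ct_norm_powR s0 cu.
have cvs := ct_norm_powR s0 cv.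
have sqE (x : R) : (x ^+ 2) `^ a = `|x| `^ s.
  by rewrite -real_normK ?num_real// -powR_mulrn// -powRrM /a; congr (_ `^ _); field.
apply/ler_addgt0Pr => eps eps0.
have a0 : 0 < a by lra.
(* The regularization [d] is so small that the error it leaves, [C] times d^a, is at most [eps]. *)
have [d d0 dP] := powR_small a0 (divr_gt0 eps0 C0).
have {}dP := dP d (ltW d0) (lexx d).
have := regpow_integral_ge0 M CE d0 a12 cs0 c0.
under eq_Rintegral do rewrite uE vE.
move=> h.
have cp (f : R -> R) : continuous f -> continuous (fun x => (f x ^+ 2 + d) `^ a).
  by move=> cf; apply: ct_powR => [|x]; [exact/ctD/ct_cst/ct_sqr|exact: sqrDe_gt0].
have i1 : \int[mu]_(x in `[0, 1]) `|v x| `^ s <=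
    \int[mu]_(x in `[0, 1]) (C * (`|u x| `^ s + d `^ a)).
  have mI : measurable (`[0, 1] : set (measurableTypeR R)) by [].
  have c1 : continuous (fun x => C * (`|u x| `^ s + d `^ a)).
    exact: (ctM (ct_cst C) (ctD cus (ct_cst (d `^ a)))).
  rewrite -subr_ge0.
  have := RintegralB mI (cont_integrable 0 1 c1) (cont_integrable 0 1 cvs).
  move=> /esym ->.
  apply: le_trans h _; apply: cont_le_Rintegral.
  - have := @cp (fun x => u x) cu => cq.
    have cr : continuous (fun x => (u x ^+ 2 + v x ^+ 2 + d) `^ a).
      by apply: ct_powR => [|x]; [exact: (ctD (ctD (ct_sqr cu) (ct_sqr cv)) (ct_cst d))|exact: sqr2De_gt0].
    exact: (ctB (ctM (ct_cst C) cq) cr).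
  - exact: (ctB (ctM (ct_cst C) (ctD cus (ct_cst (d `^ a)))) cvs).
  (* The first power is split by subadditivity, as [a <= 1]; in the second one [u x ^+ 2 + d] is
     dropped. *)
  - move=> x _; rewrite /regpow; apply: lerB.
      rewrite ler_pM2l// -sqE; apply: powRD_le; rewrite ?sqr_ge0 ?(ltW d0)//.
      by apply/andP; split; lra.
    rewrite -sqE; apply: ler_ppowR; rewrite ?sqr_ge0//; first lra.
    by rewrite addrAC lerDr addr_ge0 ?sqr_ge0// ltW.
apply: le_trans i1 _.
rewrite RintegralZl//; last first.
  by apply: cont_integrable; exact: (ctD cus (ct_cst (d `^ a))).
rewrite RintegralD//; [|exact: cont_integrable|by apply: cont_integrable; exact: ct_cst].
rewrite Rintegral_itv_cst// subr0 mulr1 mulrDr lerD2l mulrC -ler_pdivlMr//.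
Qed.

End riesz_inequality.

(** * The spaces L_s(0, 1) *)

Section lebesgue01_integral.
Context {R : realType}.
Notation mu := (@lebesgue_measure R).
Notation mu01 := (lebesgue01 R).
Local Open Scope ereal_scope.

(** [lebesgue01] is a measure on the whole line. Passing to the closed interval, at the cost of two
    null endpoints, gives access to compactness and to the fundamental theorem of calculus. *)
Lemma ge0_integral_lebesgue01 (f : R -> R) :
  measurable_fun setT f -> (forall x, (0 <= f x)%R) ->
  \int[mu01]_x (f x)%:E = \int[mu]_(x in `[0%R, 1%R]) (f x)%:E.
Proof.
move=> /measurable_EFinP mf f0; pose D : set (measurableTypeR R) := `]0%R, 1%R[%classic.
have mD : measurable D by exact: measurable_itv.
have mDC : measurable (~` D) by exact: measurableC.
rewrite -(setUv D) ge0_integral_setU//; last 3 first.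
- by rewrite setUv.
- by move=> x _; rewrite lee_fin.
- by apply/disj_set2P; rewrite setICr.
rewrite [X in _ + X]null_set_integral//; last 2 first.
- exact: measurable_funTS.
- have -> : mu01 (~` D) = mu (~` D `&` D) by [].
  by rewrite setICl measure0.
rewrite adde0 (@eq_measure_integral _ _ _ D mu); last first.
  by move=> A mA AD; rewrite /= /mrestr; congr (mu _); apply/setIidl.
rewrite -(@integral_itv_bndo_bndc R (BLeft 0%R) 1%R); last exact: measurable_funTS.
by rewrite -(@integral_itv_obnd_cbnd R 0%R (BLeft 1%R)); last exact: measurable_funTS.
Qed.

End lebesgue01_integral.

Section Ls_norm.
Context {R : realType}.
Notation mu := (@lebesgue_measure R).
Notation mu01 := (lebesgue01 R).
Implicit Types (s K a : R) (f g : R -> R).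

Variable s : R.
Hypothesis s1 : 1 < s.

Let s0 : 0 < s. Proof. exact: lt_trans s1. Qed.

Definition inLs f : Prop := f \in Lfun mu01 s%:E.

(** [fine] sends an infinite norm to 0, so this is the norm for functions satisfying [inLs]. *)
Definition nrm f : R := fine 'N[mu01]_s%:E[EFin \o f]%E.

Let powf f x : R := `|f x| `^ s.

Lemma measurable_norm_powR f : measurable_fun setT f -> measurable_fun setT (powf f).
Proof.
move=> mf; apply: (@measurableT_comp _ _ _ _ _ _ (@powR R ^~ s)) => //.
exact: measurableT_comp.
Qed.

Lemma Lnorm01E f : measurable_fun setT f ->
  'N[mu01]_s%:E[EFin \o f]%E = ((\int[mu]_(x in `[0%R, 1%R]) (powf f x)%:E) `^ s^-1)%E.
Proof.
move=> mf; rewrite unlock /Lnorm -(ge0_integral_lebesgue01 (measurable_norm_powR mf))//.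
by move=> x; exact: powR_ge0.
Qed.

Lemma integrable_powf f : measurable_fun setT f ->
  mu.-integrable `[0, 1] (EFin \o powf f) <->
  (\int[mu]_(x in `[0%R, 1%R]) (powf f x)%:E < +oo)%E.
Proof.
move=> mf; have mp : measurable_fun `[0 : R, 1] (EFin \o powf f).
  by apply/measurable_EFinP; apply: measurable_funTS; exact: measurable_norm_powR.
have E : (\int[mu]_(x in `[0%R, 1%R]) `|(EFin \o powf f) x| =
    \int[mu]_(x in `[0%R, 1%R]) (powf f x)%:E)%E.
  by apply: eq_integral => x _; rewrite gee0_abs// lee_fin powR_ge0.
split; first by move=> /integrableP[_]; rewrite E.
by move=> h; apply/integrableP; split => //; rewrite E.
Qed.

Lemma inLsP f : inLs f <->
  measurable_fun setT f /\ mu.-integrable `[0, 1] (EFin \o powf f).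
Proof.
rewrite /inLs; split.
  rewrite inE => /andP[]; rewrite inE => mf; rewrite inE/= /finite_norm Lnorm01E// => lf.
  split => //; apply/integrable_powf => //.
  by move: lf; apply: lty_poweRy; rewrite gt_eqF// invr_gt0.
move=> [mf /integrable_powf if_]; rewrite inE; apply/andP; rewrite !inE/=; split => //.
by rewrite /finite_norm Lnorm01E// poweR_lty// if_.
Qed.

Lemma Lnorm_nrm f : inLs f -> 'N[mu01]_s%:E[EFin \o f]%E = (nrm f)%:E.
Proof.
rewrite /inLs inE => /andP[_]; rewrite inE/= /finite_norm => lf.
by rewrite /nrm fineK// ge0_fin_numE// Lnorm_ge0.
Qed.

Lemma nrm_ge0 f : 0 <= nrm f.
Proof. by rewrite fine_ge0// Lnorm_ge0. Qed.

Lemma nrmE f : inLs f -> nrm f = (\int[mu]_(x in `[0, 1]) `|f x| `^ s) `^ s^-1.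
Proof.
move=> /inLsP[mf if_]; rewrite /nrm Lnorm01E//.
have /integrable_fin_num := if_; move=> /(_ (measurable_itv _)) fn.
by rewrite -(fineK fn) poweR_EFin.
Qed.

Lemma nrm_powR f : inLs f -> nrm f `^ s = \int[mu]_(x in `[0, 1]) `|f x| `^ s.
Proof.
move=> lf; rewrite nrmE// -powRrM mulVf ?gt_eqF// powRr1//.
by apply: Rintegral_ge0 => x _; exact: powR_ge0.
Qed.

Lemma inLs_measurable f : inLs f -> measurable_fun setT f.
Proof. by move=> /inLsP[]. Qed.

Lemma inLsD f g : inLs f -> inLs g -> inLs (fun x => f x + g x).
Proof.
have le1s : (1%E <= s%:E)%E by rewrite lee_fin ltW.
move=> lf lg; rewrite /inLs (_ : (fun x => _) = f + g)//.
have [_] := @Lfun_addr_closed _ _ R mu01 _ le1s; exact.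
Qed.

Lemma inLsZ a f : inLs f -> inLs (fun x => a * f x).
Proof.
move=> lf; have := @Lfun_scale _ _ R mu01 f a s (ltW s1) lf.
by rewrite /inLs (_ : a \o* f = (fun x => a * f x))//; apply/funext => x /=; rewrite mulrC.
Qed.

Lemma nrmZ a f : inLs f -> nrm (fun x => a * f x) = `|a| * nrm f.
Proof.
move=> lf; rewrite nrmE; last exact: inLsZ.
under eq_Rintegral do rewrite normrM powRM//.
have [_ if_] := (inLsP f).1 lf.
rewrite RintegralZl// powRM ?powR_ge0//; last first.
  by apply: Rintegral_ge0 => x _; exact: powR_ge0.
by rewrite -nrmE// -powRrM mulfV ?gt_eqF// powRr1.
Qed.

Lemma inLsN f : inLs f -> inLs (fun x => - f x).
Proof. by move=> /(inLsZ (-1)); under eq_fun do rewrite mulN1r. Qed.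

Lemma inLsB f g : inLs f -> inLs g -> inLs (fun x => f x - g x).
Proof. by move=> lf lg; apply: inLsD => //; exact: inLsN. Qed.

Lemma nrmN f : inLs f -> nrm (fun x => - f x) = nrm f.
Proof.
move=> lf; rewrite (_ : (fun x => - f x) = (fun x => -1 * f x)).
  by rewrite nrmZ// normrN1 mul1r.
by apply/funext => x; rewrite mulN1r.
Qed.

Lemma ler_nrmD f g : inLs f -> inLs g ->
  nrm (fun x => f x + g x) <= nrm f + nrm g.
Proof.
move=> lf lg; rewrite -lee_fin EFinD -!Lnorm_nrm//; last exact: inLsD.
apply: (@minkowski_EFin _ _ _ mu01 f g s); [exact: inLs_measurable|exact: inLs_measurable|].
exact: ltW.
Qed.

Lemma ler_nrmB f g : inLs f -> inLs g ->
  nrm (fun x => f x - g x) <= nrm f + nrm g.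
Proof. by move=> lf lg; rewrite -(nrmN lg); apply: ler_nrmD => //; exact: inLsN. Qed.

Lemma bounded_inLs f K : measurable_fun setT f ->
  (forall x, 0 <= x <= 1 -> `|f x| <= K) -> inLs f /\ nrm f <= K.
Proof.
move=> mf fK; have K0 : 0 <= K by apply: le_trans (fK 0 _); rewrite ?lexx ?ler01.
have lK (x : R) : `[0, 1]%classic x -> powf f x <= K `^ s.
  by rewrite /= in_itv/= => x01; apply: ler_ppowR => //; [exact: ltW|exact: fK].
have iK : mu.-integrable `[0, 1] (EFin \o (fun=> K `^ s)).
  by apply: cont_integrable; exact: ct_cst.
have if_ : mu.-integrable `[0, 1] (EFin \o powf f).
  apply: le_integrable iK => //.
    by apply/measurable_EFinP; apply: measurable_funTS; exact: measurable_norm_powR.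
  by move=> x x01 /=; rewrite lee_fin !ger0_norm ?powR_ge0//; exact: lK.
have lf : inLs f by apply/inLsP.
split => //; rewrite nrmE//.
have -> : K = (K `^ s) `^ s^-1 by rewrite -powRrM mulfV ?gt_eqF// powRr1.
apply: ler_ppowR; first by rewrite invr_ge0 ltW.
  by apply: Rintegral_ge0 => x _; exact: powR_ge0.
have <- : \int[mu]_(x in `[0, 1]) (K `^ s) = K `^ s.
  by rewrite Rintegral_itv_cst// subr0 mulr1.
exact: le_Rintegral.
Qed.

Lemma continuous_measurable f : continuous f -> measurable_fun setT f.
Proof.
by move=> cf; exact: continuous_measurable_fun.
Qed.

Lemma continuous_inLs f : continuous f -> inLs f.
Proof.
move=> cf; apply/inLsP; split; first exact: continuous_measurable.
by apply: cont_integrable; exact: ct_norm_powR.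
Qed.

Lemma nrm_le f K : continuous f -> (forall x, 0 <= x <= 1 -> `|f x| <= K) -> nrm f <= K.
Proof. by move=> cf fK; have [] := bounded_inLs (continuous_measurable cf) fK. Qed.

(** On an interval of finite length, [1 + powf f] dominates the modulus of [f]. *)
Lemma inLs_integrable f : inLs f -> mu.-integrable `[0, 1] (EFin \o f).
Proof.
move=> /inLsP[mf if_].
have i1 : mu.-integrable `[0, 1] (EFin \o (fun x => 1 + powf f x)).
  have c1 : mu.-integrable `[0, 1] (EFin \o (fun=> 1)) by apply: cont_integrable; exact: ct_cst.
  have mI : measurable (`[0, 1] : set (measurableTypeR R)) by [].
  exact: (integrableD mI c1 if_).
apply: le_integrable i1 => //.
  by apply/measurable_EFinP; exact: measurable_funTS.
move=> x _ /=; rewrite lee_fin [leRHS]ger0_norm ?addr_ge0 ?powR_ge0//.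
have [f1|f1] := leP `|f x| 1; first by rewrite ler_wpDr ?powR_ge0.
by rewrite ler_wpDl//; apply: le1r_powR; exact: ltW.
Qed.

End Ls_norm.

Section hoelder01.
Context {R : realType}.
Notation mu := (@lebesgue_measure R).
Notation mu01 := (lebesgue01 R).

Lemma hoelder01 (s s' : R) (f g : R -> R) : 1 < s -> 1 < s' ->
  s^-1 + s'^-1 = 1 -> inLs s f -> inLs s' g ->
  `|\int[mu]_(x in `[0, 1]) (f x * g x)| <= nrm s f * nrm s' g.
Proof.
move=> s1 s'1 ss' lf lg.
have mf := inLs_measurable s1 lf; have mg := inLs_measurable s'1 lg.
have mfg : measurable_fun setT (fun x => f x * g x) by exact: measurable_funM.
have := @hoelder _ _ _ mu01 f g s s' mf mg (lt_trans ltr01 s1) (lt_trans ltr01 s'1) ss'.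
rewrite (Lnorm_nrm lf) (Lnorm_nrm lg) -EFinM Lnorm1.
have -> : (\int[mu01]_x `|(EFin \o (f \* g)%R) x|)%E =
    (\int[mu01]_x (`|f x * g x|%R)%:E)%E by apply: eq_integral.
rewrite ge0_integral_lebesgue01//; last exact: measurableT_comp.
move=> h; have ifg : mu.-integrable `[0, 1] (EFin \o (fun x => f x * g x)).
  apply/integrableP; split.
    by apply/measurable_EFinP; exact: measurable_funTS.
  by apply: le_lt_trans h _; rewrite ltry.
apply: le_trans (le_normr_Rintegral _ ifg) _ => //.
by rewrite -lee_fin /Rintegral fineK//; have /integrable_fin_num := integrable_abse ifg; exact.
Qed.

End hoelder01.

(** * Density of cosine polynomials *)

Section span.
Context {R : realType}.
Variable w : nat -> R -> R.
Implicit Types (f g : R -> R) (x : R).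

Definition spanned f : Prop :=
  exists (M : nat) (c : nat -> R), forall x, f x = \sum_(k < M) c k * w k x.

Lemma spanned_ext f g : f =1 g -> spanned f -> spanned g.
Proof. by move=> fg [M [c fE]]; exists M, c => x; rewrite -fg. Qed.

Lemma spannedD f g : spanned f -> spanned g -> spanned (fun x => f x + g x).
Proof.
have pad (M N : nat) (c : nat -> R) x : (M <= N)%N ->
    \sum_(k < M) c k * w k x = \sum_(k < N) (if (k < M)%N then c k else 0) * w k x.
  move=> MN; rewrite (big_ord_widen N (fun k => c k * w k x))// big_mkcond/=.
  by apply: eq_bigr => i _; case: ifP; rewrite ?mul0r.
move=> [M [c fE]] [N [d gE]]; exists (maxn M N).
exists (fun k => (if (k < M)%N then c k else 0) + (if (k < N)%N then d k else 0)).
move=> x; rewrite fE gE (pad _ _ c x (leq_maxl M N)) (pad _ _ d x (leq_maxr M N)).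
by rewrite -big_split/=; apply: eq_bigr => i _; rewrite mulrDl.
Qed.

Lemma spannedZ a f : spanned f -> spanned (fun x => a * f x).
Proof.
move=> [M [c fE]]; exists M, (fun k => a * c k) => x; rewrite fE mulr_sumr.
by apply: eq_bigr => i _; rewrite mulrA.
Qed.

Lemma spanned_basis k : spanned (w k).
Proof.
exists k.+1, (fun i => (i == k)%:R) => x; rewrite big_ord_recr/= eqxx mul1r big1 ?add0r//.
by move=> i _; rewrite (ltn_eqF (ltn_ord i)) mul0r.
Qed.

Lemma spanned0 : spanned (fun=> 0).
Proof. by exists 0%N, (fun=> 0) => x; rewrite big_ord0. Qed.

End span.

Section cosine_polynomials.
Context {R : realType}.
Implicit Types (f g : R -> R) (x y eps : R).

Definition cosw (k : nat) (x : R) : R := cos (k%:R * pi * x).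

Definition cospoly f : Prop := spanned cosw f.

Lemma cosw0 x : cosw 0 x = 1.
Proof. by rewrite /cosw !mul0r cos0. Qed.

Lemma cosw_le1 k x : `|cosw k x| <= 1.
Proof. exact: cos_max. Qed.

Lemma continuous_cosw k : continuous (cosw k).
Proof. exact: ct_cos (ctM (ct_cst (k%:R * pi)) ct_id). Qed.

Lemma coswM1 k x : cosw k.+1 x * cosw 1 x = 2^-1 * (cosw k.+2 x + cosw k x).
Proof.
rewrite /cosw.
have -> : k.+2%:R * pi * x = k.+1%:R * pi * x + 1%:R * pi * x by rewrite -natr1; ring.
have -> : k%:R * pi * x = k.+1%:R * pi * x - 1%:R * pi * x by rewrite -natr1; ring.
by rewrite cosD cosB; field.
Qed.

Lemma continuous_cospoly f : cospoly f -> continuous f.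
Proof.
move=> [M [c fE]]; rewrite (_ : f = fun x => \sum_(k < M) c k * cosw k x).
  by apply: ct_sum => i; exact: ctM (ct_cst (c i)) (@continuous_cosw i).
exact/funext.
Qed.

Lemma cospoly_cst a : cospoly (fun=> a).
Proof.
apply: (@spanned_ext _ _ (fun x => a * cosw 0 x)); first by move=> x; rewrite cosw0 mulr1.
by apply: spannedZ; exact: spanned_basis.
Qed.

Lemma cospolyM1 f : cospoly f -> cospoly (fun x => f x * cosw 1 x).
Proof.
move=> [M [c fE]]; apply: (@spanned_ext _ _ (fun x => \sum_(k < M) c k * (cosw k x * cosw 1 x))).
  by move=> x; rewrite fE mulr_suml; apply: eq_bigr => i _; rewrite mulrA.
elim: M {fE} => [|M IH].
  by apply: (@spanned_ext _ _ (fun=> 0)) (cospoly_cst 0) => x; rewrite big_ord0.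
apply: (@spanned_ext _ _ (fun x => (\sum_(k < M) c k * (cosw k x * cosw 1 x)) +
    c M * (cosw M x * cosw 1 x))); first by move=> x; rewrite big_ord_recr.
apply: spannedD => //; apply: spannedZ; case: M {IH} => [|M].
  by apply: spanned_ext (spanned_basis cosw 1) => x; rewrite cosw0 mul1r.
apply: (@spanned_ext _ _ (fun x => 2^-1 * (cosw M.+2 x + cosw M x))).
  by move=> x; rewrite coswM1.
by apply: spannedZ; apply: spannedD; exact: spanned_basis.
Qed.

(* Expectation of [phi] under the binomial law with parameters [n] and [y] *)
Fixpoint binavg (n : nat) (phi : nat -> R) (y : R) : R :=
  if n is m.+1 then y * binavg m (fun k => phi k.+1) y + (1 - y) * binavg m phi y
  else phi 0%N.

Lemma ler_binavg n phi psi y : 0 <= y <= 1 ->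
  (forall k, (k <= n)%N -> phi k <= psi k) -> binavg n phi y <= binavg n psi y.
Proof.
move=> /andP[y0 y1]; elim: n phi psi => [|n IH] phi psi h /=; first exact: h.
apply: lerD; apply: ler_wpM2l; rewrite ?subr_ge0//; apply: IH => k kn; apply: h => //.
exact: leqW.
Qed.

(** Mean [n * y] and variance [n * y * (1 - y)] of the binomial law; in the induction the shifted
    argument [k.+1] is absorbed by replacing [c] with [c - 1]. *)
Lemma binavg_sqr n (a b c : R) y :
  binavg n (fun k => a + b * (k%:R - c) ^+ 2) y =
  a + b * ((n%:R * y - c) ^+ 2 + n%:R * (y * (1 - y))).
Proof.
elim: n c => [|n IH] c /=; first by rewrite !mul0r !addr0.
have -> : (fun k : nat => a + b * (k.+1%:R - c) ^+ 2) =
    (fun k : nat => a + b * (k%:R - (c - 1)) ^+ 2).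
  by apply/funext => k; rewrite -natr1; congr (_ + _ * _ ^+ 2); ring.
by rewrite !IH -natr1; ring.
Qed.

Lemma binavgB n phi a y : binavg n (fun k => phi k - a) y = binavg n phi y - a.
Proof. by elim: n phi => [//|n IH] phi /=; rewrite !IH; ring. Qed.

Lemma binavgN n phi y : binavg n (fun k => - phi k) y = - binavg n phi y.
Proof. by elim: n phi => [//|n IH] phi /=; rewrite !IH; ring. Qed.

(** [binavg n phi] is a Bernstein polynomial in its last argument, and multiplication by [cosw 1]
    preserves cosine polynomials. *)
Lemma cospoly_binavg n phi : cospoly (fun x => binavg n phi ((1 + cosw 1 x) / 2)).
Proof.
elim: n phi => [|n IH] phi /=; first exact: cospoly_cst.
have P psi : cospoly (fun x => 2^-1 * (binavg n psi ((1 + cosw 1 x) / 2) * cosw 1 x)).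
  by apply: spannedZ; exact: cospolyM1.
have Q psi : cospoly (fun x => 2^-1 * binavg n psi ((1 + cosw 1 x) / 2)).
  exact: (spannedZ 2^-1 (IH psi)).
have := spannedD (spannedD (Q (fun k => phi k.+1)) (P (fun k => phi k.+1)))
  (spannedD (Q phi) (spannedZ (-1) (P phi))).
by apply: spanned_ext => x; field.
Qed.

Lemma increasing_seq_ge (h : nat -> nat) n : increasing_seq h -> (n <= h n)%N.
Proof.
move=> ih; elim: n => [//|n IH]; apply: leq_ltn_trans IH _.
rewrite ltnNge; apply/negP => hn; have := ih n.+1 n.
by rewrite ltnn => /negbT/negP; apply; exact: hn.
Qed.

Lemma cvg_subseq (u : R ^nat) (l : R) (h : nat -> nat) : increasing_seq h ->
  u @ \oo --> l -> (u \o h) @ \oo --> l.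
Proof.
move=> ih ul; apply: cvg_comp ul => A [N _ NA]; exists N => // n Nn.
by apply: NA; exact: leq_trans Nn (increasing_seq_ge _ ih).
Qed.

Lemma cvg01 (u : R ^nat) (l : R) : (forall n, 0 <= u n <= 1) -> u @ \oo --> l -> 0 <= l <= 1.
Proof.
move=> u01 ul; apply/andP; split.
- by apply: (cvgr_to_ge ul); apply: nearW => n; have /andP[] := u01 n.
- by apply: (cvgr_to_le ul); apply: nearW => n; have /andP[] := u01 n.
Qed.

Lemma bounded01 (u : R ^nat) : (forall n, 0 <= u n <= 1) -> bounded_fun u.
Proof.
move=> u01; exists 1; split; first exact: num_real.
move=> x x1 n _ /=; have /andP[u0 u1] := u01 n.
by rewrite ger0_norm// (le_trans u1)// ltW.
Qed.

Lemma cosw1_inj x y : 0 <= x <= 1 -> 0 <= y <= 1 -> cosw 1 x = cosw 1 y -> x = y.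
Proof.
move=> /andP[x0 x1] /andP[y0 y1]; rewrite /cosw !mul1r => h.
have := @cos_inj R (pi * x) (pi * y); rewrite !in_itv/= => /(_ _ _ h) H.
apply: (mulfI (_ : pi != 0 :> R)); first by rewrite gt_eqF// pi_gt0.
have p0 := pi_ge0 R.
by apply: H; apply/andP; split; rewrite ?mulr_ge0// -[leRHS]mulr1 ler_wpM2l.
Qed.

(** Uniform continuity with a quadratic modulus in the variable [cosw 1], the form that [binavg_sqr]
    can average. If no [K] works, limits [a] and [b] of counterexamples for [K = n] have equal
    cosines, hence coincide, while [f a] and [f b] stay [eps] apart. *)
Lemma cos_modulus f eps : continuous f -> 0 < eps ->
  exists K, forall x y, 0 <= x <= 1 -> 0 <= y <= 1 ->
    `|f x - f y| <= eps + K * (cosw 1 x - cosw 1 y) ^+ 2.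
Proof.
move=> cf e0; apply: contrapT => /forallNP H.
have /choice[w wP] : forall n : nat, exists w : R * R,
    [/\ 0 <= w.1 <= 1, 0 <= w.2 <= 1 &
     eps + n%:R * (cosw 1 w.1 - cosw 1 w.2) ^+ 2 < `|f w.1 - f w.2|].
  move=> n; have /existsNP[x /existsNP[y]] := H n%:R.
  move=> /not_implyP[x01 /not_implyP[y01 /negP]]; rewrite -ltNge => h.
  by exists (x, y).
pose x n := (w n).1; pose y n := (w n).2.
have x01 n : 0 <= x n <= 1 by have [] := wP n.
have y01 n : 0 <= y n <= 1 by have [] := wP n.
have [h ih /cvg_ex[/= a xa]] := bolzano_weierstrass (bounded01 x01).
have [h' ih' /cvg_ex[/= b yb]] :=
  bolzano_weierstrass (bounded01 (fun n => y01 (h n)) : bounded_fun (y \o h)).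
pose k n := h (h' n).
have ik n : (n <= k n)%N.
  exact: leq_trans (increasing_seq_ge n ih') (increasing_seq_ge _ ih).
have xk : (fun n => x (k n)) @ \oo --> a by exact: (cvg_subseq ih' xa).
have yk : (fun n => y (k n)) @ \oo --> b by exact: yb.
have a01 := cvg01 (fun n => x01 (k n)) xk; have b01 := cvg01 (fun n => y01 (k n)) yk.
have cx : (fun n => cosw 1 (x (k n))) @ \oo --> cosw 1 a.
  by apply: continuous_cvg => //; exact: continuous_cosw.
have cy : (fun n => cosw 1 (y (k n))) @ \oo --> cosw 1 b.
  by apply: continuous_cvg => //; exact: continuous_cosw.
have fx : (fun n => f (x (k n))) @ \oo --> f a by apply: continuous_cvg => //; exact: cf.
have fy : (fun n => f (y (k n))) @ \oo --> f b by apply: continuous_cvg => //; exact: cf.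
have df : (fun n => `|f (x (k n)) - f (y (k n))|) @ \oo --> `|f a - f b|.
  by apply: cvg_norm; exact: cvgB.
have dc : (fun n => (cosw 1 (x (k n)) - cosw 1 (y (k n))) ^+ 2) @ \oo -->
    (cosw 1 a - cosw 1 b) ^+ 2.
  by rewrite expr2; under eq_fun do rewrite expr2; apply: cvgM; exact: cvgB.
have lb n : eps + n%:R * (cosw 1 (x (k n)) - cosw 1 (y (k n))) ^+ 2 <=
    `|f (x (k n)) - f (y (k n))|.
  have [_ _ /ltW] := wP (k n); apply: le_trans; rewrite lerD2l.
  by rewrite ler_wpM2r ?sqr_ge0// ler_nat.
have ab : a = b.
  apply: cosw1_inj => //; apply/eqP; rewrite -subr_eq0 -sqrf_eq0; apply/negPn/negP => d0.
  set d := _ ^+ 2 in dc d0; have {}d0 : 0 < d by rewrite lt_neqAle eq_sym d0 sqr_ge0.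
  have nd : \forall n \near \oo, d / 2 <= (cosw 1 (x (k n)) - cosw 1 (y (k n))) ^+ 2.
    by apply: (cvgr_ge d) => //; lra.
  have nf : \forall n \near \oo, `|f (x (k n)) - f (y (k n))| <= `|f a - f b| + 1.
    by apply: (cvgr_le `|f a - f b|) => //; lra.
  have nn : \forall n \near \oo, (`|f a - f b| + 1) / (d / 2) <= n%:R.
    exact: nbhs_infty_ger.
  have [n [] [h1 h2] h3] := @filter_ex _ \oo _ _ (filterI (filterI nd nf) nn).
  have := le_trans (lb n) h2; move: h3; rewrite ler_pdivrMr; last by lra.
  set v := _ ^+ 2 in h1 *; have n0 : 0 <= n%:R :> R by [].
  by nra.
have : eps <= `|f a - f b|.
  apply: (cvgr_to_ge df); apply: nearW => n; apply: le_trans (lb n).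
  by rewrite lerDl mulr_ge0// sqr_ge0.
by rewrite ab subrr normr0 leNgt e0.
Qed.

(** Bernstein's proof of the Weierstrass theorem, in the variable [y = (1 + cosw 1 x) / 2]. *)
Theorem cospoly_dense f eps : continuous f -> 0 < eps ->
  exists2 g, cospoly g & forall x, 0 <= x <= 1 -> `|f x - g x| <= eps.
Proof.
move=> cf e0; have e20 : 0 < eps / 2 by lra.
have [K KP] := cos_modulus cf e20.
have [m mK] : exists m : nat, `|K| / (eps / 2) <= m%:R.
  by exists (Num.bound (`|K| / (eps / 2))); apply/ltW/archi_boundP; rewrite divr_ge0// ltW.
pose n := m.+1; have n0 : 0 < n%:R :> R by [].
(* The point of [0, 1] at which [(1 + cosw 1 x) / 2] equals [k / n]. *)
pose node (k : nat) : R := acos (2 * k%:R / n%:R - 1) / pi.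
pose phi k := f (node k).
exists (fun x => binavg n phi ((1 + cosw 1 x) / 2)); first exact: cospoly_binavg.
move=> x x01; set y := (1 + cosw 1 x) / 2.
have y01 : 0 <= y <= 1.
  by have := cosw_le1 1 x; rewrite ler_norml /y => /andP[? ?]; apply/andP; split; lra.
have pi0 := pi_gt0 R.
have nodeP k : (k <= n)%N -> 0 <= node k <= 1 /\ cosw 1 (node k) = 2 * k%:R / n%:R - 1.
  move=> kn; have k1 : -1 <= (2 * k%:R / n%:R - 1 : R) <= 1.
    have h0 : 0 <= k%:R / n%:R :> R by exact: divr_ge0.
    have h1 : k%:R / n%:R <= 1 :> R by rewrite ler_pdivrMr// mul1r ler_nat.
    by rewrite -mulrA; apply/andP; split; lra.
  split.
    apply/andP; split; first by rewrite divr_ge0 ?acos_ge0// ltW.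
    by rewrite ler_pdivrMr// mul1r acos_lepi.
  by rewrite /cosw /node mul1r mulrC divfK ?gt_eqF// acosK// in_itv.
have dk k : (k <= n)%N ->
    `|phi k - f x| <= eps / 2 + `|K| * (4 / n%:R ^+ 2) * (k%:R - n%:R * y) ^+ 2.
  move=> kn; have [n01 nE] := nodeP _ kn.
  rewrite distrC; apply: le_trans (KP _ _ x01 n01) _; rewrite lerD2l nE.
  have -> : cosw 1 x - (2 * k%:R / n%:R - 1) = - (2 / n%:R * (k%:R - n%:R * y)).
    by rewrite /y; field; rewrite gt_eqF.
  rewrite sqrrN exprMn (_ : (2 / n%:R) ^+ 2 = 4 / n%:R ^+ 2); last by field; rewrite gt_eqF.
  by rewrite mulrA ler_wpM2r ?sqr_ge0// ler_wpM2r ?ler_norm// divr_ge0// exprn_ge0.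
have ub : eps / 2 + `|K| * (4 / n%:R ^+ 2) *
    ((n%:R * y - n%:R * y) ^+ 2 + n%:R * (y * (1 - y))) <= eps.
  have y4 : y * (1 - y) <= 4^-1 by have := sqr_ge0 (y - 2^-1); lra.
  have K1 : `|K| / n%:R <= eps / 2.
    rewrite ler_pdivrMr//; move: mK; rewrite ler_pdivrMr// mulrC => h.
    by apply: le_trans h _; rewrite ler_pM2l// ler_nat.
  rewrite subrr expr0n/= add0r.
  have -> : `|K| * (4 / n%:R ^+ 2) * (n%:R * (y * (1 - y))) =
    `|K| / n%:R * (4 * (y * (1 - y))) by field; rewrite gt_eqF.
  have Kn : 0 <= `|K| / n%:R by rewrite divr_ge0.
  have y0 : 0 <= y * (1 - y) by case/andP: y01 => ? ?; rewrite mulr_ge0// subr_ge0.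
  by nra.
rewrite distrC -binavgB ler_norml; apply/andP; split.
  rewrite lerNl -binavgN; apply: le_trans ub; rewrite -binavg_sqr.
  apply: ler_binavg => // k kn; apply: le_trans (dk _ kn).
  by rewrite -normrN ler_norm.
apply: le_trans ub; rewrite -binavg_sqr; apply: ler_binavg => // k kn.
by apply: le_trans (dk _ kn); exact: ler_norm.
Qed.

End cosine_polynomials.

(** * Partial sums of cosine series *)

Section fourier_coefficients.
Context {R : realType}.
Notation mu := (@lebesgue_measure R).
Implicit Types (f g : R -> R) (x y : R) (k N : nat).

Definition coef f k : R :=
  (if k == 0%N then 1 else 2) * \int[mu]_(x in `[0, 1]) (f x * cosw k x).

Definition psum f N x : R := \sum_(k < N) coef f k * cosw k x.

Lemma continuous_psum f N : continuous (psum f N).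
Proof. by apply: ct_sum => i; exact: ctM (ct_cst _) (@continuous_cosw R i). Qed.

Lemma int_cosw k : \int[mu]_(x in `[0, 1]) cosw k x = (k == 0%N)%:R.
Proof.
case: k => [|k].
  by under eq_Rintegral do rewrite cosw0; rewrite Rintegral_itv_cst// subr0 mul1r.
have k0 : k.+1%:R * pi != 0 :> R by rewrite mulf_neq0// gt_eqF// pi_gt0.
pose F x := (k.+1%:R * pi)^-1 * sin (k.+1%:R * pi * x + 0).
have dF x : is_derive x 1 F (cosw k.+1 x).
  apply: is_derive_eq (drvZ _ (drv_sin_affine (k.+1%:R * pi) 0 x)) _.
  by rewrite mulKf// addr0.
rewrite (cont_FTC ler01 (@continuous_cosw R _) dF) /F !addr0 mulr0 mulr1 sin0.
by rewrite sin_natpi subrr.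
Qed.

(** In truncated subtraction [(j - k) + (k - j)] is the distance of [j] and [k], so no order between
    them is assumed. *)
Lemma coswM j k x : cosw j x * cosw k x =
  2^-1 * (cosw (j + k) x + cosw ((j - k) + (k - j)) x).
Proof.
wlog jk : j k / (k <= j)%N.
  move=> h; have [kj|/ltnW jk] := leqP k j; first exact: h.
  by rewrite mulrC (h _ _ jk) addnC [((j - k) + _)%N]addnC.
rewrite (_ : (k - j = 0)%N) ?addn0; last by apply/eqP; rewrite subn_eq0.
rewrite /cosw natrD natrB//.
have -> : (j%:R + k%:R) * pi * x = j%:R * pi * x + k%:R * pi * x by ring.
have -> : (j%:R - k%:R) * pi * x = j%:R * pi * x - k%:R * pi * x by ring.
by rewrite cosD cosB; field.
Qed.

Lemma coef_cosw j k : coef (cosw j) k = (j == k)%:R.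
Proof.
rewrite /coef; under eq_Rintegral do rewrite coswM.
rewrite RintegralZl//; last first.
  by apply: cont_integrable; exact: ctD (@continuous_cosw R _) (@continuous_cosw R _).
rewrite RintegralD//; [|exact/cont_integrable/continuous_cosw..].
rewrite !int_cosw !addn_eq0 !subn_eq0 -eqn_leq.
case: k => [|k] /=; first by rewrite andbT; case: (j == 0%N) => /=; field.
by rewrite andbF; case: (j == k.+1) => /=; field.
Qed.

Lemma mul_cosw_integrable f k : mu.-integrable `[0, 1] (EFin \o f) ->
  mu.-integrable `[0, 1] (EFin \o (fun x => f x * cosw k x)).
Proof.
move=> if_; have /integrableP[mf _] := if_.
have mI : measurable (`[0, 1] : set (measurableTypeR R)) by [].
apply: (le_integrable mI _ _ if_).
  apply/measurable_EFinP; apply: measurable_funM; first exact/measurable_EFinP.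
  apply: measurable_funTS; apply: continuous_measurable_fun; exact: continuous_cosw.
by move=> x _ /=; rewrite lee_fin normrM ler_piMr// cosw_le1.
Qed.

Lemma coefD f g k : mu.-integrable `[0, 1] (EFin \o f) ->
  mu.-integrable `[0, 1] (EFin \o g) ->
  coef (fun x => f x + g x) k = coef f k + coef g k.
Proof.
move=> if_ ig; rewrite /coef; under eq_Rintegral do rewrite mulrDl.
rewrite RintegralD//; [exact: mulrDr|exact: mul_cosw_integrable|].
exact: mul_cosw_integrable.
Qed.

Lemma coefZ a f k : mu.-integrable `[0, 1] (EFin \o f) ->
  coef (fun x => a * f x) k = a * coef f k.
Proof.
move=> if_; rewrite /coef; under eq_Rintegral do rewrite -mulrA.
rewrite RintegralZl//; first exact: mulrCA.
exact: mul_cosw_integrable.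
Qed.

Lemma coef_sum M (c : nat -> R) k :
  coef (fun x => \sum_(j < M) c j * cosw j x) k = if (k < M)%N then c k else 0.
Proof.
have ip m : mu.-integrable `[0, 1] (EFin \o (fun x => \sum_(j < m) c j * cosw j x)).
  by apply: cont_integrable; apply: ct_sum => i; exact: ctM (ct_cst _) (@continuous_cosw R _).
elim: M => [|M IH].
  rewrite /coef; under eq_Rintegral do rewrite big_ord0 mul0r.
  by rewrite Rintegral_itv_cst// mul0r mulr0.
rewrite (_ : (fun x => _) = (fun x => (\sum_(j < M) c j * cosw j x) + c M * cosw M x)); last first.
  by apply/funext => x; rewrite big_ord_recr.
rewrite coefD//; last first.
  by apply: cont_integrable; exact: ctM (ct_cst _) (@continuous_cosw R _).
rewrite IH coefZ; last exact/cont_integrable/continuous_cosw.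
rewrite coef_cosw ltnS [in RHS]leq_eqVlt eq_sym.
by have [->|kM] := eqVneq k M; rewrite ?ltnn ?mulr1 ?add0r//= mulr0 addr0.
Qed.

Lemma psumD f g N x : mu.-integrable `[0, 1] (EFin \o f) ->
  mu.-integrable `[0, 1] (EFin \o g) ->
  psum (fun x => f x + g x) N x = psum f N x + psum g N x.
Proof.
move=> if_ ig; rewrite /psum -big_split/=; apply: eq_bigr => k _.
by rewrite coefD// mulrDl.
Qed.

End fourier_coefficients.

Section coefficient_bounds.
Context {R : realType}.
Notation mu := (@lebesgue_measure R).
Variables (s : R).
Hypothesis s1 : 1 < s.
Implicit Types (f g : R -> R) (x y : R) (k N : nat).

Lemma ler_nrm f g : inLs s f -> inLs s g ->
  (forall x, 0 <= x <= 1 -> `|f x| <= `|g x|) -> nrm s f <= nrm s g.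
Proof.
move=> lf lg fg; have s0 : 0 < s := lt_trans ltr01 s1.
rewrite (nrmE s1 lf) (nrmE s1 lg); apply: ler_ppowR; first by rewrite invr_ge0 ltW.
  by apply: Rintegral_ge0 => x _; exact: powR_ge0.
have mI : measurable (`[0, 1] : set (measurableTypeR R)) by [].
apply: (le_Rintegral mI ((inLsP s1 f).1 lf).2 ((inLsP s1 g).1 lg).2).
move=> x /=; rewrite in_itv/= => x01; apply: ler_ppowR => //; first exact: ltW.
exact: fg.
Qed.

Lemma conjugate_exponent : 1 < s / (s - 1) /\ s^-1 + (s / (s - 1))^-1 = 1.
Proof.
have sm : 0 < s - 1 by rewrite subr_gt0.
split; first by rewrite ltr_pdivlMr// mul1r; lra.
by field; rewrite !gt_eqF//; lra.
Qed.

Lemma coef_bound f k : inLs s f -> `|coef f k| <= 2 * nrm s f.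
Proof.
move=> lf; have [s'1 ss'] := conjugate_exponent.
rewrite normrM; apply: ler_pM => //.
  by case: ifP => _; rewrite ger0_norm//; lra.
have ck := @continuous_cosw R k.
apply: le_trans (hoelder01 s1 s'1 ss' lf (continuous_inLs s'1 ck)) _.
rewrite ler_piMr ?nrm_ge0//; apply: nrm_le => // x _; exact: cosw_le1.
Qed.

(** The constant grows with [N], but continuity for each fixed [N] is enough to extend a uniform
    bound from a dense subspace. *)
Lemma psum_crude f N : inLs s f -> nrm s (psum f N) <= N%:R * (2 * nrm s f).
Proof.
move=> lf; apply: nrm_le => //; first exact: continuous_psum.
move=> x _; apply: le_trans (ler_norm_sum _ _ _) _.
rewrite -[N in leRHS]card_ord -sum1_card natr_sum mulr_suml; apply: ler_sum => k _.
rewrite mul1r normrM -[leRHS]mulr1; apply: ler_pM => //; first exact: coef_bound.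
exact: cosw_le1.
Qed.

End coefficient_bounds.

Section partial_sums_le2.
Context {R : realType}.
Notation mu := (@lebesgue_measure R).
Implicit Types (f g u v : R -> R) (x y phi : R) (k N : nat).

(** [v] is the conjugate function of the trigonometric polynomial [u]: only nonnegative frequencies
    occur in [u + i * v]. The first condition says that [v] has no constant term. *)
Definition conj_pair phi u v : Prop := exists (M : nat) (c : nat -> R),
  [/\ c 0%N * sin phi = 0,
      forall x, u x = \sum_(m < M) c m * cos (m%:R * pi * x - phi) &
      forall x, v x = \sum_(m < M) c m * sin (m%:R * pi * x - phi)].

Lemma conj_pair_riesz s phi u v : 1 < s <= 2 -> cos phi * sin phi = 0 ->
  conj_pair phi u v -> nrm s v <= (2 / (s - 1)) `^ s^-1 * nrm s u.
Proof.
move=> s12 cs0 [M [c [c0 uE vE]]]; have [s1 s2] := andP s12.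
have s0 : 0 < s := lt_trans ltr01 s1.
have aff (m : nat) : continuous (fun x : R => m%:R * pi * x - phi).
  exact: ctB (ctM (ct_cst _) ct_id) (ct_cst phi).
have cu : continuous u.
  rewrite (_ : u = fun x => \sum_(m < M) c m * cos (m%:R * pi * x - phi)); last exact/funext.
  by apply: ct_sum => i; exact: ctM (ct_cst _) (ct_cos (aff i)).
have cv : continuous v.
  rewrite (_ : v = fun x => \sum_(m < M) c m * sin (m%:R * pi * x - phi)); last exact/funext.
  by apply: ct_sum => i; exact: ctM (ct_cst _) (ct_sin (aff i)).
have k0 : 0 <= 2 / (s - 1) by rewrite divr_ge0//; lra.
rewrite (nrmE s1 (continuous_inLs s1 cv)) (nrmE s1 (continuous_inLs s1 cu)).
rewrite -powRM//; last by apply: Rintegral_ge0 => x _; exact: powR_ge0.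
apply: ler_ppowR; first by rewrite invr_ge0 ltW.
  by apply: Rintegral_ge0 => x _; exact: powR_ge0.
under eq_Rintegral do rewrite vE.
by under [X in _ <= _ * X]eq_Rintegral do rewrite uE; exact: riesz_le2.
Qed.

Lemma conj_pairD phi u v u' v' : conj_pair phi u v -> conj_pair phi u' v' ->
  conj_pair phi (fun x => u x + u' x) (fun x => v x + v' x).
Proof.
have ext (M N : nat) (c : nat -> R) (t : nat -> R) : (M <= N)%N ->
    \sum_(k < M) c k * t k = \sum_(k < N) (if (k < M)%N then c k else 0) * t k.
  move=> MN; rewrite (big_ord_widen N (fun k => c k * t k))// big_mkcond/=.
  by apply: eq_bigr => i _; case: ifP; rewrite ?mul0r.
move=> [M [c [c0 uE vE]]] [N [d [d0 u'E v'E]]]; exists (maxn M N).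
exists (fun k => (if (k < M)%N then c k else 0) + (if (k < N)%N then d k else 0)).
split.
- by rewrite mulrDl; do 2 case: ifP => _; rewrite ?mul0r ?c0 ?d0 addr0.
- move=> x; rewrite uE u'E.
  rewrite (ext _ _ c (fun k => cos (k%:R * pi * x - phi)) (leq_maxl M N)).
  rewrite (ext _ _ d (fun k => cos (k%:R * pi * x - phi)) (leq_maxr M N)).
  by rewrite -big_split/=; apply: eq_bigr => i _; rewrite mulrDl.
- move=> x; rewrite vE v'E.
  rewrite (ext _ _ c (fun k => sin (k%:R * pi * x - phi)) (leq_maxl M N)).
  rewrite (ext _ _ d (fun k => sin (k%:R * pi * x - phi)) (leq_maxr M N)).
  by rewrite -big_split/=; apply: eq_bigr => i _; rewrite mulrDl.
Qed.

Lemma conj_pairZ phi a u v : conj_pair phi u v ->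
  conj_pair phi (fun x => a * u x) (fun x => a * v x).
Proof.
move=> [M [c [c0 uE vE]]]; exists M, (fun k => a * c k); split.
- by rewrite -mulrA c0 mulr0.
- by move=> x; rewrite uE mulr_sumr; apply: eq_bigr => i _; rewrite mulrA.
- by move=> x; rewrite vE mulr_sumr; apply: eq_bigr => i _; rewrite mulrA.
Qed.

Lemma conj_pair0 phi : conj_pair phi (fun=> 0) (fun=> 0).
Proof. by exists 0%N, (fun=> 0); split => *; rewrite ?mul0r ?big_ord0. Qed.

Lemma conj_pair_sum phi M (c : nat -> R) (u v : nat -> R -> R) :
  (forall k, conj_pair phi (u k) (v k)) ->
  conj_pair phi (fun x => \sum_(k < M) c k * u k x) (fun x => \sum_(k < M) c k * v k x).
Proof.
move=> h; elim: M => [|M IH].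
  by under eq_fun do rewrite big_ord0; under [X in conj_pair _ _ X]eq_fun do rewrite big_ord0;
    exact: conj_pair0.
under eq_fun do rewrite big_ord_recr; under [X in conj_pair _ _ X]eq_fun do rewrite big_ord_recr.
by apply: conj_pairD => //; exact: conj_pairZ.
Qed.

Lemma conj_pair_ext phi u v u' v' : u =1 u' -> v =1 v' -> conj_pair phi u v ->
  conj_pair phi u' v'.
Proof. by move=> /funext -> /funext ->. Qed.

Lemma conj_pair1 phi m : (m == 0%N)%:R * sin phi = 0 ->
  conj_pair phi (fun x => cos (m%:R * pi * x - phi)) (fun x => sin (m%:R * pi * x - phi)).
Proof.
move=> h; have E (t : nat -> R) : t m = \sum_(i < m.+1) (m == i)%:R * t i.
  rewrite big_ord_recr/= eqxx mul1r big1 ?add0r// => i _.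
  by rewrite eq_sym (ltn_eqF (ltn_ord i)) mul0r.
exists m.+1, (fun i => (m == i)%:R); split => //.
- by move=> x; exact: (E (fun i => cos (i%:R * pi * x - phi))).
- by move=> x; exact: (E (fun i => sin (i%:R * pi * x - phi))).
Qed.

Lemma conj_pair_cos (m : nat) : conj_pair 0 (fun x => cos (m%:R * pi * x)) (fun x => sin (m%:R * pi * x)).
Proof.
have := @conj_pair1 0 m; rewrite sin0 mulr0 => /(_ erefl).
by apply: conj_pair_ext => x; rewrite subr0.
Qed.

Lemma conj_pair_sin (m : nat) : m != 0%N ->
  conj_pair (pi / 2) (fun x => sin (m%:R * pi * x)) (fun x => - cos (m%:R * pi * x)).
Proof.
move=> m0; have := @conj_pair1 (pi / 2) m; rewrite (negbTE m0) mul0r => /(_ erefl).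
by apply: conj_pair_ext => x; rewrite ?cosBpihalf ?sinBpihalf.
Qed.

Let theta k x : R := k%:R * pi * x.

(* The conjugates of [cos k t * cos N t] and [cos k t * sin N t] *)
Let conj_cc k N x := 2^-1 * (sin (theta k x + theta N x) +
  (if (k < N)%N then sin (theta N x - theta k x) else sin (theta k x - theta N x))).

Let conj_cs k N x := - (2^-1 * (cos (theta k x + theta N x) +
  (if (k < N)%N then cos (theta N x - theta k x)
   else if (N < k)%N then - cos (theta k x - theta N x) else 0))).

Lemma conj_pair_cos_cos k N : conj_pair 0 (fun x => cos (theta k x) * cos (theta N x))
  (conj_cc k N).
Proof.
have h := conj_pairZ 2^-1 (conj_pairD (conj_pair_cos (k + N)) (conj_pair_cos ((k - N) + (N - k)))).
apply: conj_pair_ext h => x.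
- by have := coswM k N x; rewrite /cosw => ->.
- rewrite natrD mulrDl mulrDl; congr (_ * (_ + _)).
  case: ltnP => [/ltnW|] kN; have := kN; rewrite -subn_eq0 => /eqP ->.
    by rewrite add0n natrB// mulrBl mulrBl.
  by rewrite addn0 natrB// mulrBl mulrBl.
Qed.

Lemma conj_pair_cos_sin k N : (0 < N)%N ->
  conj_pair (pi / 2) (fun x => cos (theta k x) * sin (theta N x))
  (conj_cs k N).
Proof.
move=> N0; have kN0 : (k + N)%N != 0%N by rewrite -lt0n addn_gt0 N0 orbT.
have h1 := conj_pair_sin kN0.
have e1 x : (k + N)%:R * pi * x = theta k x + theta N x by rewrite natrD mulrDl mulrDl.
have [kN|Nk|kN] := ltngtP k N.
- rewrite /conj_cs kN.
  have d0 : (N - k)%N != 0%N by rewrite -lt0n subn_gt0.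
  apply: conj_pair_ext (conj_pairZ 2^-1 (conj_pairD h1 (conj_pair_sin d0))) => x.
    rewrite e1 natrB 1?ltnW// mulrBl mulrBl -/(theta k x) -/(theta N x).
    by rewrite sinD sinB; field.
  rewrite e1 natrB 1?ltnW// mulrBl mulrBl -/(theta k x) -/(theta N x).
  by field.
- rewrite /conj_cs ltnNge (ltnW Nk) Nk /=.
  have d0 : (k - N)%N != 0%N by rewrite -lt0n subn_gt0.
  apply: conj_pair_ext (conj_pairZ 2^-1 (conj_pairD h1 (conj_pairZ (-1) (conj_pair_sin d0)))) => x.
    rewrite e1 natrB 1?ltnW// mulrBl mulrBl -/(theta k x) -/(theta N x).
    by rewrite sinD sinB; field.
  rewrite e1 natrB 1?ltnW// mulrBl mulrBl -/(theta k x) -/(theta N x).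
  by field.
- subst k; rewrite /conj_cs ltnn.
  apply: conj_pair_ext (conj_pairZ 2^-1 h1) => x.
    by rewrite e1 sinD; field.
  by rewrite e1; field.
Qed.

(** For [N < k] the conjugation acts on the faster factor [cos (theta k x)] alone, and the two
    modulated terms cancel. For [k < N] it acts on the factor of frequency [N], and they recombine
    because squared sine and cosine add up to 1. At [k = N] half of the term survives. *)
Lemma truncation_identity k N x :
  sin (theta N x) * conj_cc k N x - cos (theta N x) * conj_cs k N x =
  (if (k < N)%N then 1 else if (N < k)%N then 0 else 2^-1) * cos (theta k x).
Proof.
have sb : sin (theta N x) ^+ 2 = 1 - cos (theta N x) ^+ 2.
  by rewrite -(cos2Dsin2 (theta N x)) addrC addKr.
rewrite /conj_cc /conj_cs; have [kN|Nk|->] := ltngtP k N; rewrite ?sinD ?cosD ?sinN ?cosN.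
- move: (cos (theta k x)) (sin (theta k x)) (cos (theta N x)) (sin (theta N x)) sb => a b c d sb.
  by transitivity (a * (d ^+ 2 + c ^+ 2)); [field|rewrite sb; ring].
- move: (cos (theta k x)) (sin (theta k x)) (cos (theta N x)) (sin (theta N x)) => a b c d; by field.
- move: (cos (theta N x)) (sin (theta N x)) sb => p q sb.
  by transitivity (2^-1 * p * (q ^+ 2 + p ^+ 2)); [field|rewrite sb; ring].
Qed.

Lemma psum_cospoly_bound s : 1 < s <= 2 -> exists2 C, 0 <= C &
  forall f N, cospoly f -> nrm s (psum f N) <= C * nrm s f.
Proof.
move=> s12; have [s1 s2] := andP s12.
pose K := (2 / (s - 1)) `^ s^-1.
have K0 : 0 <= K by exact: powR_ge0.
exists (2 * K + 1); first by lra.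
move=> f N pf; have cf := continuous_cospoly pf; have [M [c fE]] := pf.
have lf : inLs s f by exact: continuous_inLs.
have [->|N0] := posnP N.
  apply: (@le_trans _ _ 0); last by rewrite mulr_ge0 ?nrm_ge0//; lra.
  apply: nrm_le => //; first exact: continuous_psum.
  by move=> x _; rewrite /psum big_ord0 normr0.
have ct k : continuous (theta k) by exact: (ctM (ct_cst _) ct_id).
pose u1 x := f x * cos (theta N x); pose u2 x := f x * sin (theta N x).
have cu1 : continuous u1 by exact: ctM cf (ct_cos (ct N)).
have cu2 : continuous u2 by exact: ctM cf (ct_sin (ct N)).
have h1 := conj_pair_sum M c (conj_pair_cos_cos^~ N).
have h2 := conj_pair_sum M c (fun k => conj_pair_cos_sin k N0).
pose v1 x := \sum_(k < M) c k * conj_cc k N x.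
pose v2 x := \sum_(k < M) c k * conj_cs k N x.
have {}h1 : conj_pair 0 u1 v1.
  apply: (conj_pair_ext _ _ h1) => // x; rewrite /u1 fE mulr_suml.
  by apply: eq_bigr => k _; rewrite mulrA.
have {}h2 : conj_pair (pi / 2) u2 v2.
  apply: (conj_pair_ext _ _ h2) => // x; rewrite /u2 fE mulr_suml.
  by apply: eq_bigr => k _; rewrite mulrA.
have cs0 : cos 0 * sin 0 = 0 :> R by rewrite sin0 mulr0.
have cs1 : cos (pi / 2) * sin (pi / 2) = 0 :> R by rewrite cos_pihalf mul0r.
have r1 : nrm s v1 <= K * nrm s u1 := conj_pair_riesz s12 cs0 h1.
have r2 : nrm s v2 <= K * nrm s u2 := conj_pair_riesz s12 cs1 h2.
have ccc k : continuous (conj_cc k N).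
  have c1 := ct_sin (ctD (ct k) (ct N)); have c2 := ct_sin (ctB (ct N) (ct k)).
  have c3 := ct_sin (ctB (ct k) (ct N)).
  by rewrite /conj_cc; case: (k < N)%N; exact: ctM (ct_cst _) (ctD c1 _).
have ccs k : continuous (conj_cs k N).
  have c1 := ct_cos (ctD (ct k) (ct N)); have c2 := ct_cos (ctB (ct N) (ct k)).
  have c3 := ctN (ct_cos (ctB (ct k) (ct N))); have c4 := @ct_cst R 0.
  rewrite /conj_cs; case: (k < N)%N; first exact: ctN (ctM (ct_cst _) (ctD c1 c2)).
  by case: (N < k)%N; exact: ctN (ctM (ct_cst _) (ctD c1 _)).
have cv1 : continuous v1 by apply: ct_sum => k; exact: ctM (ct_cst _) (ccc k).
have cv2 : continuous v2 by apply: ct_sum => k; exact: ctM (ct_cst _) (ccs k).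
pose w1 x := sin (theta N x) * v1 x; pose w2 x := cos (theta N x) * v2 x.
have cw1 : continuous w1 by exact: ctM (ct_sin (ct N)) cv1.
have cw2 : continuous w2 by exact: ctM (ct_cos (ct N)) cv2.
have iL g : continuous g -> inLs s g by exact: continuous_inLs.
have nu1 : nrm s u1 <= nrm s f.
  apply: ler_nrm => //; [exact: iL|move=> x _].
  by rewrite normrM ler_piMr// cos_max.
have nu2 : nrm s u2 <= nrm s f.
  apply: ler_nrm => //; [exact: iL|move=> x _].
  by rewrite normrM ler_piMr// sin_max.
have nw1 : nrm s w1 <= nrm s v1.
  apply: ler_nrm => //; [exact: iL|exact: iL|move=> x _].
  by rewrite normrM ler_piMl// sin_max.
have nw2 : nrm s w2 <= nrm s v2.
  apply: ler_nrm => //; [exact: iL|exact: iL|move=> x _].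
  by rewrite normrM ler_piMl// cos_max.
(* [psum f N] stops before [N], while [w1 - w2] retains half of the term of frequency [N]; [w3]
   removes it, and [coef_bound] makes its norm at most [nrm s f]. *)
pose w3 x := (- 2^-1 * coef f N) * cosw N x.
have cw3 : continuous w3 by exact: ctM (ct_cst _) (@continuous_cosw R N).
have cN : coef f N = if (N < M)%N then c N else 0.
  by rewrite (_ : f = fun x => \sum_(j < M) c j * cosw j x) ?coef_sum//; exact/funext.
have cofE k : coef f k = if (k < M)%N then c k else 0.
  by rewrite (_ : f = fun x => \sum_(j < M) c j * cosw j x) ?coef_sum//; exact/funext.
have E x : psum f N x = (w1 x - w2 x) + w3 x.
  pose chi k : R := if (k < N)%N then 1 else if (N < k)%N then 0 else 2^-1.
  have -> : w1 x - w2 x = \sum_(k < M) c k * (chi k * cosw k x).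
    rewrite /w1 /w2 /v1 /v2 !mulr_sumr -sumrB; apply: eq_bigr => k _.
    rewrite /chi -truncation_identity; ring.
  (* Padding with zero coefficients lets the sum be cut at [N.+1] whatever the order of [M] and
     [N]. *)
  have -> : \sum_(k < M) c k * (chi k * cosw k x) =
      \sum_(k < M + N.+1) coef f k * (chi k * cosw k x).
    rewrite big_split_ord/= [X in _ = _ + X]big1 ?addr0.
      by apply: eq_bigr => k _; rewrite cofE ltn_ord.
    by move=> k _; rewrite cofE ltnNge leq_addr mul0r.
  rewrite addnC big_split_ord/= [X in _ + X + _]big1 ?addr0; last first.
    move=> k _; have h : (N < N.+1 + k)%N by exact: leq_addr.
    by rewrite /chi ltnNge (ltnW h)/= h mul0r mulr0.
  rewrite big_ord_recr/= /chi ltnn /psum /w3.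
  under [in RHS]eq_bigr => k _ do rewrite ltn_ord mul1r.
  by ring.
rewrite (_ : psum f N = fun x => (w1 x - w2 x) + w3 x); last exact/funext.
have n3 : nrm s w3 <= nrm s f.
  rewrite nrmZ//; last by apply: iL; exact: continuous_cosw.
  have cw : nrm s (cosw N) <= 1.
    by apply: nrm_le => //; [exact: continuous_cosw|move=> x _; exact: cosw_le1].
  rewrite (normrM (- 2^-1)) normrN (@ger0_norm _ 2^-1) ?invr_ge0//.
  have cb := coef_bound s1 N lf.
  have := nrm_ge0 s (cosw N : R -> R); have := normr_ge0 (coef f N).
  by nra.
apply: le_trans (ler_nrmD s1 (iL _ (ctB cw1 cw2)) (iL _ cw3)) _.
have := ler_nrmB s1 (iL _ cw1) (iL _ cw2).
have : K * nrm s u1 <= K * nrm s f by rewrite ler_wpM2l.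
have : K * nrm s u2 <= K * nrm s f by rewrite ler_wpM2l.
lra.
Qed.

End partial_sums_le2.

(** * Density of cosine polynomials in L_s *)

Section density.
Context {R : realType}.
Notation mu := (@lebesgue_measure R).
Variables (s : R).
Hypothesis s1 : 1 < s.
Implicit Types (f g : R -> R) (x y eps : R).

Let s0 : 0 < s. Proof. exact: lt_trans s1. Qed.

Definition clip (b y : R) : R := Num.max (- b) (Num.min y b).

Lemma clip_bound b y : 0 <= b -> `|clip b y| <= b.
Proof.
move=> b0; rewrite ler_norml /clip le_max lexx/= ge_max ge_min lexx orbT andbT.
lra.
Qed.

Lemma clip_id b y : `|y| <= b -> clip b y = y.
Proof.
by rewrite ler_norml => /andP[h1 h2]; rewrite /clip (min_idPl h2) (max_idPr h1).
Qed.

Lemma clip_dist b y z : `|clip b y - clip b z| <= `|y - z|.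
Proof.
have minL u v w : `|Num.min u w - Num.min v w| <= `|u - v| :> R.
  by case: (leP u w) => h1; case: (leP v w) => h2; rewrite ?subrr ?normr0//;
    rewrite ler_norml ler_normr; apply/andP; split; try (apply/orP; ((left; lra) || (right; lra)));
    case: (lerP 0 (u - v)) => h3; rewrite ?(ger0_norm h3) ?(ltr0_norm h3); lra.
have maxL u v w : `|Num.max w u - Num.max w v| <= `|u - v| :> R.
  by case: (leP w u) => h1; case: (leP w v) => h2; rewrite ?subrr ?normr0//;
    case: (lerP 0 (u - v)) => h3; rewrite ?(ger0_norm h3) ?(ltr0_norm h3) ler_norml; apply/andP; split; lra.
by apply: le_trans (maxL _ _ _) (minL _ _ _).
Qed.

Lemma clip_defect b y : 0 <= b -> `|y - clip b y| <= `|y|.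
Proof.
move=> b0; have [yb|yb] := leP `|y| b; first by rewrite clip_id// subrr normr0.
have [y0|y0] := leP 0 y.
  have by_ : b <= y by move: yb; rewrite ger0_norm// => /ltW.
  rewrite /clip (min_idPr by_) (max_idPr _); last lra.
  by rewrite !ger0_norm//; lra.
have by_ : y < - b by move: yb; rewrite ltr0_norm//; lra.
rewrite /clip (min_idPl _); last lra.
rewrite (max_idPl _); last exact: ltW.
by rewrite !ltr0_norm//; lra.
Qed.

Lemma continuous_clip b : continuous (clip b).
Proof.
move=> y; apply/cvgrPdist_le => /= e e0; near=> z.
apply: le_trans (clip_dist b y z) _; near: z; exact: cvgr_dist_le.
Unshelve. all: by end_near. Qed.

(** Dominated convergence: at each point the clipping error is eventually 0, and it never exceeds
    the modulus of [f]. *)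
Lemma truncation_dense f eps : inLs s f -> 0 < eps ->
  exists2 b, 0 < b & nrm s (fun x => f x - clip b (f x)) <= eps.
Proof.
move=> lf e0; have [mf if_] := (inLsP s1 f).1 lf.
have mI : measurable (`[0, 1] : set (measurableTypeR R)) by [].
pose h (n : nat) x := `|f x - clip n.+1%:R (f x)| `^ s.
have mc b : measurable_fun setT (fun x => f x - clip b (f x)).
  apply: measurable_funB => //; apply: (@measurableT_comp _ _ _ _ _ _ (clip b)) => //.
  by apply: continuous_measurable_fun; exact: continuous_clip.
have hf (n : nat) x : h n x <= `|f x| `^ s.
  apply: ler_ppowR; [exact: ltW|exact: normr_ge0|].
  exact: clip_defect.
have hcvg x : h n x @[n --> \oo] --> 0.
  apply: cvg_near_cst; near=> n; rewrite /h clip_id ?subrr ?normr0 ?powR0 ?gt_eqF//.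
  apply: (@le_trans _ _ n%:R); last by rewrite ler_nat.
  by near: n; exact: nbhs_infty_ger.
have mh n : measurable_fun `[0 : R, 1] (fun x => (h n x)%:E).
  apply/measurable_EFinP; apply: measurable_funTS.
  exact: measurable_norm_powR.
have hE : (\int[mu]_(x in `[0%R, 1%R]) (h n x)%:E)%E @[n --> \oo] --> 0%E.
  rewrite -(integral0 mu `[0 : R, 1]%classic).
  apply: (@dominated_cvg _ _ _ mu _ mI (fun n x => (h n x)%:E) (fun=> 0%E)
    (fun x => (`|f x| `^ s)%:E) mh) => //.
  - by move=> x _; apply: cvg_EFin; [exact: nearW|exact: hcvg].
  - by move=> n x _; rewrite gee0_abs ?lee_fin ?powR_ge0.
have es0 : 0 < eps `^ s by exact: powR_gt0.
have hE2 : (\int[mu]_(x in `[0, 1]) h n x) @[n --> \oo] --> (0 : R) by apply: fine_cvg.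
have [N _ /(_ N (leqnn N)) /=] := (cvgrPdist_le _ _).1 hE2 _ es0.
rewrite sub0r normrN => hN.
exists N.+1%:R => //.
have lg : inLs s (fun x => f x - clip N.+1%:R (f x)).
  apply/inLsP => //; split; first exact: mc.
  apply: (le_integrable mI _ _ if_); first exact: mh.
  by move=> x _ /=; rewrite lee_fin (ger0_norm (powR_ge0 _ _)) (ger0_norm (powR_ge0 _ _)); exact: (hf N).
have e1 : eps = (eps `^ s) `^ s^-1 by rewrite -powRrM mulfV ?gt_eqF// powRr1// ltW.
rewrite nrmE// [leRHS]e1; apply: ler_ppowR; first by rewrite invr_ge0 ltW.
  by apply: Rintegral_ge0 => x _; exact: powR_ge0.
by apply: le_trans hN; rewrite ler_norm.
Unshelve. all: by end_near. Qed.

(** An L_1 approximation becomes one in L_s once both [f] and the approximant are clipped at [b]: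
    their difference [t - c] is at most [2 * b], so |t - c|^s <= (2 b)^(s-1) |t - c|. *)
Lemma continuous_dense f eps : inLs s f -> 0 < eps ->
  exists2 g, continuous g & nrm s (fun x => f x - g x) <= eps.
Proof.
move=> lf e0; have e20 : 0 < eps / 2 by lra.
have [b b0 fb] := truncation_dense lf e20.
have mf := inLs_measurable s1 lf.
pose t x := clip b (f x).
have mt : measurable_fun setT t.
  apply: (@measurableT_comp _ _ _ _ _ _ (clip b)) => //.
  by apply: continuous_measurable_fun; exact: continuous_clip.
have [lt nt] : inLs s t /\ nrm s t <= b.
  by apply: bounded_inLs => // x _; apply: clip_bound; exact: ltW.
have mI : measurable (`[0, 1] : set (measurableTypeR R)) by [].
have fI : (mu `[0%R, 1%R]%classic < +oo)%E.
  by rewrite lebesgue_measure_itv/= lte_fin ltr01 -EFinB ltry.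
have [g_ [cg ig gE]] := approximation_continuous_integrable mI fI (inLs_integrable s1 lt).
have K0 : 0 < (2 * b) `^ (s - 1) by apply: powR_gt0; lra.
pose d := (eps / 2) `^ s / (2 * b) `^ (s - 1).
have d0 : 0 < d by rewrite divr_gt0// powR_gt0.
have gE2 : (\int[mu]_(x in `[0, 1]) `|t x - g_ n x|) @[n --> \oo] --> (0 : R) by apply: fine_cvg.
have [N _ /(_ N (leqnn N)) /=] := (cvgrPdist_le _ _).1 gE2 _ d0.
rewrite sub0r normrN; set g := g_ N => hN.
pose c x := clip b (g x).
have cc : continuous c by apply: ct_comp; [exact: continuous_clip|exact: cg].
exists c => //.
have cl : inLs s c by exact: continuous_inLs.
have ltc : inLs s (fun x => t x - c x) by exact: inLsB.
have i1 : mu.-integrable `[0, 1] (EFin \o (fun x => t x - g x)).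
  exact: (integrableB mI (inLs_integrable s1 lt) (ig N)).
have n2 : nrm s (fun x => t x - c x) <= eps / 2.
  have e1 : eps / 2 = ((eps / 2) `^ s) `^ s^-1 by rewrite -powRrM mulfV ?gt_eqF// powRr1// ltW.
  rewrite nrmE// [leRHS]e1; apply: ler_ppowR; first by rewrite invr_ge0 ltW.
    by apply: Rintegral_ge0 => x _; exact: powR_ge0.
  apply: (@le_trans _ _ (\int[mu]_(x in `[0, 1]) ((2 * b) `^ (s - 1) * `|t x - g x|))).
    apply: (le_Rintegral mI ((inLsP s1 _).1 ltc).2).
      exact: (integrableZl mI _ (integrable_norm i1)).
    move=> x _; have tb : `|t x| <= b by apply: clip_bound; exact: ltW.
    have cb : `|c x| <= b by apply: clip_bound; exact: ltW.
    have tc : `|t x - c x| <= `|t x - g x|.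
      by rewrite -{1}(clip_id tb) clip_dist.
    have [->|tc0] := eqVneq (t x - c x) 0.
      by rewrite normr0 powR0 ?gt_eqF// mulr_ge0// powR_ge0.
    rewrite -(powR_sub1 s (_ : 0 < `|t x - c x|)) ?normr_gt0// mulrC.
    have sm : 0 <= s - 1 by rewrite subr_ge0 ltW.
    apply: ler_pM tc; [exact: powR_ge0|exact: normr_ge0|].
    apply: (ler_ppowR sm); first exact: normr_ge0.
    by apply: le_trans (ler_normB _ _) _; rewrite [leRHS]mulrDl !mul1r lerD.
  rewrite RintegralZl//; last exact: integrable_norm i1.
  rewrite mulrC -ler_pdivlMr//; apply: le_trans hN.
  apply: le_trans (ler_norm _); rewrite le_eqVlt; apply/orP; left; apply/eqP.
  by [].
rewrite (_ : (fun x => f x - c x) = (fun x => (f x - t x) + (t x - c x))); last first.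
  by apply/funext => x; rewrite addrA subrK.
apply: le_trans (ler_nrmD s1 (inLsB s1 lf lt) ltc) _.
by apply: le_trans (lerD fb n2) _; rewrite -splitr.
Qed.

Lemma cospoly_dense_Ls f eps : inLs s f -> 0 < eps ->
  exists2 g, cospoly g & nrm s (fun x => f x - g x) <= eps.
Proof.
move=> lf e0; have e20 : 0 < eps / 2 by lra.
have [h ch fh] := continuous_dense lf e20.
have [g pg hg] := cospoly_dense ch e20; have cg := continuous_cospoly pg.
exists g => //; have chg := ctB ch cg.
rewrite (_ : (fun x => f x - g x) = (fun x => (f x - h x) + (h x - g x))); last first.
  by apply/funext => x; rewrite addrA subrK.
have lh : inLs s h by exact: continuous_inLs.
apply: le_trans (ler_nrmD s1 (inLsB s1 lf lh) (continuous_inLs s1 chg)) _.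
by apply: le_trans (lerD fh (nrm_le s1 chg hg)) _; rewrite -splitr.
Qed.

End density.

(** * Uniformly bounded partial sums on L_s for every exponent *)

Section bounded_partial_sums.
Context {R : realType}.
Notation mu := (@lebesgue_measure R).
Implicit Types (f g : R -> R) (s x y eps : R).

Lemma psum_extend s (C : R) : 1 < s -> 0 <= C ->
  (forall f N, cospoly f -> nrm s (psum f N) <= C * nrm s f) ->
  forall f N, inLs s f -> nrm s (psum f N) <= C * nrm s f.
Proof.
move=> s1 C0 H f N lf; apply/ler_addgt0Pr => eps eps0.
(* The denominator adds up what [f - g] costs: [2 * N] by [psum_crude], [C] for replacing [nrm s g]
   by [nrm s f], and 1 to keep it positive. *)
pose d := eps / (N%:R * 2 + C + 1).
have D0 : 0 < N%:R * 2 + C + 1 by rewrite ltr_wpDl// addr_ge0// mulr_ge0.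
have d0 : 0 < d by rewrite divr_gt0.
have [g pg fg] := cospoly_dense_Ls s1 lf d0.
have lg : inLs s g := continuous_inLs s1 (continuous_cospoly pg).
have lfg := inLsB s1 lf lg.
have E x : psum f N x = psum (fun x => f x - g x) N x + psum g N x.
  rewrite -(psumD N x (inLs_integrable s1 lfg) (inLs_integrable s1 lg)).
  by congr psum; apply/funext => z; rewrite subrK.
rewrite (_ : psum f N = fun x => psum (fun x => f x - g x) N x + psum g N x); last exact/funext.
have lp h : inLs s (psum h N) by apply: continuous_inLs => //; exact: continuous_psum.
apply: le_trans (ler_nrmD s1 (lp _) (lp _)) _.
have h1 := psum_crude s1 N lfg; have h2 := H g N pg.
have h3 : nrm s g <= nrm s f + d.
  have gE : (fun x => f x - (f x - g x)) = g by apply/funext => x; rewrite subKr.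
  by have := ler_nrmB s1 lf lfg; rewrite gE => /le_trans; apply; rewrite lerD2l.
have h4 : N%:R * (2 * nrm s (fun x => f x - g x)) <= N%:R * 2 * d.
  by rewrite -mulrA ler_wpM2l// ler_wpM2l.
have h5 : C * nrm s g <= C * (nrm s f + d) by rewrite ler_wpM2l.
have h6 : N%:R * 2 * d + C * d + d = eps by rewrite -[X in _ + X]mul1r -!mulrDl mulrC divfK// gt_eqF.
by rewrite mulrDr in h5; lra.
Qed.

Lemma psum_sym f g N : mu.-integrable `[0, 1] (EFin \o f) -> 
  mu.-integrable `[0, 1] (EFin \o g) ->
  \int[mu]_(x in `[0, 1]) (psum f N x * g x) = \int[mu]_(x in `[0, 1]) (f x * psum g N x).
Proof.
have key u v : mu.-integrable `[0, 1] (EFin \o u) -> mu.-integrable `[0, 1] (EFin \o v) ->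
    \int[mu]_(x in `[0, 1]) (v x * psum u N x) = \sum_(k < N) coef u k *
      \int[mu]_(x in `[0, 1]) (v x * cosw k x).
  move=> iu iv; rewrite /psum; elim: N => [|M IH].
    rewrite big_ord0; under eq_Rintegral do rewrite big_ord0 mulr0.
    by rewrite Rintegral_itv_cst// mul0r.
  rewrite big_ord_recr/= -IH -RintegralZl//; last exact: mul_cosw_integrable.
  have im : mu.-integrable `[0, 1] (EFin \o (fun x => v x * psum u M x)).
    have [d [d0 dP]] : exists K, 0 <= K /\ forall x, `|psum u M x| <= K.
      exists (\sum_(k < M) `|coef u k|); split; first exact: sumr_ge0.
      move=> x; apply: le_trans (ler_norm_sum _ _ _) _; apply: ler_sum => k _.
      by rewrite normrM ler_piMr// cosw_le1.
    have mI : measurable (`[0, 1] : set (measurableTypeR R)) by [].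
    have /integrableP[mv _] := iv.
    apply: (le_integrable mI _ _ (integrableZl mI d iv)).
      apply/measurable_EFinP; apply: measurable_funM; first exact/measurable_EFinP.
      apply: measurable_funTS; apply: continuous_measurable_fun; exact: continuous_psum.
    move=> x _ /=; rewrite lee_fin !normrM mulrC.
    by apply: ler_pM => //; apply: le_trans (dP x) _; exact: ler_norm.
  rewrite -RintegralD//; last first.
    have mI : measurable (`[0, 1] : set (measurableTypeR R)) by [].
    exact: (integrableZl mI _ (mul_cosw_integrable M iv)).
  by apply: eq_Rintegral => x _; rewrite big_ord_recr/= mulrDr mulrCA.
move=> if_ ig; rewrite key//; under eq_Rintegral do rewrite mulrC.
rewrite key//; apply: eq_bigr => k _; rewrite /coef; ring.
Qed.

Theorem psum_bound s : 1 < s -> exists2 C, 0 <= C &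
  forall f N, inLs s f -> nrm s (psum f N) <= C * nrm s f.
Proof.
move=> s1; have [s2|s2] := leP s 2.
  have s12 : 1 < s <= 2 by rewrite s1.
  have [C C0 CP] := psum_cospoly_bound s12.
  by exists C => //; exact: psum_extend.
have [s'1 ss'] := conjugate_exponent s1.
set s' := s / (s - 1) in s'1 ss'.
have s'2 : 1 < s' <= 2.
  by rewrite s'1/= /s' ler_pdivrMr; lra.
have [C C0 CP] := psum_cospoly_bound s'2.
have {}CP := psum_extend s'1 C0 CP.
exists C => // f N lf; set h := psum f N.
have s0 : 0 < s by lra.
have ch : continuous h by exact: continuous_psum.
have lh : inLs s h by exact: continuous_inLs.
(* The extremal function for [h] in the inequality of Hoelder: its product with [h] is |h|^s, and
   its [s']-norm is the power [s - 1] of [nrm s h]. By [psum_sym] the partial sum moves from [f]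
   onto it, where the case of exponents at most 2 applies. *)
pose phi x := h x * `|h x| `^ (s - 2).
have cphi : continuous phi by apply: ctM => //; apply: ct_norm_powR => //; lra.
have lphi : inLs s' phi by exact: continuous_inLs.
have absphi x : `|phi x| = `|h x| `^ (s - 1).
  rewrite /phi normrM (ger0_norm (powR_ge0 _ _)).
  have [->|h0] := eqVneq (h x) 0; first by rewrite normr0 mul0r powR0//; lra.
  rewrite -[in RHS](powR_sub1 (s - 1)) ?normr_gt0//; congr (_ * _ `^ _); lra.
have hphi x : h x * phi x = `|h x| `^ s.
  rewrite /phi mulrA -expr2 -real_normK ?num_real//.
  have [->|h0] := eqVneq (h x) 0; first by rewrite normr0 [in RHS]powR0 ?gt_eqF// expr0n/= mul0r.
  by rewrite -powR_mulrn// -powRD ?normr_eq0 ?h0 ?implybT//; congr (_ `^ _); lra.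
have i1 : nrm s h `^ s <= nrm s f * nrm s' (psum phi N).
  rewrite (nrm_powR s1 lh); under eq_Rintegral do rewrite -hphi.
  rewrite (psum_sym N (inLs_integrable s1 lf) (inLs_integrable s'1 lphi)).
  apply: le_trans (ler_norm _) _; apply: hoelder01 => //.
  by apply: continuous_inLs => //; exact: continuous_psum.
have nphi : nrm s' phi = nrm s h `^ (s - 1).
  rewrite (nrmE s'1 lphi); under eq_Rintegral do rewrite absphi -powRrM.
  rewrite (_ : (s - 1) * s' = s); last by rewrite /s'; field; lra.
  rewrite -(nrm_powR s1 lh) -powRrM; congr (_ `^ _); rewrite /s'; field.
  by apply/andP; split; rewrite gt_eqF//; lra.
have [h0|h0] := eqVneq (nrm s h) 0; first by rewrite h0 mulr_ge0// nrm_ge0.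
have hp : 0 < nrm s h by rewrite lt_neqAle eq_sym h0 nrm_ge0.
have hp1 : 0 < nrm s h `^ (s - 1) by exact: powR_gt0.
rewrite -(ler_pM2r hp1) (powR_sub1 s hp).
apply: le_trans i1 _; rewrite -nphi mulrAC mulrC ler_wpM2r ?nrm_ge0//.
exact: CP.
Qed.

End bounded_partial_sums.

(** * Perturbations of the cosine basis *)

Section even_periodic.
Context {R : realType}.
Notation mu := (@lebesgue_measure R).
Implicit Types (f g h : R -> R) (x y eps : R).

Definition even_periodic f := (forall x, f (- x) = f x) /\ (forall x, f (x + 2) = f x).

Lemma even_periodic_cosw k : even_periodic (@cosw R k).
Proof.
split=> x; rewrite /cosw; first by rewrite mulrN cosN.
have -> : k%:R * pi * (x + 2) = k%:R * pi * x + (pi *+ 2) *+ k.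
  by rewrite -mulr_natr -(mulr_natr pi); ring.
exact: (periodicn (@cosD2pi R)).
Qed.

Lemma even_periodic_cospoly f : cospoly f -> even_periodic f.
Proof.
move=> [M [c fE]]; split=> x; rewrite !fE; apply: eq_bigr => k _; congr (_ * _);
  by have [h1 h2] := even_periodic_cosw k; rewrite ?h1 ?h2.
Qed.

(** One [y] serves all even 2-periodic functions, so an inequality between two of them passes from
    [0, 1] to the whole line. *)
Lemma even_periodic_fold x :
  exists2 y, 0 <= y <= 1 & forall f, even_periodic f -> f x = f y.
Proof.
pose k := Num.floor ((x + 1) / 2); pose r := x - 2 * k%:~R.
have /andP[r1 r2] : -1 <= r <= 1.
  have := floor_itv ((x + 1) / 2); rewrite -/k intrD => /andP[h1 h2].
  by apply/andP; split; rewrite /r; lra.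
have fr f : even_periodic f -> f x = f r.
  move=> [_ per]; have pern (n : nat) z : f (z + 2 * n%:R) = f z.
    elim: n => [|n IH]; first by rewrite mulr0 addr0.
    by rewrite -(natr1 n) mulrDr mulr1 addrA per.
  rewrite /r; case: (k) => n; first by rewrite -(pern n (x - _)) subrK.
  by rewrite NegzE intrN mulrN opprK -(pern n.+1 x).
exists `|r|; first by rewrite normr_ge0 ler_norml r1.
move=> f ef; rewrite (fr f ef); have [ev _] := ef.
by have [r0|r0] := leP 0 r; [rewrite ger0_norm|rewrite ltr0_norm// ev].
Qed.

Lemma cosw_dilation j k x : cosw j (k%:R * x) = cosw (j * k) x :> R.
Proof. by rewrite /cosw natrM; congr cos; ring. Qed.

(** No change of variables is made: both integrals agree on each [cosw j], and approximation by
    cosine polynomials, uniform on the whole line by [even_periodic_fold], carries the identity over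
    to [f]. *)
Lemma integral_dilation f k : continuous f -> even_periodic f -> (0 < k)%N ->
  \int[mu]_(x in `[0, 1]) f (k%:R * x) = \int[mu]_(x in `[0, 1]) f x.
Proof.
move=> cf ef k0; apply/eqP; rewrite -subr_eq0 -normr_le0; apply/ler_addgt0Pr => eps e0.
have e20 : 0 < eps / 2 by lra.
have [g pg fg] := cospoly_dense cf e20.
have cg := continuous_cospoly pg.
have fgT x : `|f x - g x| <= eps / 2.
  have [y y01 fold] := even_periodic_fold x.
  by rewrite (fold f ef) (fold g (even_periodic_cospoly pg)) fg.
have ck (h : R -> R) : continuous h -> continuous (fun x => h (k%:R * x)).
  by move=> ch; apply: (ct_comp ch); exact: ctM (ct_cst k%:R) ct_id.
have gk : \int[mu]_(x in `[0, 1]) g (k%:R * x) = \int[mu]_(x in `[0, 1]) g x.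
  have [M [c gE]] := pg; under eq_Rintegral do rewrite gE.
  under [in RHS]eq_Rintegral do rewrite gE.
  elim: M {gE} => [|M IH].
    by under eq_Rintegral do rewrite big_ord0; under [in RHS]eq_Rintegral do rewrite big_ord0.
  under eq_Rintegral do rewrite big_ord_recr/=.
  under [in RHS]eq_Rintegral do rewrite big_ord_recr/=.
  have cS : continuous (fun x => \sum_(i < M) c i * cosw i x).
    by apply: ct_sum => i; exact: ctM (ct_cst _) (@continuous_cosw R _).
  have cM := ctM (ct_cst (c M)) (@continuous_cosw R M).
  rewrite RintegralD//; [|exact/cont_integrable/(ck _ cS)|exact/cont_integrable/(ck _ cM)].
  rewrite RintegralD//; [|exact: cont_integrable|exact: cont_integrable].
  rewrite IH; congr (_ + _).
  rewrite RintegralZl//; last exact/cont_integrable/ck/continuous_cosw.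
  rewrite RintegralZl//; last exact/cont_integrable/continuous_cosw.
  congr (_ * _); under eq_Rintegral do rewrite cosw_dilation.
  by rewrite !int_cosw muln_eq0 [(k == 0)%N]eqn0Ngt k0 orbF.
have bnd (h : R -> R) : continuous h -> (forall x : R, `|h x| <= eps / 2) ->
    `|\int[mu]_(x in `[0, 1]) h x| <= eps / 2.
  have mI : measurable (`[0, 1] : set (measurableTypeR R)) by [].
  move=> ch hb; apply: le_trans (le_normr_Rintegral mI (cont_integrable 0 1 ch)) _ => //.
  apply: le_trans (cont_le_Rintegral (ct_norm ch) (ct_cst (eps / 2)) _) _ => //.
  by rewrite Rintegral_itv_cst// subr0 mulr1.
have b1 := bnd _ (ctB (ck _ cf) (ck _ cg)) (fun x => fgT (k%:R * x)).
have b2 := bnd _ (ctB cf cg) fgT.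
move: b1 b2; rewrite RintegralB//; [|exact/cont_integrable/ck|exact/cont_integrable/ck].
rewrite RintegralB//; [|exact/cont_integrable|exact/cont_integrable].
rewrite gk !ler_norml => /andP[h1 h2] /andP[h3 h4]; apply/andP; split; lra.
Qed.

Lemma nrm_dilation s f k : 1 < s -> continuous f -> even_periodic f -> (0 < k)%N ->
  nrm s (fun x => f (k%:R * x)) = nrm s f.
Proof.
move=> s1 cf ef k0; have s0 : 0 < s := lt_trans ltr01 s1.
have ck : continuous (fun x => f (k%:R * x)).
  by apply: (ct_comp cf); exact: ctM (ct_cst k%:R) ct_id.
rewrite (nrmE s1 (continuous_inLs s1 cf)) (nrmE s1 (continuous_inLs s1 ck)).
have ev : even_periodic (fun x => `|f x| `^ s).
  by have [h1 h2] := ef; split=> x; rewrite ?h1 ?h2.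
by rewrite (integral_dilation (ct_norm_powR s0 cf) ev k0).
Qed.

End even_periodic.

Section triangular_systems.
Context {R : realType}.
Variables (L : nat -> nat -> R).
Hypothesis L0 : forall m, L m m != 0.

(** In the application [L n m] is the [m]-th cosine coefficient of the [n]-th function, zero for
    [m < n], and [b] lists the expansion coefficients of a function with cosine coefficients [a]. *)
Definition solves (a b : nat -> R) := forall m, a m = \sum_(n < m.+1) b n * L n m.

Lemma solves_exists a : exists b, solves a b.
Proof.
pose F m (b : nat -> R) := (a m - \sum_(n < m) b n * L n m) / L m m.
(* Course-of-values recursion: [bs m] is the list of the first [m] unknowns. *)
pose fix bs (m : nat) : seq R := if m is k.+1 then rcons (bs k) (F k (nth 0 (bs k))) else [::].
have size_bs m : size (bs m) = m by elim: m => [//|m IH] /=; rewrite size_rcons IH.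
have stable m k n : (n < m)%N -> nth 0 (bs (m + k)%N) n = nth 0 (bs m) n.
  move=> nm; elim: k => [|k IH]; first by rewrite addn0.
  by rewrite addnS /= nth_rcons size_bs (leq_trans nm) ?leq_addr.
pose b n := nth 0 (bs n.+1) n.
have bE m n : (n < m)%N -> nth 0 (bs m) n = b n.
  by move=> nm; rewrite -(subnKC nm) stable.
exists b => m; rewrite big_ord_recr/=.
have -> : b m = (a m - \sum_(n < m) b n * L n m) / L m m.
  rewrite /b /= nth_rcons size_bs ltnn eqxx /F; congr ((_ - _) / _).
  by apply: eq_bigr => n _; rewrite bE.
by rewrite divfK// addrC subrK.
Qed.

Lemma solves_unique a b c : solves a b -> solves a c -> b = c.
Proof.
move=> sb sc; apply/funext => m; have [k] := ubnP m; elim: k m => // k IH m mk.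
have := sb m; rewrite (sc m) !big_ord_recr/= => h.
have E : \sum_(n < m) b n * L n m = \sum_(n < m) c n * L n m.
  by apply: eq_bigr => n _; rewrite IH// (leq_trans (ltn_ord n)).
by move: h; rewrite E => /addrI /(mulIf (L0 m)).
Qed.

End triangular_systems.

Section sequence_sums.
Context {R : realType}.
Notation mu := (@lebesgue_measure R).
Implicit Types (r : seq nat) (t : nat -> R) (h : nat -> R -> R).

Lemma ct_bigsum r t h : (forall k, continuous (h k)) ->
  continuous (fun x => \sum_(k <- r) t k * h k x).
Proof.
move=> ch; elim: r => [|a r IH].
  by under eq_fun do rewrite big_nil; exact: ct_cst.
by under eq_fun do rewrite big_cons; exact: ctD (ctM (ct_cst _) (ch a)) IH.
Qed.

Lemma coef_bigsum r t h m : (forall k, continuous (h k)) ->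
  coef (fun x => \sum_(k <- r) t k * h k x) m = \sum_(k <- r) t k * coef (h k) m.
Proof.
move=> ch; elim: r => [|a r IH].
  rewrite big_nil /coef; under eq_Rintegral do rewrite big_nil mul0r.
  by rewrite Rintegral_itv_cst// mul0r mulr0.
rewrite big_cons -IH -coefZ; last exact/cont_integrable/ch.
rewrite -coefD; last 2 first.
- exact/cont_integrable/(ctM (ct_cst _) (ch a)).
- exact/cont_integrable/ct_bigsum.
by congr coef; apply/funext => x; rewrite big_cons.
Qed.

Lemma nrm_bigsum s r t h : 1 < s -> (forall k, continuous (h k)) ->
  nrm s (fun x => \sum_(k <- r) t k * h k x) <= \sum_(k <- r) `|t k| * nrm s (h k).
Proof.
move=> s1 ch; elim: r => [|a r IH].
  rewrite big_nil; apply: nrm_le => // [|x _]; last by rewrite big_nil normr0.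
  exact: ct_bigsum.
have l1 := continuous_inLs s1 (ctM (ct_cst (t a)) (ch a)).
have l2 := continuous_inLs s1 (@ct_bigsum r t h ch).
have -> : (fun x => \sum_(k <- a :: r) t k * h k x) =
    (fun x => t a * h a x + \sum_(k <- r) t k * h k x).
  by apply/funext => x; rewrite big_cons.
rewrite big_cons; apply: le_trans (ler_nrmD s1 l1 l2) _.
rewrite (nrmZ s1 (t a) (continuous_inLs s1 (ch a))).
by rewrite lerD2l.
Qed.

Lemma sum_nat_delta (N j : nat) (F : nat -> R) : (0 < j)%N ->
  \sum_(1 <= m < N.+1) (j == m)%:R * F m = if (j <= N)%N then F j else 0.
Proof.
move=> j0; case: ifP => jN.
  rewrite (bigD1_seq j)/=; [|by rewrite mem_index_iota j0 ltnS|exact: iota_uniq].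
  rewrite eqxx mul1r big1 ?addr0// => m mj.
  by rewrite eq_sym (negbTE mj) mul0r.
rewrite big_nat_cond big1// => m; rewrite andbT => /andP[_ mN].
have [jm|_] := eqVneq j m; last by rewrite mul0r.
by move: mN; rewrite -jm ltnS jN.
Qed.

End sequence_sums.

Section perturbation.
Context {R : realType}.
Notation mu := (@lebesgue_measure R).
Variables (s : R) (tau : nat -> R) (q : R) (g : R -> R) (e : nat -> R -> R).
Hypotheses (s1 : 1 < s) (q0 : 0 <= q) (q1 : q < 1) (tau1 : tau 1%N != 0).
Hypothesis tail : forall K, \sum_(2 <= k < K) `|tau k| <= q * `|tau 1%N|.
Hypothesis gE : forall eps : R, 0 < eps -> exists K0, forall K x, (K0 <= K)%N ->
  `|g x - \sum_(1 <= k < K) tau k * cosw k x| <= eps.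
Hypothesis cg : continuous g.
Hypothesis e0E : forall x, e 0 x = 1.
Hypothesis eSE : forall n x, (0 < n)%N -> e n x = g (n%:R * x).
Implicit Types (f v : R -> R) (b c : nat -> R) (n m k N K : nat) (x : R).

Let T1 := `|tau 1%N|.
Let T10 : 0 < T1. Proof. by rewrite normr_gt0. Qed.

Let iL f : continuous f -> inLs s f. Proof. exact: continuous_inLs. Qed.

Let ce n : continuous (e n).
Proof.
case: n => [|n].
  by rewrite (_ : e 0 = fun=> 1); [exact: ct_cst|apply/funext].
rewrite (_ : e n.+1 = fun x => g (n.+1%:R * x)); last by apply/funext => x; rewrite eSE.
by apply: (ct_comp cg); exact: ctM (ct_cst _) ct_id.
Qed.

Let eE n eps : (0 < n)%N -> 0 < eps -> exists K0, forall K x, (K0 <= K)%N ->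
  `|e n x - \sum_(1 <= k < K) tau k * cosw (k * n) x| <= eps.
Proof.
move=> n0 eps0; have [K0 H] := gE eps0; exists K0 => K x KK.
rewrite eSE//; under eq_bigr do rewrite -cosw_dilation; exact: H.
Qed.

Let L n m := coef (e n) m.

Let L0m m : L 0 m = (m == 0%N)%:R.
Proof.
by rewrite /L (_ : e 0 = cosw 0) ?coef_cosw 1?eq_sym//; apply/funext => x; rewrite e0E cosw0.
Qed.

(** Uniform convergence allows taking the coefficient term by term; [k * n = m] forces [k <= m], so
    any [K] above [m] already gives the full sum. *)
Let LE n m K : (0 < n)%N -> (m < K)%N ->
  L n m = \sum_(1 <= k < K) tau k * ((k * n)%N == m)%:R.
Proof.
move=> n0 mK; apply/eqP; rewrite -subr_eq0 -normr_le0; apply/ler_addgt0Pr => eps eps0.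
have e20 : 0 < eps / 2 by lra.
have [K0 H] := eE n0 e20; pose K' := maxn K0 K.
pose h x := e n x + -1 * \sum_(1 <= k < K') tau k * cosw (k * n) x.
have cS : continuous (fun x => \sum_(1 <= k < K') tau k * cosw (k * n) x).
  by apply: ct_bigsum => k; exact: continuous_cosw.
have ch : continuous h by exact: ctD (@ce n) (ctM (ct_cst _) cS).
have nh : nrm s h <= eps / 2.
  apply: nrm_le => // x _; rewrite /h mulN1r; exact/H/leq_maxl.
have := coef_bound s1 m (iL ch); rewrite /h.
rewrite coefD; [|exact/cont_integrable/ce|exact/cont_integrable/(ctM (ct_cst _) cS)].
rewrite coefZ; last exact: cont_integrable.
rewrite coef_bigsum; last by move=> k; exact: continuous_cosw.
have -> : \sum_(1 <= k < K') tau k * coef (cosw (k * n)) m =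
    \sum_(1 <= k < K) tau k * ((k * n)%N == m)%:R.
  under eq_bigr do rewrite coef_cosw.
  rewrite (big_cat_nat _ (n := K))/=; [|exact: leq_trans mK|exact: leq_maxr].
  rewrite [X in _ + X]big_nat_cond [X in _ + X]big1 ?addr0// => k.
  rewrite andbT => /andP[Kk _]; case: eqP => [km|_]; last by rewrite mulr0.
  have : (k <= m)%N by rewrite -km leq_pmulr.
  by rewrite leqNgt (leq_trans mK Kk).
by rewrite mulN1r add0r => /le_trans; apply; lra.
Qed.

Let Ltri n m : (m < n)%N -> L n m = 0.
Proof.
move=> mn; have n0 : (0 < n)%N by exact: leq_ltn_trans mn.
rewrite (LE n0 (ltnSn m)) big_nat_cond big1// => k; rewrite andbT => /andP[k0 _].
case: eqP => [km|_]; last by rewrite mulr0.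
have : (n <= m)%N by rewrite -km leq_pmull.
by rewrite leqNgt mn.
Qed.

Let Ldiag m : L m m != 0.
Proof.
case: m => [|m]; first by rewrite L0m eqxx oner_neq0.
rewrite (LE (isT : (0 < m.+1)%N) (ltnSn m.+1)).
rewrite big_ltn//= mul1n eqxx mulr1 big_nat_cond big1 ?addr0// => k.
rewrite andbT => /andP[k1 _]; case: eqP => [|_]; last by rewrite mulr0.
by move/eqP; rewrite -[X in _ == X]mul1n eqn_pmul2r// => /eqP k1'; move: k1; rewrite k1'.
Qed.

(** When [b] solves the system for [f], this is a partial sum, without constant term, of the formal
    preimage of [f] under [cosw n |-> e n]. *)
Let X b N x := \sum_(1 <= n < N.+1) b n * cosw n x.

Let cX b N : continuous (X b N).
Proof. by apply: ct_bigsum => n; exact: continuous_cosw. Qed.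

Let epX b N : even_periodic (X b N).
Proof.
by split=> x; rewrite /X; apply: eq_bigr => n _; have [h1 h2] := @even_periodic_cosw R n;
  rewrite ?h1 ?h2.
Qed.

(** The condition [k * n <= N] amounts to [n <= N %/ k], so cutting at frequency [N] becomes cutting
    each dilate at [N %/ k]. *)
Let X_identity a b N x : solves L a b ->
  \sum_(1 <= m < N.+1) a m * cosw m x =
  \sum_(1 <= k < N.+1) tau k * X b (N %/ k) (k%:R * x).
Proof.
move=> sol.
transitivity (\sum_(1 <= m < N.+1) \sum_(1 <= n < N.+1) \sum_(1 <= k < N.+1)
    b n * tau k * (((k * n)%N == m)%:R * cosw m x)).
  apply: eq_big_nat => m /andP[m0 mN].
  have -> : a m = \sum_(1 <= n < N.+1) b n * L n m.
    rewrite sol -(big_mkord xpredT (fun n => b n * L n m)).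
    rewrite [RHS](big_cat_nat _ (n := m.+1))//= [X in _ = _ + X]big_nat_cond.
    rewrite [X in _ = _ + X]big1 ?addr0; last first.
      by move=> n; rewrite andbT => /andP[mn _]; rewrite Ltri// mulr0.
    by rewrite big_ltn// L0m (gtn_eqF m0) mulr0 add0r.
  rewrite mulr_suml; apply: eq_big_nat => n /andP[n0 _].
  rewrite (LE n0 mN) mulr_sumr mulr_suml; apply: eq_bigr => k _; ring.
rewrite exchange_big/=; under eq_bigr do rewrite exchange_big/=.
rewrite exchange_big/=; apply: eq_big_nat => k /andP[k0 _].
rewrite /X mulr_sumr [RHS](big_nat_widen _ _ N.+1); last by rewrite ltnS leq_div.
rewrite [RHS]big_mkcond/=; apply: eq_big_nat => n /andP[n0 _].
rewrite -mulr_sumr sum_nat_delta ?muln_gt0 ?k0// ltnS leq_divRL// mulnC.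
by case: ifP => _; [rewrite cosw_dilation mulnC; ring|rewrite mulr0].
Qed.

Variable C : R.
Hypotheses (C0 : 0 <= C)
  (psumC : forall f N, inLs s f -> nrm s (psum f N) <= C * nrm s f).

Let q1' : 0 < 1 - q. Proof. by rewrite subr_gt0. Qed.

(** Fixed point of the inductive estimate: [D f * T1 = (C + 2) * nrm s f + q * T1 * D f], where 2
    accounts for the constant term subtracted from the partial sum. *)
Let D f := (C + 2) * nrm s f / (T1 * (1 - q)).

Let D0 f : 0 <= D f.
Proof.
rewrite /D divr_ge0//; first by rewrite mulr_ge0 ?nrm_ge0// addr_ge0.
by rewrite mulr_ge0 ?(ltW T10) ?(ltW q1').
Qed.

Let coef0_cst f : nrm s (fun=> coef f 0) <= `|coef f 0|.
Proof. by apply: nrm_le => //; exact: ct_cst. Qed.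

(** Strong induction on [N]: isolating [k = 1] in [X_identity] leaves dilates of sums cut at
    [N %/ k < N]. Dilation preserves their norms, and their weights add up to at most [q * T1]. *)
Let X_bound f b N : inLs s f -> solves L (coef f) b -> nrm s (X b N) <= D f.
Proof.
move=> lf sol; have [k] := ubnP N; elim: k N => // k IH N Nk.
have [->|N0] := posnP N.
  apply: le_trans (D0 f); apply: nrm_le => // x _.
  by rewrite /X big_geq// normr0.
pose S x := psum f N.+1 x - coef f 0.
have cS : continuous S by exact: ctB (@continuous_psum R f _) (ct_cst _).
have nS : nrm s S <= (C + 2) * nrm s f.
  apply: le_trans (ler_nrmB s1 (iL (@continuous_psum R f N.+1)) (iL (@ct_cst R (coef f 0)))) _.
  rewrite mulrDl; apply: lerD; first exact: psumC.
  exact: le_trans (coef0_cst f) (coef_bound s1 0 lf).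
pose Y x := \sum_(2 <= k < N.+1) tau k * X b (N %/ k) (k%:R * x).
have cXk k' : continuous (fun x => X b (N %/ k') (k'%:R * x)).
  by apply: (ct_comp (@cX b _)); exact: ctM (ct_cst _) ct_id.
have cY : continuous Y by exact: ct_bigsum.
have nY : nrm s Y <= q * T1 * D f.
  apply: le_trans (nrm_bigsum _ tau s1 cXk) _.
  apply: (@le_trans _ _ (\sum_(2 <= k < N.+1) `|tau k| * D f)).
    rewrite big_nat_cond [leRHS]big_nat_cond; apply: ler_sum => i.
    rewrite andbT => /andP[i2 iN]; apply: ler_wpM2l => //.
    rewrite nrm_dilation//; last exact: ltn_trans i2.
    by apply: IH; rewrite -ltnS (leq_trans _ Nk)// ltnS ltn_Pdiv.
  by rewrite -mulr_suml ler_wpM2r// tail.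
have XE x : X b N x = (tau 1%N)^-1 * (S x - Y x).
  have : S x = tau 1%N * X b N x + Y x.
    have -> : S x = \sum_(1 <= m < N.+1) coef f m * cosw m x.
      rewrite /S /psum -(big_mkord xpredT (fun k => coef f k * cosw k x)).
      by rewrite big_ltn// cosw0 mulr1 addrC addKr.
    rewrite (X_identity N x sol) big_ltn// divn1 mul1r; congr (_ + _).
  by move=> ->; rewrite addrK mulKf.
rewrite (_ : X b N = fun x => (tau 1%N)^-1 * (S x - Y x)); last exact/funext.
have cSY := ctB cS cY; rewrite (nrmZ s1 _ (iL cSY)) normfV -/T1 mulrC ler_pdivrMr//.
apply: le_trans (ler_nrmB s1 (iL cS) (iL cY)) _; apply: le_trans (lerD nS nY) _.
have -> : (C + 2) * nrm s f = D f * (T1 * (1 - q)).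
  by rewrite /D divfK// mulf_neq0// gt_eqF.
by rewrite le_eqVlt; apply/orP; left; apply/eqP; ring.
Qed.

(** Expanding each [e n] in its cosine series turns the sum, up to a uniform error, into dilates of
    [X b N] with weights [tau k] of total mass at most [2 * T1]. *)
Let Q_bound f b N : inLs s f -> solves L (coef f) b ->
  nrm s (fun x => \sum_(1 <= n < N.+1) b n * e n x) <= 2 * T1 * D f.
Proof.
move=> lf sol; apply/ler_addgt0Pr => eps eps0.
pose B := \sum_(1 <= n < N.+1) `|b n|.
have B0 : 0 <= B by exact: sumr_ge0.
have B1 : 0 < B + 1 by rewrite ltr_wpDl.
have [K0 H] := gE (divr_gt0 eps0 B1).
pose K := maxn K0 2; pose Q x := \sum_(1 <= n < N.+1) b n * e n x.
pose Z x := \sum_(1 <= k < K) tau k * X b N (k%:R * x).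
have cXk k' : continuous (fun x => X b N (k'%:R * x)).
  by apply: (ct_comp (@cX b _)); exact: ctM (ct_cst _) ct_id.
have cZ : continuous Z by exact: ct_bigsum.
have cQ : continuous Q by exact: ct_bigsum.
have nZ : nrm s Z <= 2 * T1 * D f.
  apply: le_trans (nrm_bigsum _ tau s1 cXk) _.
  apply: (@le_trans _ _ (\sum_(1 <= k < K) `|tau k| * D f)).
    rewrite big_nat_cond [leRHS]big_nat_cond; apply: ler_sum => i.
    rewrite andbT => /andP[i1 iK]; apply: ler_wpM2l => //.
    by rewrite nrm_dilation//; exact: X_bound.
  rewrite -mulr_suml ler_wpM2r// big_ltn; last by rewrite leq_max orbT.
  have := tail K; rewrite -/T1 => h; have : q * T1 <= T1 by rewrite ler_piMl ?(ltW T10)// ltW.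
  by lra.
have QZ x : `|Q x - Z x| <= eps.
  have -> : Z x = \sum_(1 <= n < N.+1) b n * \sum_(1 <= k < K) tau k * cosw k (n%:R * x).
    rewrite /Z /X; under eq_bigr do rewrite mulr_sumr.
    rewrite exchange_big/=; apply: eq_bigr => n _; rewrite mulr_sumr.
    by apply: eq_bigr => k _; rewrite !cosw_dilation mulnC; ring.
  rewrite /Q -sumrB; apply: le_trans (ler_norm_sum _ _ _) _.
  apply: (@le_trans _ _ (\sum_(1 <= n < N.+1) `|b n| * (eps / (B + 1)))).
    rewrite big_nat_cond [leRHS]big_nat_cond; apply: ler_sum => n.
    rewrite andbT => /andP[n1 _]; rewrite -mulrBr normrM ler_wpM2l// eSE//.
    by apply: H; exact: leq_maxl.
  rewrite -mulr_suml -/B mulrCA ler_piMr ?(ltW eps0)//.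
  by rewrite ler_pdivrMr// mul1r lerDl.
rewrite (_ : (fun x => _) = fun x => Z x + (Q x - Z x)); last first.
  by apply/funext => x; rewrite addrC subrK.
apply: le_trans (ler_nrmD s1 (iL cZ) (iL (ctB cQ cZ))) _; apply: lerD => //.
by apply: nrm_le => //; exact: ctB.
Qed.

Let C2 := 2 + 2 * (C + 2) / (1 - q).

Let C20 : 0 <= C2.
Proof. by rewrite /C2 addr_ge0// divr_ge0 ?(ltW q1')// mulr_ge0// addr_ge0. Qed.

Let E b N x := \sum_(n < N) b n * e n x.

Let cE b N : continuous (E b N).
Proof. by apply: ct_sum => n; exact: ctM (ct_cst _) (@ce n). Qed.

Let E_bound f b N : inLs s f -> solves L (coef f) b -> nrm s (E b N) <= C2 * nrm s f.
Proof.
move=> lf sol; case: N => [|N].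
  apply: le_trans (mulr_ge0 C20 (nrm_ge0 s f)); apply: nrm_le => // x _.
  by rewrite /E big_ord0 normr0.
pose Q x := \sum_(1 <= n < N.+1) b n * e n x.
have cQ : continuous Q by exact: ct_bigsum.
have b0 : coef f 0 = b 0%N by rewrite sol big_ord_recr big_ord0/= L0m mulr1 add0r.
rewrite (_ : E b N.+1 = fun x => coef f 0 + Q x); last first.
  apply/funext => x; rewrite /E -(big_mkord xpredT (fun n => b n * e n x)).
  by rewrite big_ltn// e0E mulr1 b0.
apply: le_trans (ler_nrmD s1 (iL (@ct_cst R _)) (iL cQ)) _.
rewrite /C2 mulrDl; apply: lerD; first exact: le_trans (coef0_cst f) (coef_bound s1 0 lf).
apply: le_trans (Q_bound N lf sol) _; rewrite le_eqVlt; apply/orP; left; apply/eqP.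
by rewrite /D; field; rewrite !gt_eqF.
Qed.

Let cspan v : spanned e v -> continuous v.
Proof.
move=> [M [d vE]]; rewrite (_ : v = fun x => \sum_(n < M) d n * e n x); last exact/funext.
by apply: ct_sum => n; exact: ctM (ct_cst _) (@ce n).
Qed.

(* Each cosine is approximated by the perturbed system up to [q ^+ r]. *)
Let contraction r n eta : (0 < n)%N -> 0 < eta ->
  exists2 v, spanned e v & nrm s (fun x => cosw n x - v x) <= q ^+ r + eta.
Proof.
elim: r n eta => [|r IH] n eta n0 eta0.
  exists (fun=> 0); first exact: spanned0.
  apply: nrm_le => // [|x _]; first exact: ctB (@continuous_cosw R n) (ct_cst 0).
  by rewrite subr0 expr0 (le_trans (cosw_le1 _ _))// lerDl ltW.
have eta20 : 0 < eta / 2 by lra.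
have [K0 H] := eE n0 (mulr_gt0 T10 eta20).
pose K := maxn K0 2; have KK : (K0 <= K)%N := leq_maxl _ _.
have K2 : (2 <= K)%N := leq_maxr _ _.
(* The recursion rests on [tau 1 * cosw n = e n - \sum_(k >= 2) tau k * cosw (k * n)]: each cosine
   on the right is replaced by its approximation of order [r], and the weights contribute one more
   factor [q]. *)
have [w sw nw] : exists2 w, spanned e w &
    nrm s (fun x => \sum_(2 <= k < K) tau k * cosw (k * n) x - w x) <=
    \sum_(2 <= k < K) `|tau k| * (q ^+ r + eta / 2).
  have : all (fun k => (0 < k)%N) (index_iota 2 K).
    by apply/allP => k; rewrite mem_index_iota => /andP[/ltnW].
  elim: (index_iota 2 K) => [_|k l IHl /= /andP[k0 /IHl[w sw nw]]].
    exists (fun=> 0); first exact: spanned0.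
    rewrite big_nil; apply: nrm_le => // [|x _]; last by rewrite big_nil subr0 normr0.
    exact: ctB (ct_bigsum (fun k => @continuous_cosw R (k * n))) (ct_cst 0).
  have kn0 : (0 < k * n)%N by rewrite muln_gt0 k0.
  have [v sv nv] := IH _ _ kn0 eta20.
  exists (fun x => tau k * v x + w x); first exact: spannedD (spannedZ _ sv) sw.
  have c1 := ctB (@continuous_cosw R (k * n)) (cspan sv).
  have c2 := ctB (ct_bigsum (r := l) (t := tau) (fun k => @continuous_cosw R (k * n))) (cspan sw).
  rewrite (_ : (fun x => _) = fun x => tau k * (cosw (k * n) x - v x) +
      (\sum_(j <- l) tau j * cosw (j * n) x - w x)); last first.
    by apply/funext => x; rewrite big_cons; ring.
  rewrite big_cons; apply: le_trans (ler_nrmD s1 (iL (ctM (ct_cst (tau k)) c1)) (iL c2)) _.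
  by apply: lerD => //; rewrite (nrmZ s1 _ (iL c1)) ler_wpM2l.
exists (fun x => (tau 1%N)^-1 * (e n x + -1 * w x)).
  exact: spannedZ (spannedD (spanned_basis _ _) (spannedZ _ sw)).
pose u x := e n x - \sum_(1 <= k < K) tau k * cosw (k * n) x.
pose z x := \sum_(2 <= k < K) tau k * cosw (k * n) x - w x.
have cu : continuous u.
  exact: ctB (@ce n) (ct_bigsum (fun k => @continuous_cosw R (k * n))).
have cz : continuous z.
  exact: ctB (ct_bigsum (fun k => @continuous_cosw R (k * n))) (cspan sw).
have nu : nrm s u <= T1 * (eta / 2) by apply: nrm_le => // x _; exact: H.
rewrite (_ : (fun x => _) = fun x => - (tau 1%N)^-1 * (u x + z x)); last first.
  by apply/funext => x; rewrite /u /z big_ltn// mul1n; field.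
have cuz := ctD cu cz; rewrite (nrmZ s1 _ (iL cuz)) normrN normfV -/T1.
rewrite mulrC ler_pdivrMr//; apply: le_trans (ler_nrmD s1 (iL cu) (iL cz)) _.
apply: le_trans (lerD nu nw) _; rewrite -mulr_suml.
have qr0 : 0 <= q ^+ r by exact: exprn_ge0.
apply: (@le_trans _ _ (T1 * (eta / 2) + q * T1 * (q ^+ r + eta / 2))).
  by rewrite lerD2l ler_wpM2r ?tail// addr_ge0// ltW.
have -> : T1 * (eta / 2) + q * T1 * (q ^+ r + eta / 2) =
    (q * q ^+ r + (1 + q) * (eta / 2)) * T1 by ring.
rewrite ler_pM2r// exprS lerD2l.
have : q * (eta / 2) <= eta / 2 by rewrite ler_piMl ?(ltW eta20)// ltW.
lra.
Qed.

Let span_dense f eps : inLs s f -> 0 < eps ->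
  exists2 v, spanned e v & nrm s (fun x => f x - v x) <= eps.
Proof.
have step1 n eta : 0 < eta ->
    exists2 v, spanned e v & nrm s (fun x => cosw n x - v x) <= eta.
  move=> eta0; have [->|n0] := posnP n.
    exists (e 0); first exact: spanned_basis.
    apply: nrm_le => // [|x _]; first exact: ctB (@continuous_cosw R 0) (@ce 0).
    by rewrite cosw0 e0E subrr normr0 ltW.
  have eta20 : 0 < eta / 2 by lra.
  have qn : (fun r => q ^+ r) @ \oo --> (0 : R) by apply: cvg_expr; rewrite ger0_norm.
  have [r _ /(_ r (leqnn r)) /=] := (cvgrPdist_le _ _).1 qn _ eta20.
  rewrite sub0r normrN ger0_norm ?exprn_ge0// => qr.
  have [v sv nv] := contraction r n0 eta20.
  by exists v => //; apply: le_trans nv _; rewrite [leRHS]splitr lerD2r.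
have step2 M (p : nat -> R) eta : 0 < eta ->
    exists2 v, spanned e v & nrm s (fun x => \sum_(k < M) p k * cosw k x - v x) <= eta.
  elim: M eta => [|M IH] eta eta0.
    exists (fun=> 0); first exact: spanned0.
    apply: nrm_le => // [|x _]; last by rewrite big_ord0 subr0 normr0 ltW.
    by apply: ctB (ct_cst 0); apply: ct_sum => -[].
  have eta20 : 0 < eta / 2 by lra.
  have p0 : 0 < `|p M| + 1 by rewrite ltr_wpDl.
  have [v sv nv] := step1 M _ (divr_gt0 eta20 p0).
  have [w sw nw] := IH _ eta20.
  exists (fun x => w x + p M * v x); first exact: spannedD sw (spannedZ _ sv).
  have cS : continuous (fun x => \sum_(k < M) p k * cosw k x).
    by apply: ct_sum => k; exact: ctM (ct_cst _) (@continuous_cosw R k).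
  have c1 := ctB cS (cspan sw); have c2 := ctB (@continuous_cosw R M) (cspan sv).
  rewrite (_ : (fun x => _) = fun x => (\sum_(k < M) p k * cosw k x - w x) +
      p M * (cosw M x - v x)); last by apply/funext => x; rewrite big_ord_recr/=; ring.
  apply: le_trans (ler_nrmD s1 (iL c1) (iL (ctM (ct_cst (p M)) c2))) _.
  rewrite [leRHS]splitr; apply: lerD => //; rewrite (nrmZ s1 _ (iL c2)).
  apply: (@le_trans _ _ (`|p M| * (eta / 2 / (`|p M| + 1)))); first exact: ler_wpM2l.
  by rewrite mulrCA ler_piMr ?(ltW eta20)// ler_pdivrMr// mul1r lerDl.
move=> lf eps0; have eps20 : 0 < eps / 2 by lra.
have [h [M [p hE]] nh] := cospoly_dense_Ls s1 lf eps20.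
have [v sv nv] := step2 M p _ eps20.
have ch : continuous h by apply: continuous_cospoly; exists M, p.
exists v => //; rewrite (_ : (fun x => _) = fun x => (f x - h x) + (h x - v x)); last first.
  by apply/funext => x; rewrite addrA subrK.
apply: le_trans (ler_nrmD s1 (inLsB s1 lf (iL ch)) (iL (ctB ch (cspan sv)))) _.
rewrite [leRHS]splitr; apply: lerD => //; apply: le_trans nv.
by under eq_fun do rewrite hE.
Qed.

Let coef_E b m N : (m < N)%N -> coef (E b N) m = \sum_(n < m.+1) b n * L n m.
Proof.
move=> mN; have -> : E b N = fun x => \sum_(0 <= n < N) b n * e n x.
  by apply/funext => x; rewrite /E -(big_mkord xpredT (fun n => b n * e n x)).
rewrite coef_bigsum// (big_cat_nat _ (n := m.+1))//= [X in _ + X]big_nat_cond.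
rewrite [X in _ + X]big1 ?addr0 ?big_mkord// => n.
by rewrite andbT => /andP[mn _]; rewrite -/(L n m) Ltri// mulr0.
Qed.

Let coefB f v m : inLs s f -> continuous v ->
  coef (fun x => f x - v x) m = coef f m - coef v m.
Proof.
move=> lf cv; have h := coefD m (inLs_integrable s1 lf)
  (cont_integrable 0 1 (ctM (ct_cst (-1)) cv)).
rewrite coefZ ?mulN1r in h; last exact: cont_integrable.
by rewrite -h; congr coef; apply/funext => x; rewrite mulN1r.
Qed.

(** Existence: for [v] in the span near [f], the sequence [b - d'] solves the system for [f - v], so
    [E_bound] controls the partial sums of [f - v] uniformly in [N]. Uniqueness: [coef] is
    continuous for the norm, so the coefficients of any expansion solve the triangular system. *)
Let expansion f : inLs s f -> exists! c : nat -> R,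
  (fun N => 'N[lebesgue01 R]_s%:E[EFin \o (fun x => f x - E c N x)%R])%E @ \oo --> 0%E.
Proof.
move=> lf; have lfE b N : inLs s (fun x => f x - E b N x).
  exact: (inLsB s1 lf (iL (@cE b N))).
have [b sol] := solves_exists Ldiag (coef f).
exists b; split.
  under eq_fun do rewrite (Lnorm_nrm (lfE b _)).
  apply: cvg_EFin; first exact: nearW.
  apply/cvgrPdist_le => eps eps0.
  have D1 : 0 < 1 + C2 by rewrite ltr_pwDl.
  have [v sv nv] := span_dense lf (divr_gt0 eps0 D1).
  have cv := cspan sv; have [M [d vE]] := sv.
  pose d' n := if (n < M)%N then d n else 0.
  (* From [M] on, the partial sums of [v] are [v] itself. *)
  have vE' N : (M <= N)%N -> v = E d' N.
    move=> MN; apply/funext => x; rewrite vE /E.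
    rewrite (big_ord_widen N (fun n => d n * e n x))// big_mkcond/=.
    by apply: eq_bigr => n _; rewrite /d'; case: ifP; rewrite ?mul0r.
  have lfv : inLs s (fun x => f x - v x) by exact: (inLsB s1 lf (iL cv)).
  have sol' : solves L (coef (fun x => f x - v x)) (fun n => b n - d' n).
    move=> m; rewrite coefB// sol (vE' (maxn M m.+1)) ?leq_maxl// coef_E ?leq_maxr//.
    by rewrite -sumrB; apply: eq_bigr => n _; rewrite mulrBl.
  near=> N; have MN : (M <= N)%N by near: N; exact: nbhs_infty_ge.
  rewrite sub0r normrN ger0_norm ?nrm_ge0//=.
  have cE' : continuous (E (fun n => b n - d' n) N) by exact: cE.
  rewrite (_ : (fun x => _) = fun x => (f x - v x) - E (fun n => b n - d' n) N x); last first.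
    apply/funext => x; rewrite (vE' _ MN).
    have -> : E (fun n => b n - d' n) N x = E b N x - E d' N x.
      by rewrite /E -sumrB; apply: eq_bigr => n _; rewrite mulrBl.
    by rewrite opprB addrA subrK.
  apply: le_trans (ler_nrmB s1 lfv (iL cE')) _.
  apply: (@le_trans _ _ ((1 + C2) * nrm s (fun x => f x - v x))).
    by rewrite mulrDl mul1r lerD2l; exact: E_bound.
  by rewrite mulrC -ler_pdivlMr.
move=> c; under eq_fun do rewrite (Lnorm_nrm (lfE c _)).
move=> /fine_cvg/= cvc; apply: (solves_unique Ldiag sol) => m.
apply/eqP; rewrite -subr_eq0 -normr_le0; apply/ler_addgt0Pr => eps eps0.
have eps20 : 0 < eps / 2 by lra.
have [N0 _ N0P] := (cvgrPdist_le _ _).1 cvc _ eps20.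
pose N := maxn N0 m.+1.
have := N0P N (leq_maxl _ _); rewrite /= sub0r normrN ger0_norm ?nrm_ge0// => nN.
rewrite -(@coef_E c m N) ?leq_maxr// -coefB//.
by apply: le_trans (coef_bound s1 m (lfE c N)) _; rewrite add0r; lra.
Unshelve. all: by end_near. Qed.

Theorem perturbed_basis : schauder_basis (lebesgue01 R) s e.
Proof. by split => [n|f lf]; [exact/iL/ce|exact: expansion]. Qed.

End perturbation.

(** * The functions sin_p and cos_p *)

Section improper_integral.
Context {R : realType}.
Notation mu := (@lebesgue_measure R).

(** Monotone convergence along the intervals from 0 to [1 - n.+1%:R^-1]; it serves a density with a
    singularity at 1. *)
Lemma ge0_improper_integrable (f : R -> R) (M : R) : measurable_fun setT f ->
  (forall x, 0 <= f x) ->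
  (forall b : R, 0 <= b < 1 -> mu.-integrable `[0, b] (EFin \o f) /\
     \int[mu]_(x in `[0, b]) f x <= M) ->
  mu.-integrable `[0, 1] (EFin \o f) /\ \int[mu]_(x in `[0, 1]) f x <= M.
Proof.
move=> mf f0 H; pose A (n : nat) : set (measurableTypeR R) := `[0, 1 - n.+1%:R^-1]%classic.
have n1 (n : nat) : 0 <= (1 - n.+1%:R^-1 : R) < 1.
  apply/andP; split; first by rewrite subr_ge0 invf_le1// ler1n.
  by rewrite ltrBlDr ltrDl invr_gt0.
have mI : measurable (`[0, 1] : set (measurableTypeR R)) by [].
have UA : \bigcup_n A n = `[0, 1[%classic.
  apply/seteqP; split => x /=.
    move=> [n _]; rewrite /A /= !in_itv/= => /andP[-> xn] /=.
    by apply: le_lt_trans xn _; have /andP[] := n1 n.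
  rewrite in_itv/= => /andP[x0 x1].
  exists (Num.bound (1 - x)^-1) => //; rewrite /A /= in_itv/= x0/= lerBrDr addrC -lerBrDr.
  have x10 : 0 < 1 - x by rewrite subr_gt0.
  rewrite -[leRHS]invrK lef_pV2 ?posrE ?invr_gt0//.
  have := archi_boundP (ltW (_ : 0 < (1 - x)^-1)); rewrite invr_gt0 => /(_ x10) /ltW/le_trans; apply.
  by rewrite ler_nat.
have mA n : measurable (A n) by exact: measurable_itv.
have ndA : nondecreasing_seq A.
  move=> m n mn; apply/subsetPset => x; rewrite /A /= !in_itv/= => /andP[-> xm]/=.
  by apply: le_trans xm _; rewrite lerD2l lerN2 lef_pV2 ?posrE// ler_nat.
have le_n n : (\int[mu]_(x in A n) (f x)%:E <= M%:E)%E.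
  have [iA leM] := H _ (n1 n).
  move: leM; rewrite -lee_fin /Rintegral fineK//.
  by apply: integrable_fin_num => //; exact: iA.
have le_M : (\int[mu]_(x in `[0%R, 1%R[) (f x)%:E <= M%:E)%E.
  rewrite -UA; have cv := @ge0_nondecreasing_set_cvg_integral _ _ R A (fun x => (f x)%:E) mu ndA mA.
  have mfA n : measurable_fun (A n) (fun x => (f x)%:E).
    by apply/measurable_EFinP/measurable_funTS.
  have f0A n x : A n x -> (0 <= (f x)%:E)%E by rewrite lee_fin.
  by apply: (cvge_to_le (cv mfA f0A)); apply: nearW => n; exact: le_n.
have eI : (\int[mu]_(x in `[0%R, 1%R]) (f x)%:E = \int[mu]_(x in `[0%R, 1%R[) (f x)%:E)%E.
  by rewrite -integral_itv_bndo_bndc//; apply/measurable_EFinP/measurable_funTS.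
have fI : (\int[mu]_(x in `[0%R, 1%R]) (f x)%:E)%E \is a fin_num.
  rewrite ge0_fin_numE; last by apply: integral_ge0 => x _; rewrite lee_fin.
  by rewrite eI; apply: le_lt_trans le_M (ltry _).
split; last by rewrite -lee_fin /Rintegral fineK// eI.
apply/integrableP; split; first by apply/measurable_EFinP/measurable_funTS.
under eq_integral do rewrite /= ger0_norm//.
by rewrite -ge0_fin_numE//; apply: integral_ge0 => x _; rewrite lee_fin.
Qed.

End improper_integral.

Section norm_powers.
Context {R : realType}.
Implicit Types (f : R -> R) (r t x y a b : R).

Lemma ct_npow r : 0 < r -> continuous (fun t : R => `|t| `^ r).
Proof. by move=> r0; exact: (ct_norm_powR r0 ct_id). Qed.

Lemma drv_npow r t : 0 < t ->
  is_derive t 1 (fun t : R => `|t| `^ r) (r * t `^ (r - 1)).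
Proof.
move=> t0; apply: (@near_eq_is_derive _ _ _ (fun u : R => u `^ r)); last first.
  exact: (is_derive1_powR r t0).
by near=> u; rewrite gtr0_norm//; near: u; exact: lt_nbhsr.
Unshelve. all: by end_near. Qed.

Lemma powR_lt1 x r : 0 < r -> 0 <= x < 1 -> 0 <= x `^ r < 1.
Proof.
move=> r0 /andP[x0 x1]; rewrite powR_ge0/=.
have : x `^ r < 1 `^ r by apply: gt0_ltr_powR; rewrite // nnegrE.
by rewrite powR1.
Qed.

Lemma powR_le1 x r : 0 <= r -> 0 <= x <= 1 -> 0 <= x `^ r <= 1.
Proof.
move=> r0 /andP[x0 x1]; rewrite powR_ge0/=.
by have := ler_ppowR r0 x0 x1; rewrite powR1.
Qed.

Lemma powRK x r : 0 <= x -> r != 0 -> (x `^ r) `^ r^-1 = x.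
Proof. by move=> x0 r0; rewrite -powRrM mulfV// powRr1. Qed.

End norm_powers.

Section F_p_analysis.
Context {R : realType} (p : R).
Hypothesis p1 : 1 < p.
Notation mu := (@lebesgue_measure R).
Implicit Types x y t a b : R.

Let q1 : 0 < p - 1 /\ 0 < p + 1. Proof. by have := p1; split; lra. Qed.
Let p0 : 0 < p. Proof. exact: lt_trans ltr01 p1. Qed.
Let pn0 : p != 0. Proof. by rewrite gt_eqF. Qed.

Definition arcsin_density t : R := (1 - t `^ p) `^ (- p^-1).
Local Notation fp := arcsin_density.

Lemma density_ge1 t : 0 <= t < 1 -> 1 <= fp t.
Proof.
move=> t01; have /andP[h0 h1] := powR_lt1 p0 t01.
rewrite -(powRr0 (1 - t `^ p)) /fp ger_powR//; last by rewrite oppr_le0 invr_ge0 ltW.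
by apply/andP; split; lra.
Qed.

Lemma density_homo x y : 0 <= x -> x <= y -> y < 1 -> fp x <= fp y.
Proof.
move=> x0 xy y1; apply: ler_npowR; first by rewrite oppr_le0 invr_ge0 ltW.
  by have := @powR_lt1 _ y p p0; rewrite y1 (le_trans x0 xy) => /(_ isT)/andP[_]; lra.
by rewrite lerD2l lerN2 ler_ppowR// ltW.
Qed.

Lemma density_continuous t : 0 < t < 1 -> {for t, continuous fp}.
Proof.
move=> /andP[t0 t1]; have h := @powR_lt1 _ t p p0; rewrite (ltW t0) t1 in h.
have /andP[_ h1] := h isT.
have d := drvB (drv_cst 1 t) (is_derive1_powR p t0).
apply: drv_continuous (drv_powR (- p^-1) d _); lra.
Qed.

Lemma density_within b : 0 <= b < 1 -> {within `[0, b], continuous fp}.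
Proof.
move=> /andP[b0 b1].
apply: (@subspace_eq_continuous _ _ _ (fun t : R => (1 - `|t| `^ p) `^ (- p^-1))).
  by move=> x; rewrite inE/= in_itv/= => /andP[x0 _]; rewrite ger0_norm.
apply: continuous_in_subspaceT => x; rewrite inE/= in_itv/= => /andP[x0 xb].
have h := @powR_lt1 _ x p p0; rewrite x0 (le_lt_trans xb b1) in h; have /andP[_ h1] := h isT.
apply: (@continuous_comp _ _ _ (fun t : R => 1 - `|t| `^ p) (fun u : R => u `^ (- p^-1))).
  by apply: (ctB (ct_cst 1) (ct_npow p0)).
apply: (drv_continuous (is_derive1_powR _ _)).
by rewrite ger0_norm//; lra.
Qed.

Lemma density_measurable : measurable_fun setT fp.
Proof.
apply: (@measurableT_comp _ _ _ _ _ _ (fun x : R => x `^ (- p^-1))).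
  exact: measurable_powR.
by apply: measurable_funB => //; exact: measurable_powR.
Qed.

(* An elementary majorant: [U'] dominates the density by Bernoulli's inequality
   [(1 - x) `^ (1 - p^-1) <= 1 - (1 - p^-1) * x] with [x = t `^ p]. *)
Let U t := (p * t - (p - 1) / (p + 1) * `|t| `^ (p + 1)
            - t * `|1 - `|t| `^ p| `^ (1 - p^-1)) / (p - 1).
Let dU t := (p - (p - 1) * t `^ p - ((1 - t `^ p) * fp t - (p - 1) * t `^ p * fp t)) / (p - 1).

Let p'0 : 0 < 1 - p^-1. Proof. by rewrite subr_gt0 invf_lt1. Qed.

Lemma drv_cospow t : 0 < t < 1 ->
  is_derive t 1 (fun t => `|1 - `|t| `^ p| `^ (1 - p^-1))
    (- (p - 1) * t `^ (p - 1) * fp t).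
Proof.
move=> /andP[t0 t1]; have h := @powR_lt1 _ t p p0; rewrite (ltW t0) t1 in h.
have /andP[_ h1] := h isT.
have d := drvB (drv_cst 1 t) (drv_npow p t0).
apply: is_derive_eq (drv_comp d (drv_npow (1 - p^-1) _)) _.
  by rewrite gtr0_norm//; lra.
rewrite gtr0_norm// /fp (_ : 1 - p^-1 - 1 = - p^-1); last by ring.
by field.
Qed.

Let powS t r : 0 < t -> t `^ (r + 1) = t `^ r * t.
Proof.
move=> t0; rewrite powRD; last by rewrite (gt_eqF t0) implybT.
by rewrite powRr1// ltW.
Qed.

Let drv_U t : 0 < t < 1 -> is_derive t 1 U (dU t).
Proof.
move=> t01; have /andP[t0 t1] := t01.
have d1 := drvZ p (drv_id t).
have d2 := drvZ ((p - 1) / (p + 1)) (drv_npow (p + 1) t0).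
have d3 := drvM (drv_id t) (drv_cospow t01).
apply: is_derive_eq (drvM (drvB (drvB d1 d2) d3) (drv_cst (p - 1)^-1 t)) _.
have h := @powR_lt1 _ t p p0; rewrite (ltW t0) t1 in h; have /andP[_ h1] := h isT.
rewrite /dU addrK (gtr0_norm t0) gtr0_norm; last by lra.
have -> : t `^ p = t `^ (p - 1) * t by rewrite -powS// subrK.
have -> : (1 - t `^ (p - 1) * t) `^ (1 - p^-1) = (1 - t `^ (p - 1) * t) * fp t.
  have E : t `^ (p - 1) * t = t `^ p by rewrite -powS// subrK.
  rewrite E (addrC 1 (- p^-1)) powS; last by lra.
  by rewrite mulrC.
by have [? ?] := q1; field; rewrite !gt_eqF//; lra.
Qed.

Let dU_ge t : 0 < t < 1 -> fp t <= dU t.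
Proof.
move=> /andP[t0 t1].
have h := @powR_lt1 _ t p p0; rewrite (ltW t0) t1 in h; have /andP[h0 h1] := h isT.
rewrite /dU ler_pdivlMr; last by have := p1; lra.
have B : (1 - t `^ p) `^ (1 - p^-1) <= 1 + (1 - p^-1) * (1 - t `^ p - 1).
  apply: powR_bernoulli; last by lra.
  by rewrite p'0/= lerBlDr lerDl invr_ge0 ltW.
have -> : fp t * (p - 1) = (p - 1) * t `^ p * fp t + (p - 1) * ((1 - t `^ p) * fp t) by ring.
have E : (1 - t `^ p) * fp t = (1 - t `^ p) `^ (1 - p^-1).
  rewrite (addrC 1 (- p^-1)) powS; last by lra.
  by rewrite mulrC.
rewrite E; have := ler_wpM2l (ltW p0) B.
rewrite [X in _ <= X](_ : _ = p - (p - 1) * t `^ p); last by field.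
lra.
Qed.

Let ct_U : continuous U.
Proof.
apply: ctM; last exact: ct_cst.
apply: ctB; last first.
  apply: ctM; first exact: ct_id.
  by apply: ct_norm_powR => //; apply: ctB; [exact: ct_cst|exact: ct_npow].
apply: ctB; first by apply: ctM; [exact: ct_cst|exact: ct_id].
by apply: ctM; [exact: ct_cst|apply: ct_npow; have [] := q1; lra].
Qed.

(** The value at 1 bounds [pi_p p / 2]. Its finiteness gives integrability of the density, and its
    exact form returns in the numerical estimates. *)
Lemma density_majorant : exists V dV : R -> R,
  [/\ forall t, 0 < t < 1 -> is_derive t 1 V (dV t),
      forall t, 0 < t < 1 -> fp t <= dV t, continuous V, V 0 = 0 &
      V 1 = p / (p - 1) - (p + 1)^-1].
Proof.
exists U, dU; split => //.
  by rewrite /U normr0 powR0 ?gt_eqF//; [ring|have [] := q1; lra].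
rewrite /U normr1 !powR1 subrr normr0 powR0 ?gt_eqF//.
by have [? ?] := q1; field; rewrite !gt_eqF//; lra.
Qed.

(** Argued on [[0, c]] with [c < 1], since integrability up to 1 is deduced only afterwards. *)
Lemma drv_density_primitive x : 0 < x < 1 ->
  is_derive x 1 (fun y => \int[mu]_(t in `[0, y]) fp t) (fp x).
Proof.
move=> /andP[x0 x1].
have [c xc c1] : exists2 c : R, x < c & c < 1 by exists ((x + 1) / 2); lra.
have ic : mu.-integrable `[0, c] (EFin \o fp).
  by apply/itv_integrable/density_within; rewrite c1 ltW// (lt_trans x0).
have cx : {for x, continuous fp} by apply: density_continuous; rewrite x0.
have := @continuous_FTC1_closed R fp 0 x c xc ic x0 cx.
by move=> [? <-]; rewrite derive1E; split.
Qed.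

Lemma density_primitive_le b : 0 <= b < 1 ->
  \int[mu]_(x in `[0, b]) fp x <= p / (p - 1) - (p + 1)^-1.
Proof.
move=> /andP[b0 b1]; have [V [dV [Vd dV_ge cV V0 <-]]] := density_majorant.
have cI : {within `[0, b], continuous (fun y => \int[mu]_(t in `[0, y]) fp t)}.
  apply: parameterized_integral_continuous => //.
  by apply/itv_integrable/density_within; rewrite b0.
have h1 : V 0 - \int[mu]_(t in `[0, 0]) fp t <= V b - \int[mu]_(t in `[0, b]) fp t.
  apply: (@drv_ge0_homo _ (fun y => V y - \int[mu]_(t in `[0, y]) fp t)
     (fun y => dV y - fp y) 0 b) => //.
  - by move=> x xb; apply: drvB; [apply: Vd|apply: drv_density_primitive]; lra.
  - by move=> x xb; rewrite subr_ge0 dV_ge//; lra.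
  - by apply: within_continuousB => //; exact: continuous_subspaceT.
have h2 : V b <= V 1.
  apply: (@drv_ge0_homo _ V dV 0 1) => //; last by apply: ltW.
  - move=> x x01; apply: le_trans (dV_ge _ x01); apply: le_trans ler01 _.
    by apply: density_ge1; lra.
  - exact: (continuous_subspaceT cV).
move: h1; rewrite set_itv1 Rintegral_set1 V0; lra.
Qed.

Lemma density_integrable : mu.-integrable `[0, 1] (EFin \o fp).
Proof.
apply: (@ge0_improper_integrable _ fp (p / (p - 1) - (p + 1)^-1) density_measurable _ _).1.
  by move=> x; exact: powR_ge0.
by move=> b b01; split; [exact/itv_integrable/density_within|exact: density_primitive_le].
Qed.

Lemma F_p1_le : F_p p 1 <= p / (p - 1) - (p + 1)^-1.
Proof.
apply: (@ge0_improper_integrable _ fp _ density_measurable _ _).2.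
  by move=> x; exact: powR_ge0.
by move=> b b01; split; [exact/itv_integrable/density_within|exact: density_primitive_le].
Qed.

Lemma F_p0 : F_p p 0 = 0.
Proof. by rewrite /F_p set_itv1 Rintegral_set1. Qed.

Lemma F_p_within : {within `[0, 1], continuous (F_p p)}.
Proof. exact: (parameterized_integral_continuous ler01 density_integrable). Qed.

Lemma drv_F_p x : 0 < x < 1 -> is_derive x 1 (F_p p) (fp x).
Proof.
move=> /andP[x0 x1].
have cx : {for x, continuous fp} by apply: density_continuous; rewrite x0.
have := @continuous_FTC1_closed R fp 0 x 1.
by move=> /(_ x1 density_integrable x0 cx) [? <-]; rewrite derive1E; split.
Qed.

(** The density is nondecreasing, so [F_p] is convex; this lemma and [F_p_decr] compare a chord with
    the slopes at its two ends. At 1 the density has the junk value 0, hence the strict bound in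
    [F_p_decr]. *)
Lemma F_p_incr a b : 0 <= a -> a <= b -> b <= 1 ->
  fp a * (b - a) <= F_p p b - F_p p a.
Proof.
move=> a0 ab b1; have [->|ab'] := eqVneq a b; first by rewrite !subrr mulr0.
have {ab' ab}ab : a < b by rewrite lt_neqAle ab'.
have : F_p p a - fp a * a <= F_p p b - fp a * b; last by rewrite mulrBr; lra.
apply: (@drv_ge0_homo _ (fun t => F_p p t - fp a * t) (fun t => fp t - fp a) a 1) => //.
- by move=> x xa; apply: is_derive_eq (drvB (drv_F_p _) (drvZ (fp a) (drv_id x))) _; [lra|rewrite mulr1].
- by move=> x xa; rewrite subr_ge0 density_homo//; lra.
- apply: within_continuousB; last first.
    by apply: continuous_subspaceT; exact: ctM (ct_cst _) ct_id.
  apply: (continuous_subspaceW _ F_p_within).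
  by move=> y /=; rewrite !in_itv/= => /andP[y1 ->]; rewrite (le_trans a0).
- exact: ltW.
Qed.

Lemma F_p_decr a b : 0 <= a -> a <= b -> b < 1 ->
  F_p p b - F_p p a <= fp b * (b - a).
Proof.
move=> a0 ab b1.
have : fp b * a - F_p p a <= fp b * b - F_p p b; last by rewrite mulrBr; lra.
apply: (@drv_ge0_homo _ (fun t => fp b * t - F_p p t) (fun t => fp b - fp t) a b) => //.
- by move=> x xa; apply: is_derive_eq (drvB (drvZ (fp b) (drv_id x)) (drv_F_p _)) _; [lra|rewrite mulr1].
- by move=> x xa; rewrite subr_ge0 density_homo//; lra.
- apply: within_continuousB.
    by apply: continuous_subspaceT; exact: ctM (ct_cst _) ct_id.
  apply: (continuous_subspaceW _ F_p_within).
  by move=> y /=; rewrite !in_itv/= => /andP[y1 y2]; rewrite (le_trans a0 y1) (le_trans y2 (ltW b1)).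
Qed.

(* The left-hand side has derivative [- a `^ (p - 1) * fp a >= - fp a]. *)
Lemma F_p_gap a : 0 <= a <= 1 ->
  `|1 - a `^ p| `^ (1 - p^-1) / (p - 1) <= F_p p 1 - F_p p a.
Proof.
move=> /andP[a0 a1]; have [pm _] := q1.
pose V t := (p - 1)^-1 * `|1 - `|t| `^ p| `^ (1 - p^-1).
have : F_p p a - - V a <= F_p p 1 - - V 1.
  apply: (@drv_ge0_homo _ (fun t => F_p p t - - V t) (fun t => fp t * (1 - t `^ (p - 1))) 0 1) => //.
  - move=> x x01; apply: is_derive_eq (drvB (drv_F_p x01) (drvN (drvZ (p - 1)^-1 (drv_cospow x01)))) _.
    by field; rewrite gt_eqF.
  - move=> x /andP[x0 x1]; apply: mulr_ge0; first exact: powR_ge0.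
    by have := @powR_le1 _ x (p - 1) (ltW pm); rewrite (ltW x0) (ltW x1) => /(_ isT); lra.
  - apply: within_continuousB; first exact: F_p_within.
    apply: continuous_subspaceT; apply: ctN; apply: ctM (ct_cst _) _.
    by apply: ct_norm_powR => //; apply: ctB; [exact: ct_cst|exact: ct_npow].
rewrite {2}/V normr1 powR1 subrr normr0 powR0 ?gt_eqF// /V (ger0_norm a0) mulrC; lra.
Qed.

Lemma F_p1_ge : 1 <= F_p p 1 /\ (p - 1)^-1 <= F_p p 1.
Proof.
split; last first.
  have := @F_p_gap 0; rewrite lexx ler01 => /(_ isT).
  by rewrite powR0 ?gt_eqF// subr0 normr1 powR1 mul1r F_p0 subr0.
have := @F_p_incr 0 1 (lexx _) ler01 (lexx _).
by rewrite /fp powR0 ?gt_eqF// subr0 powR1 mul1r F_p0 subr0.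
Qed.

End F_p_analysis.

Section squeezed_derivative.
Context {R : realType}.
Implicit Types (f k : R -> R) (x y l : R).

Lemma lipschitz_continuous f : (forall x y, `|f x - f y| <= `|x - y|) -> continuous f.
Proof.
move=> H x; apply/cvgrPdist_le => e e0; near=> y.
by apply: le_trans (H _ _) _; near: y; apply: cvgr_dist_le.
Unshelve. all: by end_near. Qed.

(** Differentiability with an error controlled by the oscillation of a continuous [k]. It applies
    equally inside the quarter period and at its ends, where [sin_p] is glued from pieces. *)
Lemma derive_squeeze f k x l : {for x, continuous k} -> k x = l ->
  (\forall y \near x, `|f y - f x - l * (y - x)| <= `|k y - l| * `|y - x|) ->
  is_derive x 1 f l.
Proof.
move=> ck kx H; apply/is_derive1_caratheodory.
pose g y := if y == x then l else (f y - f x) / (y - x).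
exists g; split; last by rewrite /g eqxx.
  move=> y; rewrite /g; case: eqVneq => [->|yx]; first by rewrite !subrr mulr0.
  by rewrite divfK// subr_eq0.
have gx : g x = l by rewrite /g eqxx.
apply/cvgrPdist_le => e e0.
have : \forall y \near x, `|k x - k y| <= e by apply: cvgr_dist_le ck _ e0.
rewrite kx => ke; near=> y; change (`|g x - g y| <= e); rewrite gx.
have kye : `|l - k y| <= e by near: y.
have yH : `|f y - f x - l * (y - x)| <= `|k y - l| * `|y - x| by near: y.
rewrite /g; case: eqVneq => [_|yx]; first by rewrite subrr normr0 ltW.
apply: le_trans kye; rewrite distrC [leRHS]distrC.
have yx0 : 0 < `|y - x| by rewrite normr_gt0 subr_eq0.
rewrite -(ler_pM2r yx0) -normrM mulrBl divfK// subr_eq0 //.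
Unshelve. all: by end_near. Qed.

End squeezed_derivative.

Section inverse_analysis.
Context {R : realType} (p : R).
Hypothesis p1 : 1 < p.
Implicit Types x y a b d : R.

Local Notation w := (F_p p 1).
Local Notation fp := (arcsin_density p).

Let p0 : 0 < p. Proof. exact: lt_trans ltr01 p1. Qed.
Let pV : 0 < p^-1. Proof. by rewrite invr_gt0. Qed.
Let w0 : 0 < w. Proof. by have [h _] := F_p1_ge p1; apply: lt_le_trans h. Qed.

(** The density is at least 1. Consequently the inverse of [F_p] is 1-Lipschitz, which yields the
    continuity of [clamped_sin]. *)
Lemma F_p_expand a b : 0 <= a -> a <= b -> b <= 1 -> b - a <= F_p p b - F_p p a.
Proof.
move=> a0; rewrite le_eqVlt => /predU1P[->|ab] b1; first by rewrite !subrr.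
apply: le_trans (F_p_incr p1 a0 (ltW ab) b1).
by rewrite ler_peMl ?density_ge1 ?subr_ge0 ?(ltW ab)// a0 (lt_le_trans ab b1).
Qed.

Lemma F_p_le_inv a b : 0 <= b -> a <= 1 -> F_p p a <= F_p p b -> a <= b.
Proof.
move=> b0 a1 ab; rewrite leNgt; apply/negP => ba.
by have := F_p_expand b0 (ltW ba) a1; lra.
Qed.

Lemma F_p_surj x : 0 <= x <= w -> exists2 a, 0 <= a <= 1 & F_p p a = x.
Proof.
move=> xw; have [|a] := @IVT _ (F_p p) 0 1 x ler01 (F_p_within p1).
  by rewrite F_p0 min_l ?max_r// ltW.
by rewrite in_itv/=; exists a.
Qed.

Lemma F_p_invK a : 0 <= a <= 1 -> F_p_inv p (F_p p a) = a.
Proof.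
move=> a01; apply: pinvKV; last by rewrite inE/= in_itv.
move=> x y; rewrite !inE/= !in_itv/= => /andP[x0 x1] /andP[y0 y1] xy.
by apply/eqP; rewrite eq_le (F_p_le_inv y0 x1) ?(F_p_le_inv x0 y1) ?xy.
Qed.

(* Clamping the argument to [0, pi_p / 2] makes the inverse of [F_p] and the
   candidate for [cos_p] continuous on the whole line. *)
Definition clamp x : R := Num.max 0 (Num.min x w).
Definition clamped_sin x : R := F_p_inv p (clamp x).
Local Notation sinc := clamped_sin.
Definition clamped_cos x : R := `|1 - `|sinc x| `^ p| `^ p^-1.
Local Notation cosc := clamped_cos.

Lemma clamp_itv x : 0 <= clamp x <= w.
Proof. by rewrite /clamp le_max lexx/= ge_max ge_min lexx orbT ltW. Qed.

Lemma clamp_id x : 0 <= x <= w -> clamp x = x.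
Proof. by move=> /andP[x0 xw]; rewrite /clamp min_l// max_r. Qed.

Lemma clamp_step x y : x <= y -> 0 <= clamp y - clamp x <= y - x.
Proof.
have mn (a b : R) : (Num.min a b = a /\ a <= b) \/ (Num.min a b = b /\ b <= a).
  by have [ab|/ltW ab] := leP a b; [left|right].
have mx (a b : R) : (Num.max a b = b /\ a <= b) \/ (Num.max a b = a /\ b <= a).
  by have [ab|/ltW ab] := leP a b; [left|right].
rewrite /clamp; move: w0; move: w => v v0 xy.
by case: (mn x v) => -[-> ?]; case: (mn y v) => -[-> ?];
  case: (mx 0 x) => -[hx ?]; case: (mx 0 y) => -[hy ?]; case: (mx 0 v) => -[hv ?];
  rewrite ?hx ?hy ?hv; lra.
Qed.

Lemma sinc_itv x : 0 <= sinc x <= 1.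
Proof.
by rewrite /sinc; have [a a01 <-] := F_p_surj (clamp_itv x); rewrite F_p_invK.
Qed.

Lemma F_p_sinc x : F_p p (sinc x) = clamp x.
Proof.
by rewrite /sinc; have [a a01 <-] := F_p_surj (clamp_itv x); rewrite F_p_invK.
Qed.

Lemma sinc_homo x y : x <= y -> sinc x <= sinc y.
Proof.
move=> xy; have /andP[x0 x1] := sinc_itv x; have /andP[y0 y1] := sinc_itv y.
apply: F_p_le_inv => //; rewrite !F_p_sinc -subr_ge0.
by have /andP[] := clamp_step xy.
Qed.

Lemma continuous_sinc : continuous sinc.
Proof.
apply: lipschitz_continuous => x y.
wlog xy : x y / x <= y.
  by move=> H; have [/H//|/ltW/H] := leP x y; rewrite distrC [leRHS]distrC.
have sxy := sinc_homo xy.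
rewrite distrC ger0_norm ?subr_ge0// distrC ger0_norm ?subr_ge0//.
have /andP[x0 x1] := sinc_itv x; have /andP[y0 y1] := sinc_itv y.
apply: le_trans (F_p_expand x0 sxy y1) _; rewrite !F_p_sinc.
by have /andP[] := clamp_step xy.
Qed.

Lemma continuous_cosc : continuous cosc.
Proof.
apply: ct_norm_powR => //; apply: ctB; first exact: ct_cst.
exact: ct_norm_powR p0 continuous_sinc.
Qed.

Lemma coscE x : cosc x = (1 - sinc x `^ p) `^ p^-1.
Proof.
have /andP[x0 x1] := sinc_itv x; rewrite /clamped_cos (ger0_norm x0) ger0_norm//.
by have := @powR_le1 _ (sinc x) p (ltW p0) (sinc_itv x); lra.
Qed.

Lemma cosc_itv x : 0 <= cosc x <= 1.
Proof.
rewrite coscE; apply: powR_le1; first exact: ltW.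
by have := @powR_le1 _ (sinc x) p (ltW p0) (sinc_itv x); lra.
Qed.

Lemma cosc_homo x y : x <= y -> cosc y <= cosc x.
Proof.
move=> xy; rewrite !coscE.
have := @powR_le1 _ (sinc y) p (ltW p0) (sinc_itv y) => h.
have /andP[x0 _] := sinc_itv x.
have := ler_ppowR (ltW p0) x0 (sinc_homo xy) => h2.
by apply: ler_ppowR; [exact: ltW| lra | lra].
Qed.

Lemma sinc_le0 x : x <= 0 -> sinc x = 0.
Proof.
move=> x0; rewrite /clamped_sin /clamp max_l; last by rewrite ge_min x0.
by have := @F_p_invK 0; rewrite lexx ler01 F_p0; apply.
Qed.

Lemma sinc_ge x : w <= x -> sinc x = 1.
Proof.
move=> x0; rewrite /clamped_sin /clamp min_r// max_r; last exact: ltW.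
by have := @F_p_invK 1; rewrite lexx ler01; apply.
Qed.

Lemma cosc_le0 x : x <= 0 -> cosc x = 1.
Proof. by move=> x0; rewrite coscE sinc_le0// powR0 ?gt_eqF// subr0 powR1. Qed.

Lemma cosc_ge x : w <= x -> cosc x = 0.
Proof. by move=> x0; rewrite coscE sinc_ge// powR1 subrr powR0 ?gt_eqF. Qed.

(** The slope of [F_p] at [sinc x] is the reciprocal of [cosc x], so [cosc] is the slope of the
    inverse function. *)
Lemma density_sinc x : sinc x != 1 -> fp (sinc x) * cosc x = 1.
Proof.
move=> x1; have /andP[y0 y1] := sinc_itv x.
have := @powR_lt1 _ (sinc x) p p0; rewrite y0 lt_neqAle x1 y1 => /(_ isT)/andP[_ h].
rewrite coscE /arcsin_density powRN mulVf// powR_eq0 negb_and; apply/orP; left.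
by rewrite gt_eqF// subr_gt0.
Qed.

(** The chord inequalities for [F_p], multiplied by [cosc] and read through the inverse. *)
Lemma sinc_sandwich x y : 0 <= x -> x <= y -> y <= w ->
  cosc y * (y - x) <= sinc y - sinc x <= cosc x * (y - x).
Proof.
move=> x0 xy yw; have sxy := sinc_homo xy.
have /andP[a0 a1] := sinc_itv x; have /andP[b0 b1] := sinc_itv y.
have /andP[cx0 _] := cosc_itv x; have /andP[cy0 _] := cosc_itv y.
have Fx : F_p p (sinc x) = x by rewrite F_p_sinc clamp_id// x0 (le_trans xy).
have Fy : F_p p (sinc y) = y by rewrite F_p_sinc clamp_id// yw (le_trans x0).
apply/andP; split.
(* [F_p_decr] excludes this value, but then [cosc y = 0] and the lower bound is mere
   monotonicity. *)
- have [y1|y1] := eqVneq (sinc y) 1.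
    by rewrite coscE y1 powR1 subrr powR0 ?gt_eqF// mul0r subr_ge0.
  have := F_p_decr p1 a0 sxy; rewrite lt_neqAle y1 b1 Fx Fy => /(_ isT) h.
  have := ler_wpM2l cy0 h; rewrite mulrA (mulrC (cosc y) (fp _)) density_sinc// mul1r.
  by [].
- have [x1|x1] := eqVneq (sinc x) 1.
    have yx0 : 0 <= y - x by rewrite subr_ge0.
    by apply: le_trans (mulr_ge0 cx0 yx0); rewrite x1 subr_le0.
  have := F_p_incr p1 a0 sxy b1; rewrite Fx Fy => h.
  have := ler_wpM2l cx0 h; rewrite mulrA (mulrC (cosc x) (fp _)) density_sinc// mul1r.
  by [].
Qed.

Lemma sinc_tangent x y : 0 <= x <= w -> 0 <= y <= w ->
  `|sinc y - sinc x - cosc x * (y - x)| <= `|cosc y - cosc x| * `|y - x|.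
Proof.
move=> /andP[x0 xw] /andP[y0 yw].
have aux1 (c c' a b : R) : x <= y -> c' * (y - x) <= b - a <= c * (y - x) ->
    `|b - a - c * (y - x)| <= `|c' - c| * `|y - x|.
  clear => xy /andP[u1 u2]; rewrite -normrM mulrBl ler0_norm ?ler0_norm; lra.
have aux2 (c c' a b : R) : y <= x -> c * (x - y) <= a - b <= c' * (x - y) ->
    `|b - a - c * (y - x)| <= `|c' - c| * `|y - x|.
  clear => yx /andP[u1 u2].
  rewrite -normrM (_ : (c' - c) * (y - x) = - (c' * (x - y) - c * (x - y))); last by ring.
  rewrite normrN (ger0_norm (_ : 0 <= c' * (x - y) - c * (x - y))); last by lra.
  by rewrite ler0_norm; lra.
have [xy|/ltW yx] := leP x y; first exact: (aux1 _ _ _ _ xy (sinc_sandwich x0 xy yw)).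
exact: (aux2 _ _ _ _ yx (sinc_sandwich y0 yx xw)).
Qed.

Lemma drv_sinc x : 0 < x < w -> is_derive x 1 sinc (cosc x).
Proof.
move=> /andP[x0 xw]; apply: (@derive_squeeze _ _ cosc) => //.
  exact: continuous_cosc.
near=> y; apply: sinc_tangent; first by rewrite !ltW.
apply/andP; split; apply: ltW; near: y; [exact: lt_nbhsr|exact: lt_nbhsl].
Unshelve. all: by end_near. Qed.

End inverse_analysis.

Section sin_p_derivative.
Context {R : realType} (p : R).
Hypothesis p1 : 1 < p.
Implicit Types x y : R.

Local Notation w := (F_p p 1).
Local Notation cosc := (clamped_cos p).
Local Notation sinc := (clamped_sin p).
Let w0 : 0 < w. Proof. by have [h _] := F_p1_ge p1; apply: lt_le_trans h. Qed.
Let piE : pi_p p = 2 * w. Proof. by []. Qed.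
Let pi0 : 0 < pi_p p. Proof. by rewrite piE mulr_gt0. Qed.

Lemma sin_p0 : sin_p p 0 = 0.
Proof. by have := sin_pN 0 pi0; rewrite oppr0; lra. Qed.

Lemma sin_p_sinc x : 0 <= x <= w -> sin_p p x = sinc x.
Proof.
rewrite le_eqVlt => /andP[/predU1P[<- _|x0 xw]]; first by rewrite sin_p0 sinc_le0.
rewrite sin_pE//; last by rewrite piE x0 mulrAC divff// mul1r.
by rewrite /clamped_sin clamp_id// (ltW x0).
Qed.

(** At the gluing points symmetry brings [sin_p] back to [sinc]: oddness at 0 gives the control
    function [cosc |y|], reflection at [w] gives [cosc (w - |y - w|)]. In between, [sin_p] is
    locally [sinc]. *)
Lemma drv_sin_p_quarter x : 0 <= x <= w -> is_derive x 1 (sin_p p) (cosc x).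
Proof.
move=> /andP[x0 xw].
have nx (e : R) : 0 < e -> \forall y \near x, `|x - y| < e.
  by move=> e0; exact: (nbhsx_ballx x e e0).
have [x00|xn0] := eqVneq x 0.
  apply: (@derive_squeeze _ _ (fun y => cosc `|y|)).
  - by apply: (ct_comp (continuous_cosc p1) (ct_norm ct_id)).
  - by rewrite x00 normr0.
  near=> y; have : `|x - y| < w by near: y; exact: nx.
  rewrite x00 sub0r normrN sin_p0 !subr0 => /ltW yw.
  have := @sinc_tangent _ _ p1 0 `|y|; rewrite lexx normr_ge0 yw (ltW w0) => /(_ isT isT).
  rewrite (sinc_le0 p1 (lexx 0)) !subr0 normr_id; have [y0|/ltW y0] := leP 0 y.
    by move: yw; rewrite (ger0_norm y0) => yw; rewrite sin_p_sinc ?y0.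
  move: yw; rewrite (ler0_norm y0) => yw.
  have -> : sin_p p y = - clamped_sin p (- y).
    by rewrite -sin_p_sinc ?oppr_ge0 ?y0// sin_pN// opprK.
  move: (clamped_sin p _) (clamped_cos p 0) => u c.
  by rewrite (_ : - u - c * y = - (u - c * - y)) ?normrN//; ring.
have [xw'|xnw] := eqVneq x w.
  apply: (@derive_squeeze _ _ (fun y => cosc (w - `|y - w|))).
  - by apply: (ct_comp (continuous_cosc p1) (ctB (ct_cst _) (ct_norm (ctB ct_id (ct_cst _))))).
  - by rewrite /= {1}xw' subrr normr0; congr clamped_cos; rewrite subr0.
  near=> y; have : `|x - y| < w by near: y; exact: nx.
  rewrite xw' distrC => yw; set z := w - `|y - w|.
  have zw : 0 <= z <= w by rewrite /z; have := normr_ge0 (y - w); lra.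
  have sy : sin_p p y = sinc z.
    rewrite -sin_p_sinc// /z; have [yw'|/ltW yw'] := leP y w.
      by congr sin_p; rewrite ler0_norm ?subr_le0//; ring.
    rewrite ger0_norm ?subr_ge0//.
    have := sin_p_sym (y - w) pi0; rewrite (_ : pi_p p / 2 = w) ?piE//; last by field.
    by rewrite (_ : w + (y - w) = y) => [<-//|]; ring.
  rewrite sy sin_p_sinc ?lexx ?(ltW w0)//.
  have ww : 0 <= w <= w by rewrite lexx ltW.
  have := sinc_tangent p1 ww zw; rewrite (cosc_ge p1 (lexx w)) !mul0r !subr0.
  by rewrite /z addrAC subrr sub0r normrN normr_id.
have x0' : 0 < x by rewrite lt_neqAle eq_sym xn0.
have xw' : x < w by rewrite lt_neqAle xnw.
apply: (@near_eq_is_derive _ _ _ sinc); last by apply: (drv_sinc p1); rewrite x0'.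
near=> y; rewrite sin_p_sinc//.
apply/andP; split; apply: ltW; near: y; [exact: lt_nbhsr|exact: lt_nbhsl].
Unshelve. all: by end_near. Qed.

Lemma drv_sin_p_half x : `|x| <= w -> is_derive x 1 (sin_p p) (cosc `|x|).
Proof.
have [x0 xw|/ltW x0 xw] := leP 0 x.
  by rewrite (ger0_norm x0); apply: drv_sin_p_quarter; rewrite -{2}(ger0_norm x0) xw x0.
rewrite (_ : sin_p p = fun y => - sin_p p (- y)); last first.
  by apply/funext => y; rewrite sin_pN// opprK.
rewrite (ler0_norm x0) in xw *.
have d : is_derive (- x) 1 (sin_p p) (cosc (- x)).
  by apply: drv_sin_p_quarter; rewrite xw oppr_ge0 x0.
by apply: is_derive_eq (drvN (drv_comp (drvN (drv_id x)) d)) _; rewrite mulrN1 opprK.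
Qed.

Lemma sin_p_shift (k : int) x : sin_p p (x + k%:~R * pi_p p) = (-1) ^ k * sin_p p x.
Proof.
have [j [r [rP ->]]] := sin_pP x pi0.
rewrite addrAC -mulrDl -intrD !sin_p_red// expfzDr ?oppr_eq0 ?oner_eq0//.
by rewrite (mulrC ((-1) ^ j)) -mulrA.
Qed.

Lemma cos_pE (k : int) x : `|x| <= w ->
  cos_p p (x + k%:~R * pi_p p) = (-1) ^ k * cosc `|x|.
Proof.
move=> xw; rewrite /cos_p derive1E.
suff d : is_derive (x + k%:~R * pi_p p) 1 (sin_p p) ((-1) ^ k * cosc `|x|) by have [_ ->] := d.
rewrite [X in is_derive _ _ X _](_ : sin_p p = fun y => (-1) ^ k * sin_p p (y - k%:~R * pi_p p)); last first.
  by apply/funext => y; rewrite -sin_p_shift subrK.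
have d : is_derive (x + k%:~R * pi_p p - k%:~R * pi_p p) 1 (sin_p p) (cosc `|x|).
  by rewrite addrK; exact: drv_sin_p_half.
have := drv_comp (drvB (drv_id _) (drv_cst (k%:~R * pi_p p) _)) d.
by move=> h; apply: is_derive_eq (drvZ ((-1) ^ k) h) _; rewrite subr0 mulr1.
Qed.

Lemma cos_p_even_periodic : even_periodic (fun x => cos_p p (pi_p p * x)).
Proof.
have red x : exists (k : int) (r : R), `|r| <= w /\ x = r + k%:~R * pi_p p.
  have [k [r [/andP[r1 r2] ->]]] := sin_pP x pi0; exists k, r; split; last exact: addrC.
  by rewrite ler_norml; move: r1 r2; rewrite piE; lra.
split=> x; have [k [r [rw E]]] := red (pi_p p * x).
- have -> : pi_p p * - x = - r + (- k)%:~R * pi_p p by rewrite mulrN E intrN; ring.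
  by rewrite E !cos_pE ?normrN// -exprz_inv invrN1.
- have -> : pi_p p * (x + 2) = r + (k + 2%:Z)%:~R * pi_p p by rewrite mulrDr E intrD; ring.
  rewrite E !cos_pE// expfzDr ?oppr_eq0 ?oner_eq0//.
  by rewrite (_ : (-1) ^ 2%:Z = (-1) ^+ 2 :> R)// sqrrN expr1n mulr1.
Qed.

(** On each half of [0, 1] one of the two clamped cosines vanishes. The difference has the shape of
    [reflected], whose coefficients are computed below. *)
Lemma cos_p01 x : 0 <= x <= 1 ->
  cos_p p (pi_p p * x) = cosc (pi_p p * x) - cosc (pi_p p * (1 - x)).
Proof.
move=> /andP[x0 x1]; have pw := piE; have w00 := w0.
have [h|/ltW h] := leP x 2^-1.
  have x3 : 0 <= pi_p p * x <= w by rewrite pw; nra.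
  have := @cos_pE 0 (pi_p p * x); rewrite mul0r addr0 expr0z mul1r => ->.
    rewrite [cosc (_ * (1 - x))](cosc_ge p1) ?subr0 ?ger0_norm//; first by have /andP[] := x3.
    by rewrite pw; nra.
  by rewrite ger0_norm; have /andP[] := x3.
have x3 : 0 <= pi_p p * (1 - x) <= w by rewrite pw; nra.
have := @cos_pE 1 (- (pi_p p * (1 - x))); rewrite normrN expr1z mul1r.
rewrite (_ : - (pi_p p * (1 - x)) + pi_p p = pi_p p * x); last by ring.
rewrite [cosc (_ * x)](cosc_ge p1); last by rewrite pw; nra.
rewrite ger0_norm; last by have /andP[] := x3.
by move=> ->; [ring|have /andP[] := x3].
Qed.

End sin_p_derivative.

Section clamped_cos_bounds.
Context {R : realType} (p : R).
Hypothesis p1 : 1 < p.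
Implicit Types x y d : R.

Local Notation w := (F_p p 1).
Local Notation cosc := (clamped_cos p).
Local Notation sinc := (clamped_sin p).
Let p0 : 0 < p. Proof. exact: lt_trans ltr01 p1. Qed.
Let pm0 : 0 < p - 1. Proof. by rewrite subr_gt0. Qed.

(** This is [F_p_gap] at [sinc x]. It controls how [cos_p] vanishes at [pi_p / 2], the source of the
    decay rate of the Fourier coefficients. *)
Lemma clamped_cos_gap x : 0 <= x <= w -> cosc x `^ (p - 1) <= (p - 1) * (w - x).
Proof.
move=> xw; have := F_p_gap p1 (sinc_itv p1 x).
rewrite (F_p_sinc p1) (clamp_id xw) ler_pdivrMr// mulrC => h; apply: le_trans h.
have /andP[s0 s1] := powR_le1 (ltW p0) (sinc_itv p1 x).
rewrite (coscE p1) -powRrM ger0_norm ?subr_ge0//.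
by rewrite (_ : p^-1 * (p - 1) = 1 - p^-1)//; field; rewrite gt_eqF.
Qed.

(** The second factor is the power [2 - p] of [cosc x]; it is nondecreasing in [x] when [2 <= p],
    whence the concavity. *)
Definition cos_slope x : R := sinc x `^ (p - 1) * (1 - sinc x `^ p) `^ (2 / p - 1).

Lemma sinc_gt0 x : 0 < x < w -> 0 < sinc x < 1.
Proof.
move=> /andP[x0 xw]; have xw' : 0 <= x <= w by rewrite !ltW.
have /andP[s0 s1] := sinc_itv p1 x; have E := F_p_sinc p1 x; rewrite (clamp_id xw') in E.
rewrite !lt_neqAle s0 s1 !andbT; apply/andP; split; apply/negP => /eqP h.
- by move: x0; rewrite -E -h F_p0 ltxx.
- by move: xw; rewrite -[X in X < _]E h ltxx.
Qed.

Lemma drv_clamped_cos x : 0 < x < w -> is_derive x 1 cosc (- cos_slope x).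
Proof.
move=> xw; have /andP[s0 s1] := sinc_gt0 xw.
have /andP[_ sp] := @powR_lt1 _ (sinc x) p p0 (introT andP (conj (ltW s0) s1)).
have sp0 : 0 < 1 - sinc x `^ p by rewrite subr_gt0.
have d1 := drv_comp (drv_sinc p1 xw) (drv_npow p s0).
have d2 := drvB (drv_cst 1 x) d1.
have d3 : is_derive (1 - `|sinc x| `^ p) 1 (fun t : R => `|t| `^ p^-1)
    (p^-1 * (1 - `|sinc x| `^ p) `^ (p^-1 - 1)).
  by apply: drv_npow; rewrite gtr0_norm.
apply: is_derive_eq (drv_comp d2 d3) _.
rewrite (gtr0_norm s0) (coscE p1) /cos_slope.
rewrite (_ : 2 / p - 1 = (p^-1 - 1) + p^-1); last by ring.
rewrite (@powRD _ (1 - _) (p^-1 - 1) p^-1); last by rewrite (gt_eqF sp0) implybT.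
by field; rewrite gt_eqF.
Qed.

Hypothesis p2 : 2 <= p.

Lemma cos_slope_homo x y : 0 < x -> x <= y -> y < w -> cos_slope x <= cos_slope y.
Proof.
move=> x0 xy yw.
have /andP[sx0 sx1] := @sinc_gt0 x (introT andP (conj x0 (le_lt_trans xy yw))).
have /andP[sy0 sy1] := @sinc_gt0 y (introT andP (conj (lt_le_trans x0 xy) yw)).
have sxy := sinc_homo p1 xy.
have /andP[_ spy] := @powR_lt1 _ (sinc y) p p0 (introT andP (conj (ltW sy0) sy1)).
rewrite /cos_slope; apply: ler_pM; [exact: powR_ge0|exact: powR_ge0| |].
  by apply: ler_ppowR => //; apply: ltW.
apply: ler_npowR; [|by rewrite subr_gt0|].
  by rewrite subr_le0 ler_pdivrMr// mul1r.
by rewrite lerD2l lerN2; apply: ler_ppowR => //; apply: ltW.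
Qed.

(** Stated with decrements over a fixed step [d], concavity needs only a monotone first derivative,
    and folded integrals use it in this form. *)
Lemma clamped_cos_concave x y d : 0 <= x -> x <= y -> 0 <= d -> y + d <= w ->
  cosc x - cosc (x + d) <= cosc y - cosc (y + d).
Proof.
move=> x0 xy d0 yd.
apply: (@drv_ge0_homo _ (fun u => cosc u - cosc (u + d))
   (fun u => - cos_slope u - - cos_slope (u + d)) 0 (w - d)) => //.
- move=> u /andP[u0 u1]; have ud : u + d < w by rewrite -ltrBrDr.
  have uw : u < w by apply: le_lt_trans ud; rewrite lerDl.
  have d1 := @drv_clamped_cos u (introT andP (conj u0 uw)).
  have d2 := @drv_clamped_cos (u + d) (introT andP (conj (ltr_wpDr d0 u0) ud)).
  have d3 := drv_comp (drvD (drv_id u) (drv_cst d u)) d2.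
  by apply: is_derive_eq (drvB d1 d3) _; rewrite addr0 mulr1.
- move=> u /andP[u0 u1]; have ud : u + d < w by rewrite -ltrBrDr.
  rewrite opprK addrC subr_ge0; apply: cos_slope_homo => //.
  by rewrite lerDl.
- apply: continuous_subspaceT; apply: ctB; first exact: continuous_cosc.
  by apply: (ct_comp (continuous_cosc p1)); apply: ctD ct_id (ct_cst d).
- by rewrite lerBrDr.
Qed.

End clamped_cos_bounds.

(** * Fourier coefficients of cos_p *)

Section primitives.
Context {R : realType}.
Notation mu := (@lebesgue_measure R).
Implicit Types (f P : R -> R) (a b c h : R).

(** Based at [- M], one primitive covers both signs of [x]; splitting and folding of integrals then
    reduce to identities between its values. *)
Lemma primitive_exists f (M : R) : continuous f -> exists P : R -> R,
  forall x, - M < x < M -> is_derive x 1 P (f x).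
Proof.
move=> cf; exists (fun x => \int[mu]_(t in `[- M, x]) f t) => x /andP[x0 x1].
have := @continuous_FTC1_closed R f (- M) x M x1 (cont_integrable _ _ cf) x0 (cf x).
by move=> [? <-]; rewrite derive1E; split.
Qed.

Lemma primitive_integral f P (M a b : R) : continuous f ->
  (forall x, - M < x < M -> is_derive x 1 P (f x)) -> - M < a -> a <= b -> b < M ->
  \int[mu]_(x in `[a, b]) f x = P b - P a.
Proof.
move=> cf Pd Ma ab bM; apply: itv_FTC => //.
- apply: continuous_in_subspaceT => x; rewrite inE/= in_itv/= => /andP[ax xb].
  apply: drv_continuous (Pd x _); rewrite (lt_le_trans Ma ax).
  exact: le_lt_trans xb bM.
- exact: continuous_subspaceT.
- by move=> x /andP[ax xb]; apply: Pd; rewrite (lt_trans Ma ax) (lt_trans xb bM).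
Qed.

Lemma Rintegral_split f a b c : continuous f -> a <= b -> b <= c ->
  \int[mu]_(x in `[a, c]) f x =
  \int[mu]_(x in `[a, b]) f x + \int[mu]_(x in `[b, c]) f x.
Proof.
move=> cf ab bc; have [P Pd] := primitive_exists (`|a| + `|c| + 1) cf.
have a1 : - (`|a| + `|c| + 1) < a.
  by have := ler_norm (- a); rewrite normrN; have := normr_ge0 c; lra.
have c1 : c < `|a| + `|c| + 1.
  by have := ler_norm c; have := normr_ge0 a; lra.
rewrite !(primitive_integral cf Pd)//; lra.
Qed.

Lemma Rintegral_fold f c h : continuous f -> 0 <= h ->
  \int[mu]_(x in `[c - h, c + h]) f x =
  \int[mu]_(t in `[0, h]) (f (c - t) + f (c + t)).
Proof.
move=> cf h0; have [P Pd] := primitive_exists (`|c| + h + 1) cf.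
have c1 := ler_norm c; have c2 : - c <= `|c| by rewrite -normrN ler_norm.
rewrite (primitive_integral cf Pd); [|lra..].
have d t : -1 < t < h + 1 ->
    is_derive t 1 (fun t : R => P (c + t) - P (c - t)) (f (c - t) + f (c + t)).
  move=> th.
  have d1 := drv_comp (drvD (drv_cst c t) (drv_id t)) (Pd (c + t) _).
  have d2 := drv_comp (drvB (drv_cst c t) (drv_id t)) (Pd (c - t) _).
  apply: is_derive_eq (drvB (d1 _) (d2 _)) _; [lra|lra|].
  by rewrite add0r sub0r mulr1 mulrN1 opprK addrC.
have cQ : {within `[0, h], continuous (fun t : R => P (c + t) - P (c - t))}.
  apply: continuous_in_subspaceT => x; rewrite inE/= in_itv/= => /andP[ax xb].
  by apply: (drv_continuous (d x _)); lra.
have cff : {within `[0, h], continuous (fun t : R => f (c - t) + f (c + t))}.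
  apply: continuous_subspaceT; apply: ctD.
    by apply: ct_comp cf _; exact: ctB (ct_cst _) ct_id.
  by apply: ct_comp cf _; exact: ctD (ct_cst _) ct_id.
have dQ (x : R) : 0 < x < h ->
    is_derive x 1 (fun t : R => P (c + t) - P (c - t)) (f (c - x) + f (c + x)).
  by move=> xh; apply: d; lra.
by apply: (etrans _ (esym (itv_FTC h0 cQ cff dQ))); rewrite addr0 !subr0 subrr subr0.
Qed.

(** The argument of Leibniz: what follows the first term is the negative of a sum of the same
    kind. *)
Lemma alternating_sum (D : nat -> R) m : (forall i, (i < m)%N -> 0 <= D i) ->
  (forall i, (i.+1 < m)%N -> D i.+1 <= D i) ->
  0 <= \sum_(i < m) (-1) ^+ i * D i <= (if m is 0 then 0 else D 0).
Proof.
elim: m D => [|m IH] D D0 Dd; first by rewrite big_ord0 lexx.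
have := IH (fun i => D i.+1) (fun i im => D0 i.+1 im) (fun i im => Dd i.+1 im).
rewrite big_ord_recl expr0 mul1r => /andP[s0 s1].
rewrite (eq_bigr (fun i : 'I_m => - ((-1) ^+ i * D i.+1))); last first.
  by move=> i _; rewrite /= /bump add1n exprS mulN1r mulNr.
rewrite sumrN subr_ge0 gerBl s0 andbT; apply: le_trans s1 _.
by case: m {IH s0} D0 Dd => [|m] D0 Dd; [exact: D0|exact: Dd].
Qed.

End primitives.

Section profile.
Context {R : realType}.
Notation mu := (@lebesgue_measure R).
Implicit Types (a b c d h t x y : R) (i j k m : nat).

Definition sinw k x : R := sin (k%:R * pi * x).

Lemma continuous_sinw k : continuous (sinw k).
Proof. by apply: ct_sin; apply: ctM (ct_cst _) ct_id. Qed.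

Lemma sin_natpiD i u : sin (i%:R * pi + u) = (-1) ^+ i * sin u :> R.
Proof.
elim: i => [|i IH]; first by rewrite mul0r add0r expr0 mul1r.
by rewrite -natr1 mulrDl mul1r addrAC sinDpi IH exprS mulN1r mulNr.
Qed.

Lemma sinw_ge0 k x : (0 < k)%N -> 0 <= x <= (2 * k%:R)^-1 -> 0 <= sinw k x.
Proof.
move=> k0 /andP[x0 xk]; apply: sin_ge0_pi; have p0 := pi_gt0 R.
have k0' : 0 < k%:R :> R by rewrite ltr0n.
apply/andP; split; first by rewrite !mulr_ge0// ltW.
rewrite mulrAC ler_piMl ?(ltW p0)//.
apply: le_trans (ler_wpM2l (ltW k0') xk) _.
by rewrite invfM mulrCA divff ?gt_eqF// mulr1 invf_le1// ler1n.
Qed.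

Variable G : R -> R.
Hypothesis cG : continuous G.
Hypothesis G_homo : forall x y, x <= y -> G x <= G y.
Hypothesis G_le0 : forall y, y <= 0 -> G y = 0.
Hypothesis G_concave : forall a b d, 0 <= a -> a <= b -> 0 <= d -> b + d <= 2^-1 ->
  G (b + d) - G b <= G (a + d) - G a.

Let G_ge0 y : 0 <= G y.
Proof. by have [/G_le0->//|/ltW/G_homo] := leP y 0; rewrite G_le0. Qed.

Let cGs k : continuous (fun y => G y * sinw k y).
Proof. by apply: ctM => //; exact: continuous_sinw. Qed.

(* Folding about the zeros [i / j] of the sine gives an alternating sum whose
   terms decrease because [G] is concave. *)
Lemma sin_moment_le j m : j = m.*2.+1 ->
  `|\int[mu]_(y in `[0, 2^-1]) (G y * sinw j y)| <=
  \int[mu]_(y in `[0, (2 * j%:R)^-1]) (G y * sinw j y).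
Proof.
move=> jE; have [h hE] : exists h : R, (2 * j%:R)^-1 = h by exists (2 * j%:R)^-1.
rewrite hE.
have jn : (0 < j)%N by rewrite jE.
have j0 : 0 < j%:R :> R by rewrite ltr0n.
have h0 : 0 < h by rewrite -hE invr_gt0 mulr_gt0.
have jh : 2 * j%:R * h = 1 by rewrite -hE mulfV// gt_eqF// mulr_gt0.
(* [h] is a quarter period of [sinw j], and [c i] is its zero [i / j]. *)
pose c i : R := 2 * i%:R * h.
pose f y := G y * sinw j y.
have sinwc i t : sinw j (c i + t) = (-1) ^+ i * sinw j t.
  rewrite /sinw (_ : j%:R * pi * (c i + t) = i%:R * pi + j%:R * pi * t) ?sin_natpiD//.
  rewrite mulrDr; congr (_ + _).
  by transitivity (i%:R * pi * (2 * j%:R * h)); [rewrite /c; ring|rewrite jh mulr1].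
have sinwcN i t : sinw j (c i - t) = - ((-1) ^+ i * sinw j t).
  by rewrite sinwc /sinw mulrN sinN mulrN.
pose D i := \int[mu]_(t in `[0, h]) ((G (c i.+1 + t) - G (c i.+1 - t)) * sinw j t).
have cc i : c i.+1 = c i + 2 * h by rewrite /c -natr1; ring.
have ctD i : continuous (fun t => (G (c i + t) - G (c i - t)) * sinw j t).
  apply: ctM; last exact: continuous_sinw.
  apply: ctB; first by apply: ct_comp cG _; exact: ctD (ct_cst _) ct_id.
  by apply: ct_comp cG _; exact: ctB (ct_cst _) ct_id.
have piece i : \int[mu]_(y in `[c i + h, c i.+1 + h]) f y = - ((-1) ^+ i * D i).
  have -> : c i + h = c i.+1 - h by rewrite cc; ring.
  rewrite (Rintegral_fold _ (@cGs j) (ltW h0)).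
  rewrite -mulNr /D -RintegralZl//; last exact: cont_integrable.
  apply: eq_Rintegral => t _; rewrite /f sinwcN sinwc exprS; ring.
have total n : \int[mu]_(y in `[0, c n + h]) f y =
    \int[mu]_(y in `[0, h]) f y - \sum_(i < n) (-1) ^+ i * D i.
  elim: n => [|n IH]; first by rewrite /c mulr0 mul0r add0r big_ord0 subr0.
  have cn : 0 <= c n by rewrite /c !mulr_ge0// ltW.
  rewrite (Rintegral_split (@cGs j) (_ : 0 <= c n + h)); last 2 first.
  - by rewrite addr_ge0// ltW.
  - by rewrite lerD2r cc lerDl mulr_ge0// ltW.
  by rewrite IH piece big_ord_recr/=; ring.
(* Since [j] is odd, [0, 1/2] ends exactly at the end of a fold and no partial piece is left
   over. *)
have cm : c m + h = 2^-1.
  have E : j%:R = 2 * m%:R + 1 :> R by rewrite jE -natr1 -mul2n natrM.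
  have : 2 * (c m + h) = 1 by rewrite -[RHS]jh E /c; ring.
  by move=> E2; rewrite -[LHS](mulKf (_ : 2 != 0))// E2 mulr1.
have hle t : 0 <= t <= h -> 0 <= sinw j t by move=> th; apply: sinw_ge0; rewrite // hE.
have D0 i : 0 <= D i.
  apply: Rintegral_ge0 => t /=; rewrite in_itv/= => th; apply: mulr_ge0; last exact: hle.
  by rewrite subr_ge0 G_homo// lerD2l; lra.
have ch i : (i < m)%N -> c i.+1 + h <= 2^-1.
  by move=> im; rewrite -cm lerD2r /c ler_wpM2r ?(ltW h0)// ler_wpM2l// ler_nat.
have hc i : h <= c i.+1.
  by rewrite /c ler_peMl ?(ltW h0)// -natrM ler1n.
have Dd i : (i.+1 < m)%N -> D i.+1 <= D i.
  move=> im; apply: cont_le_Rintegral => // t th.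
  apply: ler_wpM2r; first exact: hle.
  have := @G_concave (c i.+1 - t) (c i.+2 - t) (2 * t).
  have := hc i; have := ch _ im; have := cc i.+1.
  rewrite (_ : c i.+1 - t + 2 * t = c i.+1 + t); last by ring.
  rewrite (_ : c i.+2 - t + 2 * t = c i.+2 + t); last by ring.
  by move=> h1 h2 h3; apply; lra.
(* By concavity from 0, the increment over the first fold is at most [G (2 * t) <= 2 * G t]. The
   alternating sum thus lies between 0 and twice the integral over [[0, h]], so the total stays
   between minus and plus that integral. *)
have D1 : (0 < m)%N -> D 0%N <= 2 * \int[mu]_(y in `[0, h]) f y.
  move=> m0; rewrite -RintegralZl//; last exact: (cont_integrable _ _ (@cGs j)).
  apply: (cont_le_Rintegral (ctD 1%N) (ctM (ct_cst 2) (@cGs j))).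
  move=> t th; rewrite /f mulrA; apply: ler_wpM2r; first exact: hle.
  have := hc 0%N; have := ch _ m0; have := cc 0%N; rewrite {2}/c mulr0 mul0r add0r.
  move=> h1 h2 h3; have := @G_concave 0 (c 1%N - t) (2 * t).
  have := @G_concave 0 t t; rewrite (G_le0 (lexx 0)) !add0r !subr0.
  rewrite (_ : c 1%N - t + 2 * t = c 1%N + t); last by ring.
  rewrite (_ : t + t = 2 * t); last by ring.
  move=> H1 H2.
  have {}H1 : G (2 * t) - G t <= G t by apply: H1; lra.
  have {}H2 : G (c 1%N + t) - G (c 1%N - t) <= G (2 * t) by apply: H2; lra.
  by lra.
rewrite -cm (total m).
have I0 : 0 <= \int[mu]_(y in `[0, h]) f y.
  apply: Rintegral_ge0 => t /=; rewrite in_itv/= => th.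
  by apply: mulr_ge0 => //; exact: hle.
have /andP[s0 s1] := alternating_sum (fun i _ => D0 i) Dd.
have s2 : (if m is 0 then 0 else D 0%N) <= 2 * \int[mu]_(y in `[0, h]) f y.
  by case E : m => [|m']; [exact: mulr_ge0|apply: D1; rewrite E].
have := le_trans s1 s2; move: s0 I0; rewrite -/f ler_norml.
move: (\sum_(i < m) _) (\int[mu]_(y in `[0, h]) f y) => u v; lra.
Qed.

End profile.

Section profile_coefficients.
Context {R : realType}.
Notation mu := (@lebesgue_measure R).
Implicit Types (a b c d h t x y : R) (i j k m : nat).

Variable G : R -> R.
Hypothesis cG : continuous G.
Hypothesis G_homo : forall x y, x <= y -> G x <= G y.
Hypothesis G_le0 : forall y, y <= 0 -> G y = 0.

Let cGs k : continuous (fun y => G y * sinw k y).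
Proof. by apply: ctM => //; exact: continuous_sinw. Qed.

(** With [k = j * pi], Bernoulli's inequality replaces (k y)^a by [1 - a + a * (k * y)], whose
    integral against [sin (k * y)] over a quarter period is exactly [k^-1], whatever [a] is. *)
Lemma sin_moment_power c a j : (0 < j)%N -> 0 <= c -> 0 < a <= 1 ->
  (forall y, 0 <= y <= 2^-1 -> G y <= (c * y) `^ a) ->
  \int[mu]_(y in `[0, (2 * j%:R)^-1]) (G y * sinw j y) <=
  (c / (j%:R * pi)) `^ a / (j%:R * pi).
Proof.
move=> jn c0 /andP[a0 a1] Gc.
have j0 : 0 < j%:R :> R by rewrite ltr0n.
have p0 := pi_gt0 R.
have [k kE] : exists k : R, j%:R * pi = k by exists (j%:R * pi).
have k0 : 0 < k by rewrite -kE mulr_gt0.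
have [K KE] : exists K : R, (c / k) `^ a = K by exists ((c / k) `^ a).
have K0 : 0 <= K by rewrite -KE powR_ge0.
have h0 : 0 <= (2 * j%:R)^-1 :> R by rewrite invr_ge0 mulr_ge0// ltW.
pose Q y := K * (- ((1 - a) / k) * cos (k * y + 0) + a * ((- y) * cos (k * y + 0) + k^-1 * sin (k * y + 0))).
pose q y := K * (1 - a + a * (k * y)) * sin (k * y).
have dQ y : is_derive y 1 Q (q y).
  have d1 := drv_cos_affine k 0 y; have d2 := drv_sin_affine k 0 y.
  have d3 := drvD (drvM (drvN (drv_id y)) d1) (drvZ k^-1 d2).
  apply: is_derive_eq (drvZ K (drvD (drvZ (- ((1 - a) / k)) d1) (drvZ a d3))) _.
  by rewrite /q addr0; field; rewrite gt_eqF.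
have cq : continuous q.
  apply: ctM; last by apply: ct_sin; apply: ctM (ct_cst _) ct_id.
  apply: ctM (ct_cst _) _; apply: ctD (ct_cst _) _; apply: ctM (ct_cst _) _.
  exact: ctM (ct_cst _) ct_id.
have kh : k * (2 * j%:R)^-1 = pi / 2 by rewrite -kE; field; rewrite gt_eqF.
rewrite kE KE; apply: (@le_trans _ _ (\int[mu]_(y in `[0, (2 * j%:R)^-1]) q y)).
  apply: (cont_le_Rintegral (@cGs j) cq) => y yh.
  have s0 := sinw_ge0 jn yh; rewrite /q; have -> : sin (k * y) = sinw j y by rewrite /sinw kE.
  apply: ler_wpM2r => //; have /andP[y0 y1] := yh.
  have yhalf : y <= 2^-1.
    apply: le_trans y1 _; rewrite lef_pV2 ?posrE ?mulr_gt0// ler_peMr// ler1n//.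
  apply: le_trans (Gc y _) _; first by rewrite y0.
  rewrite (_ : c * y = (c / k) * (k * y)); last by field; rewrite gt_eqF.
  have ky : 0 <= k * y by rewrite mulr_ge0// ltW.
  rewrite powRM ?divr_ge0// ?(ltW k0)// KE; apply: ler_wpM2l => //.
  have := @powR_bernoulli _ a (k * y); rewrite a0 a1 ky => /(_ isT isT) h.
  by apply: le_trans h _; rewrite mulrBr mulr1 addrA addrAC.
rewrite (cont_FTC h0 cq dQ) /Q !addr0 mulr0 kh cos_pihalf sin_pihalf cos0 sin0.
rewrite le_eqVlt; apply/orP; left; apply/eqP; move: ((2 * j%:R)^-1 : R) => u.
by field; rewrite gt_eqF.
Qed.

(* Chebyshev's inequality for the two nondecreasing functions [G] and [sinw 1],
   the latter of mean [2 / pi]. *)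
Lemma sin_moment1_ge : 2 / pi * \int[mu]_(y in `[0, 2^-1]) G y <=
  \int[mu]_(y in `[0, 2^-1]) (G y * sinw 1 y).
Proof.
have p0 := pi_gt0 R; have p2 := pi_ge2 R.
have h0 : 0 <= 2^-1 :> R by rewrite invr_ge0.
(* At [y0] the sine takes its mean value, so [sinw 1 y - sinw 1 y0] integrates to 0 and changes sign
   there. *)
have [y0] : exists2 y0 : R, y0 \in `[0, 2^-1] & sinw 1 y0 = 2 / pi.
  apply: IVT => //; first exact: (continuous_subspaceT (@continuous_sinw _ 1)).
  rewrite /sinw mulr0 sin0 mul1r sin_pihalf min_l// max_r//.
  by rewrite divr_ge0 ?(ltW p0)//= ler_pdivrMr// mul1r.
rewrite in_itv/= => /andP[y00 y01] sy0.
have mono (y : R) : 0 <= y <= 2^-1 -> 0 <= (G y - G y0) * (sinw 1 y - sinw 1 y0).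
  move=> /andP[y1 y2].
  have aux (u v : R) : 0 <= u -> u <= v -> v <= 2^-1 -> sinw 1 u <= sinw 1 v.
    move=> u0 uv v1; rewrite /sinw mul1r; have : pi * u <= pi * v by rewrite ler_pM2l.
    have : 0 <= pi * u by rewrite mulr_ge0// ltW.
    have : pi * v <= pi / 2 by rewrite ler_pM2l.
    move: (pi * u) (pi * v) => a b b1 a0; rewrite le_eqVlt => /predU1P[->//|ab].
    by apply: ltW; rewrite ltr_sin// in_itv/=; apply/andP; split; lra.
  have [yy|/ltW yy] := leP y y0.
    by apply: mulr_le0; rewrite subr_le0; [exact: G_homo|apply: aux].
  by apply: mulr_ge0; rewrite subr_ge0; [exact: G_homo|exact: aux].
have cs : continuous (fun y => sinw 1 y - sinw 1 y0).
  by exact: ctB (@continuous_sinw R 1) (ct_cst _).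
have int0 : \int[mu]_(y in `[0, 2^-1]) (sinw 1 y - sinw 1 y0) = 0.
  pose Q y := - (pi^-1 * cos (pi * y + 0)) - sinw 1 y0 * y.
  have dQ y : is_derive y 1 Q (sinw 1 y - sinw 1 y0).
    apply: is_derive_eq (drvB (drvN (drvZ pi^-1 (drv_cos_affine pi 0 y))) (drvZ (sinw 1 y0) (drv_id y))) _.
    have -> : sinw 1 y = sin (pi * y) by rewrite /sinw mul1r.
    by rewrite addr0 mulr1 mulrN opprK mulKf ?gt_eqF.
  rewrite (cont_FTC h0 cs dQ) /Q !addr0 !mulr0 cos_pihalf cos0 sy0.
  by move: (pi^-1 : R) => v; field.
have cGd : continuous (fun y => G y * (sinw 1 y - sinw 1 y0)) by exact: ctM.
have cl : continuous (fun y => G y0 * (sinw 1 y - sinw 1 y0)) by exact: ctM (ct_cst _) cs.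
have : \int[mu]_(y in `[0, 2^-1]) (G y0 * (sinw 1 y - sinw 1 y0)) <=
    \int[mu]_(y in `[0, 2^-1]) (G y * (sinw 1 y - sinw 1 y0)).
  apply: (cont_le_Rintegral cl cGd) => y /mono; rewrite mulrBl; lra.
rewrite RintegralZl//; last exact: (cont_integrable _ _ cs).
rewrite int0 mulr0 => h.
have -> : \int[mu]_(y in `[0, 2^-1]) (G y * sinw 1 y) =
    \int[mu]_(y in `[0, 2^-1]) (G y * (sinw 1 y - sinw 1 y0)) +
    2 / pi * \int[mu]_(y in `[0, 2^-1]) G y.
  rewrite -sy0 -RintegralZl//; last exact: cont_integrable.
  rewrite -RintegralD//; [|exact: (cont_integrable _ _ cGd)|].
    by apply: eq_Rintegral => y _; ring.
  exact: (cont_integrable _ _ (ctM (ct_cst _) cG)).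
by rewrite lerDr.
Qed.

(** As [G] vanishes on the negative half-line, at most one term is nonzero: [G] is read leftwards
    from 1/2 and continued oddly about 1/2. *)
Definition reflected x : R := G (2^-1 - x) - G (x - 2^-1).

Lemma continuous_reflected : continuous reflected.
Proof.
apply: ctB; first by apply: ct_comp cG _; exact: ctB (ct_cst _) ct_id.
by apply: ct_comp cG _; exact: ctB ct_id (ct_cst _).
Qed.

(** Folding about 1/2, where the function is odd, keeps only the sine part of the shifted cosine;
    the factor [sin (k%:R * pi / 2)] removes the even [k]. *)
Lemma coef_reflected k : coef reflected k =
  (if k == 0%N then 1 else 2) * (2 * sin (k%:R * pi / 2)) *
  \int[mu]_(y in `[0, 2^-1]) (G y * sinw k y).
Proof.
rewrite /coef -mulrA; congr (_ * _).
have h0 : 0 <= 2^-1 :> R by rewrite invr_ge0.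
have cf : continuous (fun x => reflected x * cosw k x).
  by apply: ctM; [exact: continuous_reflected|exact: continuous_cosw].
have := Rintegral_fold 2^-1 cf h0.
rewrite subrr (_ : 2^-1 + 2^-1 = 1 :> R); last by field.
move=> ->; rewrite -RintegralZl//; last exact: (cont_integrable _ _ (@cGs k)).
apply: eq_Rintegral => y; rewrite inE/= in_itv/= => /andP[y0 y1].
have e1 : 2^-1 - (2^-1 - y) = y by lra.
have e2 : 2^-1 - y - 2^-1 = - y by lra.
have e3 : 2^-1 - (2^-1 + y) = - y by lra.
have e4 : 2^-1 + y - 2^-1 = y by lra.
have Gy : G (- y) = 0 by rewrite G_le0// oppr_le0.
have -> : reflected (2^-1 - y) = G y.
  by rewrite /reflected e1 e2 Gy subr0.
have -> : reflected (2^-1 + y) = - G y.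
  by rewrite /reflected e3 e4 Gy sub0r.
rewrite /cosw /sinw.
have -> : k%:R * pi * (2^-1 - y) = k%:R * pi / 2 - k%:R * pi * y by rewrite mulrBr.
have -> : k%:R * pi * (2^-1 + y) = k%:R * pi / 2 + k%:R * pi * y by rewrite mulrDr.
by rewrite cosB cosD; ring.
Qed.

End profile_coefficients.

Section absolutely_convergent_cosine_series.
Context {R : realType}.
Notation mu := (@lebesgue_measure R).
Implicit Types (f h : R -> R) (x y e : R).

Lemma continuous_integral_eq0 h : continuous h -> (forall x, 0 <= h x) ->
  \int[mu]_(x in `[0, 1]) h x <= 0 -> forall x, 0 <= x <= 1 -> h x = 0.
Proof.
move=> ch h0 ih x /andP[x0 x1]; apply/eqP; rewrite eq_le h0 andbT leNgt.
apply/negP => hx; have hx2 : 0 < h x / 2 by rewrite divr_gt0.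
have : \forall y \near x, `|h x - h y| < h x / 2.
  by move/cvgrPdist_lt: (ch x) => /(_ _ hx2).
move=> /nbhs_ballP[r /= r0 xr].
have [d d0 [dr d1]] : exists2 d : R, 0 < d & d < r /\ d <= 2^-1.
  have [rh|rh] := leP r 2^-1; first by exists (r / 2); [|split]; lra.
  by exists 2^-1; [|split]; lra.
have [u [u0 u1 ux]] : exists u : R, [/\ 0 <= u, u + d <= 1 &
    forall y, u <= y <= u + d -> `|x - y| < r].
  have [xh|xh] := leP x 2^-1.
    exists x; split; [lra|lra|] => y /andP[y1 y2].
    by rewrite ltr_norml; apply/andP; split; lra.
  exists (x - d); split; [lra|lra|] => y /andP[y1 y2].
  by rewrite ltr_norml; apply/andP; split; lra.
have ige a b : 0 <= \int[mu]_(x in `[a, b]) h x by apply: Rintegral_ge0.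
have E : \int[mu]_(x in `[0, 1]) h x = \int[mu]_(x in `[0, u]) h x +
    (\int[mu]_(x in `[u, (u + d)]) h x + \int[mu]_(x in `[(u + d), 1]) h x).
  by rewrite (@Rintegral_split _ h 0 u 1)// ?(@Rintegral_split _ h u (u + d) 1)//; lra.
have : h x / 2 * d <= \int[mu]_(x in `[u, (u + d)]) h x.
  have := @Rintegral_itv_cst R u (u + d) (h x / 2); rewrite addrAC subrr add0r lerDl.
  move=> /(_ (ltW d0)) <-; apply: (cont_le_Rintegral (ct_cst _) ch) => y yu.
  have : `|h x - h y| < h x / 2 by apply: xr; apply: ux.
  by rewrite ltr_norml; lra.
have := ige 0 u; have := ige (u + d) 1; have := mulr_gt0 hx2 d0; move: ih; rewrite E.
clear; move: (Rintegral _ _ _) (Rintegral _ _ _) (Rintegral _ _ _) (_ * d) => a b c q; lra.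
Qed.

(** [h] is orthogonal to all cosine polynomials and is itself a uniform limit of them, so its square
    has integral 0. *)
Lemma continuous_coef_eq0 h : continuous h -> (forall k, coef h k = 0) ->
  forall x, 0 <= x <= 1 -> h x = 0.
Proof.
move=> ch hk; have hc k : \int[mu]_(x in `[0, 1]) (h x * cosw k x) = 0.
  have /eqP := hk k; rewrite /coef mulf_eq0 => /orP[|/eqP//].
  by case: (k == 0%N); rewrite ?oner_eq0 ?pnatr_eq0.
have hg g : cospoly g -> \int[mu]_(x in `[0, 1]) (h x * g x) = 0.
  move=> [N [c gE]]; under eq_Rintegral do rewrite gE.
  elim: N {gE} => [|N IH].
    by under eq_Rintegral do rewrite big_ord0 mulr0; rewrite Rintegral_itv_cst// mul0r.
  under eq_Rintegral do rewrite big_ord_recr/= mulrDr mulrCA.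
  have c1 : continuous (fun x => h x * \sum_(i < N) c i * cosw i x).
    by apply: ctM => //; apply: ct_sum => i; exact: ctM (ct_cst _) (@continuous_cosw R _).
  have c2 : continuous (fun x => h x * cosw N x) by apply: ctM => //; exact: continuous_cosw.
  rewrite RintegralD//; last 2 first.
  - exact: (cont_integrable _ _ c1).
  - exact: (cont_integrable _ _ (ctM (ct_cst (c N)) c2)).
  rewrite IH add0r RintegralZl ?hc ?mulr0//.
  exact: (cont_integrable _ _ c2).
have ch2 : continuous (fun x => h x * h x) by exact: ctM.
suff i0 : \int[mu]_(x in `[0, 1]) (h x * h x) <= 0.
  move=> x x01; apply/eqP; rewrite -[_ == _]orbb -mulf_eq0; apply/eqP.
  apply: (continuous_integral_eq0 ch2) => // y.
  by rewrite -expr2 sqr_ge0.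
have [B B0 BE] : exists2 B : R, 0 <= B & \int[mu]_(x in `[0, 1]) `|h x| = B.
  by eexists; last reflexivity; apply: Rintegral_ge0.
apply/ler_addgt0Pl => e e0; rewrite addr0.
have e1 : 0 < e / (B + 1) by rewrite divr_gt0// ltr_wpDl.
have [g Hg hge] := cospoly_dense ch e1.
have cg := continuous_cospoly Hg.
have E : \int[mu]_(x in `[0, 1]) (h x * h x) =
    \int[mu]_(x in `[0, 1]) (h x * (h x - g x)).
  have c1 : continuous (fun x => h x * g x) by exact: ctM.
  have c2 : continuous (fun x => h x * (h x - g x)) by apply: ctM => //; exact: ctB.
  rewrite -[RHS]addr0 -[X in _ = _ + X](hg _ Hg) -RintegralD//; last 2 first.
  - exact: (cont_integrable _ _ c2).
  - exact: (cont_integrable _ _ c1).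
  by apply: eq_Rintegral => x _; rewrite -mulrDr subrK.
rewrite E; apply: (@le_trans _ _ (\int[mu]_(x in `[0, 1]) (e / (B + 1) * `|h x|))).
  apply: cont_le_Rintegral.
  - by apply: ctM => //; exact: ctB.
  - exact: ctM (ct_cst _) (ct_norm ch).
  - move=> x x01; rewrite mulrC; apply: le_trans (ler_norm _) _.
    by rewrite normrM ler_wpM2r// hge.
rewrite RintegralZl//; last exact: (cont_integrable _ _ (ct_norm ch)).
by rewrite BE mulrAC ler_pdivrMr ?ltr_wpDl// ler_wpM2l// ?lerDl// ltW.
Qed.

(** The partial sums converge uniformly to a continuous limit with the same coefficients as [f], and
    [continuous_coef_eq0] identifies the two on [0, 1]. *)
Lemma absolute_coef_uniform f (M : R) : continuous f ->
  (forall K, \sum_(k < K) `|coef f k| <= M) ->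
  forall e, 0 < e -> exists K0, forall K x, (K0 <= K)%N -> 0 <= x <= 1 ->
    `|f x - psum f K x| <= e.
Proof.
move=> cf fM.
have mono : {homo (fun K => \sum_(k < K) `|coef f k|) : a b / (a <= b)%N >-> a <= b}.
  move=> a b ab; rewrite -(subnKC ab) big_split_ord/= lerDl.
  by apply: sumr_ge0.
have cT : cvgn (fun K => \sum_(k < K) `|coef f k|).
  by apply: nondecreasing_is_cvgn => //; exists M => _ [K _ <-].
have step a b x : (a <= b)%N ->
    `|psum f b x - psum f a x| <= \sum_(k < b) `|coef f k| - \sum_(k < a) `|coef f k|.
  move=> ab; rewrite /psum -(subnKC ab) !big_split_ord/= [X in `|X|]addrAC subrr add0r.
  rewrite [leRHS]addrAC subrr add0r; apply: le_trans (ler_norm_sum _ _ _) _.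
  by apply: ler_sum => i _; rewrite normrM ler_piMr// cosw_le1.
have tail e : 0 < e -> exists K0, forall a b x, (K0 <= a)%N -> (K0 <= b)%N ->
    `|psum f b x - psum f a x| <= e.
  move=> e0; have /cvgrPdist_lt/(_ _ (_ : 0 < e / 2)) := cT.
  rewrite divr_gt0// => /(_ isT)[K0 _ HK]; exists K0 => a b x.
  wlog ab : a b / (a <= b)%N.
    by move=> H ha hb; have [/H|/ltnW/H] := leqP a b; [exact|rewrite distrC; exact].
  move=> ha hb; apply: le_trans (step a b x ab) _.
  have := HK a ha; have := HK b hb; rewrite /= !ltr_norml; lra.
have cS x : cvgn (fun K => psum f K x).
  rewrite (_ : (fun K => _) = series (fun k => coef f k * cosw k x)); last first.
    by apply/funext => K; rewrite seriesEord.
  apply: normed_cvg; apply: nondecreasing_is_cvgn.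
    by apply: nondecreasing_series => k _ _; exact: normr_ge0.
  exists M => _ [K _ <-].
  rewrite /normed_series_of seriesEord.
  apply: le_trans (fM K).
  apply: ler_sum => k _; have : `|coef f k * cosw k x| <= `|coef f k|; last exact.
  by rewrite normrM ler_piMr// cosw_le1.
pose L x := limn (fun K => psum f K x).
have HL e : 0 < e -> exists K0, forall K x, (K0 <= K)%N -> `|L x - psum f K x| <= e.
  move=> e0; have [K0 HK] := tail _ e0; exists K0 => K x hK.
  have c1 : (fun N => `|psum f N x - psum f K x|) @ \oo --> `|L x - psum f K x|.
    by apply: cvg_norm; apply: cvgB; [exact: cS|exact: cvg_cst].
  have c2 : \forall N \near \oo, `|psum f N x - psum f K x| <= e.
    by exists K0 => // N /= hN; exact: HK.
  exact: (cvgr_to_le c1 c2).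
have cL : continuous L.
  move=> x; apply/cvgrPdist_le => e e0; have e3 : 0 < e / 3 by rewrite divr_gt0.
  have [K0 HK] := HL _ e3.
  have := (cvgrPdist_le _ _).1 (@continuous_psum _ f K0 x) _ e3.
  move=> ps; near=> y; have h : `|psum f K0 x - psum f K0 y| <= e / 3 by near: y; exact: ps.
  have := HK K0 x (leqnn _); have := HK K0 y (leqnn _).
  by move: h; rewrite !ler_norml; lra.
have cD : continuous (fun x => f x - L x) by exact: ctB.
have D0 k : coef (fun x => f x - L x) k = 0.
  apply/eqP; rewrite -normr_le0; apply/ler_addgt0Pl => e e0; rewrite addr0.
  have e2 : 0 < e / 2 by rewrite divr_gt0.
  have [K0 HK] := HL _ e2; pose K := maxn K0 k.+1.
  have ic (c : nat -> R) : continuous (fun x => \sum_(j < K) c j * cosw j x).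
    by apply: ct_sum => i; exact: ctM (ct_cst _) (@continuous_cosw R _).
  have cr : continuous (fun x => psum f K x - L x) by apply: ctB => //; exact: continuous_psum.
  have E1 : coef (fun x => \sum_(j < K) (- coef f j) * cosw j x) k = - coef f k.
    by rewrite (coef_sum K (fun j => - coef f j)) leq_max ltnSn orbT.
  have E : coef (fun x => f x - L x) k = coef (fun x => psum f K x - L x) k.
    have i1 : mu.-integrable `[0, 1] (EFin \o f) by exact: cont_integrable.
    have cm := ic (fun j => - coef f j).
    have i2 := cont_integrable 0 1 cm.
    have i3 := cont_integrable 0 1 cr.
    have := coefD k i1 i2; rewrite E1 subrr => E0.
    have i4 := cont_integrable 0 1 (ctD cf cm).
    have := coefD k i4 i3; rewrite E0 add0r => <-; congr coef; apply/funext => x.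
    by rewrite /psum; under eq_bigr do rewrite mulNr; rewrite sumrN; ring.
  rewrite E; have s2 : 1 < 2 :> R by lra.
  apply: le_trans (coef_bound s2 k (continuous_inLs s2 cr)) _.
  rewrite mulrC -ler_pdivlMr//; apply: (nrm_le s2 cr) => x _; rewrite distrC.
  by apply: HK; rewrite leq_maxl.
have fL := continuous_coef_eq0 cD D0.
move=> e e0; have [K0 HK] := HL _ e0; exists K0 => K x hK x01.
have -> : f x = L x by apply/eqP; rewrite -subr_eq0 fL.
exact: HK.
Unshelve. all: by end_near. Qed.

End absolutely_convergent_cosine_series.

(** * Comparison of power sums with integrals *)

Section power_sums.
Context {R : realType}.
Implicit Types (q t x y j : R).

Lemma powR_neg_bernoulli q x : 0 <= q -> 0 < x -> 1 - q * (x - 1) <= x `^ (- q).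
Proof.
move=> q0 x0; rewrite /powR gt_eqF//.
apply: le_trans (expR_ge1Dx _); rewrite mulNr lerD2l lerN2 ler_wpM2l//.
by have := @le_ln1Dx _ (x - 1); rewrite ltrBrDl subrr addrCA subrr addr0; apply.
Qed.

(** Both powers on the right lie above the tangent at [y], and the linear parts cancel. *)
Lemma powR_midpoint q t y : 0 <= q -> 0 <= t < y ->
  2 * y `^ (- q) <= (y - t) `^ (- q) + (y + t) `^ (- q).
Proof.
move=> q0 /andP[t0 ty]; have y0 : 0 < y by lra.
have E x : 0 < x -> y `^ (- q) * (1 - q * (x / y - 1)) <= x `^ (- q).
  move=> x0; rewrite [in leRHS](_ : x = y * (x / y)); last by field; rewrite gt_eqF.
  rewrite powRM ?divr_ge0 ?(ltW x0) ?(ltW y0)//; apply: ler_wpM2l; first exact: powR_ge0.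
  by apply: powR_neg_bernoulli => //; rewrite divr_gt0.
have e1 := E (y - t); have e2 := E (y + t).
apply: le_trans (lerD (e1 _) (e2 _)); [|lra|lra].
by rewrite le_eqVlt; apply/orP; left; apply/eqP; field; rewrite gt_eqF.
Qed.

Lemma drv_powR_affine (c d : R) q t : 0 < c * t + d ->
  is_derive t 1 (fun t => (c * t + d) `^ (1 - q)) ((1 - q) * (c * t + d) `^ (- q) * c).
Proof.
move=> h; apply: is_derive_eq (drv_powR (1 - q) (drv_affine c d t) h) _.
by rewrite addrAC subrr add0r.
Qed.

(** The midpoint rule underestimates the integral of the convex function t^(-q) over [y - 1, y + 1];
    over consecutive odd [y] the right-hand sides telescope. *)
Lemma powR_sum_upper q y : 1 < q -> 1 < y ->
  2 * (q - 1) * y `^ (- q) <= (y - 1) `^ (1 - q) - (y + 1) `^ (1 - q).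
Proof.
move=> q1 y1.
pose f t := ((- 1) * t + y) `^ (1 - q) - (1 * t + y) `^ (1 - q) - 2 * (q - 1) * y `^ (- q) * t.
pose df t := (1 - q) * ((- 1) * t + y) `^ (- q) * (- 1) - (1 - q) * (1 * t + y) `^ (- q) * 1
   - 2 * (q - 1) * y `^ (- q).
have fd t : -(y - 1) < t < y -> is_derive t 1 f (df t).
  move=> th; apply: is_derive_eq (drvB (drvB (drv_powR_affine _ _) (drv_powR_affine _ _))
    (drvZ _ (drv_id t))) _; [lra|lra|].
  by rewrite /df mulr1.
have : f 0 <= f 1.
  apply: (@drv_ge0_homo _ f df 0 1 _ _ _ 0 1 (lexx 0) ler01 (lexx 1)).
  - by move=> t th; apply: fd; lra.
  - move=> t th; rewrite /df mulN1r mul1r (addrC (- t)) (addrC t).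
    have := @powR_midpoint q t y (ltW (lt_trans ltr01 q1)); rewrite (_ : 0 <= t < y); last by lra.
    move=> /(_ isT).
    rewrite -subr_ge0 => h; have q10 : 0 <= q - 1 by lra.
    have := mulr_ge0 q10 h.
    by congr (_ <= _); ring.
  - apply: continuous_in_subspaceT => t; rewrite inE/= in_itv/= => /andP[t0 t1].
    by apply: (drv_continuous (fd t _)); lra.
rewrite /f !mulr0 !mulr1 !add0r (addrC (-1) y) (addrC 1 y) subrr.
by move: (2 * _ * _) => u; lra.
Qed.

(** The left endpoint rule overestimates the integral of the decreasing function t^(-q) over
    [y, y + 2]. *)
Lemma powR_sum_lower q y : 1 < q -> 0 < y ->
  y `^ (1 - q) - (y + 2) `^ (1 - q) <= 2 * (q - 1) * y `^ (- q).
Proof.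
move=> q1 y0.
pose f t := 2 * (q - 1) * y `^ (- q) * t + (2 * t + y) `^ (1 - q).
pose df t := 2 * (q - 1) * y `^ (- q) + (1 - q) * (2 * t + y) `^ (- q) * 2.
have fd t : - y < 2 * t -> is_derive t 1 f (df t).
  move=> th; apply: is_derive_eq (drvD (drvZ _ (drv_id t)) (drv_powR_affine _ _)) _; [lra|].
  by rewrite /df mulr1.
have : f 0 <= f 1.
  apply: (@drv_ge0_homo _ f df 0 1 _ _ _ 0 1 (lexx 0) ler01 (lexx 1)).
  - by move=> t th; apply: fd; lra.
  - move=> t th; have : (2 * t + y) `^ (- q) <= y `^ (- q) by apply: ler_npowR; lra.
    rewrite /df -subr_ge0 => h; have q10 : 0 <= 2 * (q - 1) by lra.
    by have := mulr_ge0 q10 h; congr (_ <= _); ring.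
  - apply: continuous_in_subspaceT => t; rewrite inE/= in_itv/= => /andP[t0 t1].
    by apply: (drv_continuous (fd t _)); lra.
rewrite /f !mulr0 !mulr1 !add0r (addrC 2 y).
by move: (2 * _ * _) => u; lra.
Qed.

End power_sums.

Section cos_p_fourier.
Context {R : realType} (p : R).
Hypothesis p2 : 2 <= p.
Notation mu := (@lebesgue_measure R).

Local Notation w := (F_p p 1).
Local Notation P := (pi_p p).
Local Notation cosc := (clamped_cos p).

Let p1 : 1 < p. Proof. by apply: lt_le_trans p2; lra. Qed.
Let pm0 : 0 < p - 1. Proof. by rewrite subr_gt0. Qed.
Let w0 : 0 < w. Proof. by have [h _] := F_p1_ge p1; apply: lt_le_trans h. Qed.
Let P0 : 0 < P. Proof. by rewrite /pi_p mulr_gt0. Qed.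
Let Pw : P * 2^-1 = w. Proof. by rewrite /pi_p mulrAC divff ?mul1r. Qed.

(* [cos_p] read backwards from its zero: concave and nondecreasing on [0, 1/2],
   zero on the negative half-line. *)
Definition cos_profile (y : R) : R := cosc (P * (2^-1 - y)).
Local Notation G := cos_profile.

Lemma continuous_cos_profile : continuous G.
Proof.
by apply: (ct_comp (continuous_cosc p1)); apply: ctM (ct_cst _) (ctB (ct_cst _) ct_id).
Qed.

Lemma cos_profile_homo (x y : R) : x <= y -> G x <= G y.
Proof.
move=> xy; apply: (cosc_homo p1); apply: ler_wpM2l; first exact: ltW.
by rewrite lerD2l lerN2.
Qed.

Lemma cos_profile_le0 (y : R) : y <= 0 -> G y = 0.
Proof.
move=> y0; apply: (cosc_ge p1); rewrite -Pw ler_pM2l//.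
by rewrite lerDl oppr_ge0.
Qed.

Lemma cos_profile_concave (a b d : R) : 0 <= a -> a <= b -> 0 <= d -> b + d <= 2^-1 ->
  G (b + d) - G b <= G (a + d) - G a.
Proof.
move=> a0 ab d0 bd; rewrite /cos_profile.
have -> : P * (2^-1 - b) = P * (2^-1 - (b + d)) + P * d by ring.
have -> : P * (2^-1 - a) = P * (2^-1 - (a + d)) + P * d by ring.
apply: (clamped_cos_concave p1 p2).
- by rewrite mulr_ge0 ?subr_ge0// ltW.
- by rewrite ler_pM2l// lerD2l lerN2 lerD2r.
- by rewrite mulr_ge0// ltW.
- by rewrite -mulrDr -Pw ler_pM2l//; lra.
Qed.

Lemma cos_profile_power (y : R) : 0 <= y <= 2^-1 ->
  G y <= ((p - 1) * P * y) `^ (p - 1)^-1.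
Proof.
move=> /andP[y0 y1]; have /andP[G0 _] := cosc_itv p1 (P * (2^-1 - y)).
have h : 0 <= P * (2^-1 - y) <= w.
  rewrite mulr_ge0 ?subr_ge0 ?(ltW P0)//= -Pw ler_pM2l//.
  by rewrite gerBl.
have := clamped_cos_gap p1 h.
have -> : (p - 1) * (w - P * (2^-1 - y)) = (p - 1) * P * y by rewrite -Pw; ring.
move=> g; rewrite -[leLHS](@powRK _ _ (p - 1))// ?gt_eqF//.
by apply: ler_ppowR => //; [rewrite invr_ge0 ltW|exact: powR_ge0].
Qed.

(** Up to the scale [P], this is the rise of [sin_p] from 0 to 1 over a quarter period. *)
Lemma cos_profile_integral : \int[mu]_(y in `[0, 2^-1]) G y = P^-1.
Proof.
pose Q (y : R) := - P^-1 * clamped_sin p (P * (2^-1 - y)).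
have h0 : 0 <= 2^-1 :> R by rewrite invr_ge0.
have cQ : {within `[0, 2^-1], continuous Q}.
  apply: continuous_subspaceT; apply: ctM (ct_cst _) _.
  by apply: (ct_comp (continuous_sinc p1)); apply: ctM (ct_cst _) (ctB (ct_cst _) ct_id).
have dQ (y : R) : 0 < y < 2^-1 -> is_derive y 1 Q (G y).
  move=> /andP[y0 y1]; have h : 0 < P * (2^-1 - y) < w.
    by rewrite mulr_gt0 ?subr_gt0//= -Pw ltr_pM2l// gtrBl.
  have d1 := drvZ P (drvB (drv_cst 2^-1 y) (drv_id y)).
  apply: is_derive_eq (drvZ (- P^-1) (drv_comp d1 (drv_sinc p1 h))) _.
  by rewrite sub0r mulrN1 mulrN mulrNN mulrCA mulVf ?mulr1// gt_eqF.
rewrite (itv_FTC h0 cQ (continuous_subspaceT continuous_cos_profile) dQ) /Q.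
rewrite subrr mulr0 subr0 Pw (sinc_le0 p1 (lexx 0)) (sinc_ge p1 (lexx w)).
by rewrite mulr0 mulr1 sub0r opprK.
Qed.

Local Notation c := ((p - 1) * P).
Local Notation q := (p / (p - 1)).
Local Notation tau := (coef (reflected G)).

Let qE : q = 1 + (p - 1)^-1. Proof. by field; rewrite gt_eqF. Qed.
Let q1 : 1 < q. Proof. by rewrite qE ltrDl invr_gt0. Qed.
Let aP : 0 < (p - 1)^-1 <= 1.
Proof. by rewrite invr_gt0 pm0 invf_le1// lerBrDr. Qed.

Lemma cos_p_coef0 : tau 0 = 0.
Proof.
by rewrite (coef_reflected continuous_cos_profile cos_profile_le0) !mul0r sin0 !mulr0 mul0r.
Qed.

Lemma cos_p_coef_even k : tau k.*2 = 0.
Proof.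
rewrite (coef_reflected continuous_cos_profile cos_profile_le0).
have -> : k.*2%:R * pi / 2 = k%:R * pi :> R by rewrite -mul2n natrM; field.
by rewrite sin_natpi !mulr0 mul0r.
Qed.

Lemma cos_p_coef_odd m : `|tau m.*2.+1| <=
  4 / pi * (c / pi) `^ (p - 1)^-1 * m.*2.+1%:R `^ (- q).
Proof.
rewrite (coef_reflected continuous_cos_profile cos_profile_le0)/=.
set j := m.*2.+1; have j0 : 0 < j%:R :> R by rewrite ltr0n.
have p0 := pi_gt0 R; have c0 : 0 <= c by rewrite ltW// mulr_gt0.
have I1 := sin_moment_le continuous_cos_profile cos_profile_homo cos_profile_le0
  cos_profile_concave (erefl j).
have I2 := sin_moment_power continuous_cos_profile (isT : (0 < j)%N) c0 aP cos_profile_power.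
rewrite normrM; have {}I1 := le_trans I1 I2.
have s1 : `|2 * (2 * sin (j%:R * pi / 2))| <= 4 :> R.
  rewrite !normrM ger0_norm// (_ : 4 = 2 * (2 * 1))//; last by ring.
  by rewrite !ler_pM2l// ler_norml sin_le1 sin_geN1.
apply: le_trans (ler_pM (normr_ge0 _) (normr_ge0 _) s1 I1) _.
rewrite (_ : c / (j%:R * pi) = c / pi * j%:R^-1); last by rewrite invfM mulrA mulrAC.
rewrite powRM ?invr_ge0 ?(ltW j0) ?divr_ge0 ?(ltW p0)//.
have -> : j%:R `^ (- q) = j%:R^-1 `^ (p - 1)^-1 * j%:R^-1 :> R.
  rewrite qE -[in RHS](powR_inv1 (ltW j0)) -powRrM -powRD; last first.
    by rewrite (gt_eqF j0) implybT.
  by congr (_ `^ _); ring.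
by rewrite le_eqVlt; apply/orP; left; apply/eqP; rewrite [(j%:R * pi)^-1]invfM; ring.
Qed.

(** Only odd indices from 3 on contribute. The midpoint comparison telescopes them into the integral
    of t^(-q) from 2 on, which puts the factor 2 into the base [c / (2 * pi)]. *)
Lemma cos_p_coef_tail K : \sum_(2 <= k < K) `|tau k| <=
  2 * (p - 1) / pi * (c / (2 * pi)) `^ (p - 1)^-1.
Proof.
have p0 := pi_gt0 R; have c0 : 0 < c by rewrite mulr_gt0.
have [A AE] : exists A, 4 / pi * (c / pi) `^ (p - 1)^-1 = A by eexists.
have A0 : 0 <= A by rewrite -AE mulr_ge0 ?powR_ge0// divr_ge0// ltW.
have q10 : 0 < q - 1 by rewrite subr_gt0.
have H n : \sum_(2 <= k < n.*2.+2) `|tau k| <=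
    A / (2 * (q - 1)) * (2 `^ (1 - q) - n.*2.+2%:R `^ (1 - q)).
  elim: n => [|n IH]; first by rewrite big_geq// subrr mulr0.
  rewrite doubleS big_nat_recr//= big_nat_recr//= -doubleS cos_p_coef_even normr0.
  rewrite doubleS addr0 in IH *.
  have h := cos_p_coef_odd n.+1; rewrite doubleS AE in h.
  apply: le_trans (lerD IH h) _.
  have y1 : 1 < n.*2.+3%:R :> R by rewrite ltr1n.
  have e1 : n.*2.+3%:R - 1 = n.*2.+2%:R :> R by rewrite -[n.*2.+3%:R]natr1 addrK.
  have := powR_sum_upper q1 y1; rewrite e1 natr1 => u.
  have q20 : 0 < 2 * (q - 1) by rewrite mulr_gt0.
  have := ler_wpM2l (divr_ge0 A0 (ltW q20)) u.
  rewrite mulrA divfK ?gt_eqF// => v; apply: le_trans (lerD (lexx _) v) _.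
  by rewrite -mulrDr addrA subrK.
have : \sum_(2 <= k < K) `|tau k| <= \sum_(2 <= k < K.*2.+2) `|tau k|.
  have [K2|K2] := leqP K 2; first by rewrite big_geq// sumr_ge0.
  rewrite [leRHS](@big_cat_nat _ _ _ K)//=; last 2 first.
  - exact: ltnW.
  - by rewrite -addnn -addn2 -addnA leq_addr.
  by rewrite lerDl sumr_ge0.
move=> /le_trans; apply; apply: le_trans (H K) _.
apply: (@le_trans _ _ (A / (2 * (q - 1)) * 2 `^ (1 - q))).
  apply: ler_wpM2l; last by rewrite gerBl powR_ge0.
  by rewrite divr_ge0// mulr_ge0// ltW.
have -> : 1 - q = - (p - 1)^-1 by rewrite qE; ring.
have -> : q - 1 = (p - 1)^-1 by rewrite qE; ring.
have -> : c / (2 * pi) = c / pi * 2^-1 by rewrite invfM mulrA mulrAC.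
rewrite powRM ?invr_ge0 ?divr_ge0 ?(ltW p0) ?(ltW c0)//.
rewrite -[2^-1](@powR_inv1 _ 2)// -powRrM mulN1r -AE.
rewrite le_eqVlt; apply/orP; left; apply/eqP.
have mn0 : p - 1 != 0 by rewrite gt_eqF.
have pin0 : pi != 0 :> R by rewrite gt_eqF.
move: ((c / pi) `^ (p - 1)^-1) (2 `^ (- (p - 1)^-1)) => u v.
move: (p - 1) (pi : R) mn0 pin0 => m z mn0 zn0.
by field; rewrite mn0 zn0.
Qed.

Lemma cos_p_coef1 : 8 / (pi * P) <= tau 1.
Proof.
have p0 := pi_gt0 R.
rewrite (coef_reflected continuous_cos_profile cos_profile_le0)/= mul1r sin_pihalf.
have := sin_moment1_ge continuous_cos_profile cos_profile_homo.
rewrite cos_profile_integral mulr1 => h.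
apply: le_trans (ler_wpM2l (_ : 0 <= 2 * 2) h); last by [].
by rewrite le_eqVlt; apply/orP; left; apply/eqP; rewrite invfM; ring.
Qed.

Lemma cos_p_reflected (x : R) : 0 <= x <= 1 -> cos_p p (P * x) = reflected G x.
Proof.
have e1 : 2^-1 - (2^-1 - x) = x by lra.
have e2 : 2^-1 - (x - 2^-1) = 1 - x by lra.
by move=> x01; rewrite (cos_p01 p1 x01) /reflected /cos_profile e1 e2.
Qed.

Lemma cos_p_uniform e : 0 < e -> exists K0, forall K (x : R), (K0 <= K)%N ->
  `|cos_p p (P * x) - \sum_(1 <= k < K) tau k * cosw k x| <= e.
Proof.
move=> e0; have cr := continuous_reflected continuous_cos_profile.
have [|K0 HK] := absolute_coef_uniform (M := `|tau 1| + 2 * (p - 1) / pi * (c / (2 * pi)) `^ (p - 1)^-1) cr _ e0.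
  move=> K; case: K => [|[|K]].
  - rewrite big_ord0 addr_ge0// mulr_ge0 ?powR_ge0// divr_ge0 ?ltW ?pi_gt0//.
    by rewrite mulr_gt0.
  - rewrite big_ord1 cos_p_coef0 normr0 addr_ge0// mulr_ge0 ?powR_ge0// divr_ge0 ?ltW ?pi_gt0//.
    by rewrite mulr_gt0.
  - rewrite -(big_mkord xpredT (fun k => `|tau k|)) big_ltn// big_ltn// cos_p_coef0 normr0 add0r.
    by rewrite lerD2l cos_p_coef_tail.
(* The successor makes [K] positive, so that the vanishing term of index 0 can be split off. *)
exists K0.+1 => K x hK; have [y y01 Hy] := even_periodic_fold x.
rewrite (Hy _ (cos_p_even_periodic p1)).
under eq_bigr do rewrite (Hy _ (even_periodic_cosw _)).
have := HK K y (ltnW hK) y01; rewrite cos_p_reflected//.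
case: K hK => // K hK; rewrite /psum -(big_mkord xpredT (fun k => tau k * cosw k y)).
by rewrite big_ltn// cos_p_coef0 mul0r add0r.
Qed.

Lemma continuous_cos_p_dilated : continuous (fun x => cos_p p (P * x)).
Proof.
move=> x; apply/cvgrPdist_le => e e0; have e3 : 0 < e / 3 by rewrite divr_gt0.
have [K HK] := cos_p_uniform e3.
have cS : continuous (fun x : R => \sum_(1 <= k < K) tau k * cosw k x).
  by apply: ct_bigsum; exact: continuous_cosw.
have ps := (cvgrPdist_le _ _).1 (cS x) _ e3.
near=> y; have := HK K x (leqnn _); have := HK K y (leqnn _).
have : `|\sum_(1 <= k < K) tau k * cosw k x - \sum_(1 <= k < K) tau k * cosw k y| <= e / 3.
  by near: y; exact: ps.
move: (\sum_(1 <= k < K) _) (\sum_(1 <= k < K) _) (cos_p _ _) (cos_p _ _) => a b u v.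
by rewrite !ler_norml; lra.
Unshelve. all: by end_near. Qed.

Theorem cos_p_basis (s : R) : 1 < s -> (c / (2 * pi)) `^ q < 2 / pi ->
  schauder_basis (lebesgue01 R) s (fun (n : nat) (x : R) => cos_p p (n%:R * P * x)).
Proof.
move=> s1 cq; have p0 := pi_gt0 R; have c0 : 0 < c by rewrite mulr_gt0.
have [C C0 psumC] := psum_bound s1.
have [B BE] : exists B, 2 * (p - 1) / pi * (c / (2 * pi)) `^ (p - 1)^-1 = B by eexists.
have B0 : 0 <= B.
  by rewrite -BE mulr_ge0 ?powR_ge0// divr_ge0 ?(ltW p0)// mulr_ge0// ltW.
have t1 := cos_p_coef1.
have B1 : B < tau 1.
  apply: lt_le_trans t1; rewrite ltr_pdivlMr ?mulr_gt0//.
  (* As [c = (p - 1) * P], a factor [c / (2 * pi)] comes out and raises the exponent [(p - 1)^-1] to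
     [q]; [cq] then says exactly that [B] is below [8 / (pi * P)], the lower bound for [tau 1]. *)
  have -> : B * (pi * P) = (c / (2 * pi)) `^ q * (4 * pi).
    have -> : (c / (2 * pi)) `^ q = c / (2 * pi) * (c / (2 * pi)) `^ (p - 1)^-1.
      have x0 : 0 < c / (2 * pi) by rewrite divr_gt0// mulr_gt0.
      rewrite qE powRD; last by rewrite (gt_eqF x0) implybT.
      by rewrite powRr1// ltW.
    rewrite -BE; move: (_ `^ _) => u.
    have pin0 : pi != 0 :> R by rewrite gt_eqF.
    by move: (pi : R) pin0 => z z0; field.
  have m0 : 0 < 4 * pi :> R by rewrite mulr_gt0.
  rewrite -(ltr_pM2r m0) in cq; apply: lt_le_trans cq _.
  by rewrite mulrCA divfK ?gt_eqF//; lra.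
have tau0 : 0 < tau 1 by apply: le_lt_trans B1.
apply: (@perturbed_basis R s tau (B / tau 1) (fun x => cos_p p (P * x)) _ s1 _ _ _ _ _ _ _ _ C C0 psumC).
- by rewrite divr_ge0// ltW.
- by rewrite ltr_pdivrMr// mul1r.
- by rewrite gt_eqF.
- by move=> K; rewrite gtr0_norm// divfK ?gt_eqF// -BE cos_p_coef_tail.
- exact: cos_p_uniform.
- exact: continuous_cos_p_dilated.
- move=> x; have := cos_pE p1 0 (x := 0); rewrite normr0 => /(_ (ltW w0)).
  by rewrite !mul0r addr0 expr0z mul1r (cosc_le0 p1 (lexx 0)).
- by move=> n x _; congr cos_p; ring.
Qed.

End cos_p_fourier.

(** * Numerical bounds *)

Section numerical_bounds.
Context {R : realType}.

Lemma sin_le_id (x : R) : 0 <= x -> sin x <= x.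
Proof.
move=> x0; have : 0 - sin 0 <= x - sin x; last by rewrite sin0; lra.
have H (y : R) : 0 < y < x -> is_derive y 1 (fun t : R => t - sin t) (1 - cos y).
  by move=> _; exact: drvB (drv_id y) (is_derive_sin y).
apply: (drv_ge0_homo H _ _ (lexx 0) x0 (lexx x)).
- by move=> y _; rewrite subr_ge0 cos_le1.
- by apply: continuous_subspaceT; apply: ctB ct_id _; exact: continuous_sin.
Qed.

(* From [16 * sin (pi / 16) <= pi] *)
Lemma pi_gt308 : 77 / 25 < pi :> R.
Proof.
have p2 := pi_ge2 R; have p0 := pi_gt0 R.
have half (x : R) : cos (2 * x) = 2 * cos x ^+ 2 - 1.
  rewrite (_ : 2 * x = x + x); last by ring.
  by rewrite cosD -!expr2; have := cos2Dsin2 x; lra.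
have h2 := half (pi / 4); have h4 := half (pi / 8); have h8 := half (pi / 16).
rewrite (_ : 2 * (pi / 4) = pi / 2) ?cos_pihalf in h2; last by field.
rewrite (_ : 2 * (pi / 8) = pi / 4) in h4; last by field.
rewrite (_ : 2 * (pi / 16) = pi / 8) in h8; last by field.
have pos (n : R) : 2 <= n -> 0 <= cos (pi / n).
  move=> n2; apply: cos_ge0_pihalf; apply/andP; split.
    by apply: (@le_trans _ _ 0); [rewrite oppr_le0|]; rewrite divr_ge0//; lra.
  by rewrite ler_pM2l// lef_pV2 ?posrE//; lra.
(* Half-angle formulas bound the cosines from above; [cos (pi / 8) <= 925 / 1000] is incompatible
   with [sin (pi / 16) <= 77 / 400]. *)
have c4 : cos (pi / 4) <= 708 / 1000 :> R.
  by rewrite leNgt; apply/negP => h; nra.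
have c8 : cos (pi / 8) <= 925 / 1000 :> R.
  by rewrite leNgt; apply/negP => h; nra.
have := @sin_le_id (pi / 16); rewrite divr_ge0 ?(ltW p0)// => /(_ isT) sp.
have sp0 : 0 <= sin (pi / 16) :> R.
  apply: sin_ge0_pi; rewrite divr_ge0 ?(ltW p0)//=.
  by rewrite ler_pdivrMr// ler_peMr ?(ltW p0)// ler1n.
have := cos2Dsin2 (pi / 16 : R).
rewrite ltNge => e1; apply/negP => h; have {}sp : sin (pi / 16) <= 77 / 400 :> R.
  by apply: le_trans sp _; rewrite ler_pdivrMr//; apply: le_trans h _; lra.
have := ler_pM sp0 sp0 sp sp; rewrite -expr2; move: e1 h8 c8.
by clear; move: (sin _ ^+ 2) (cos (pi / 16) ^+ 2) (cos (pi / 8)) => u v w; lra.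
Qed.

(** Used with the exponents 25/16 and 9/16, which are p' and p' - 1 at p = 25/9. *)
Lemma powR_root_le (a Y : R) (m n : nat) : 0 <= a -> 0 <= Y -> (0 < n)%N ->
  a ^+ m <= Y ^+ n -> a `^ (m%:R / n%:R) <= Y.
Proof.
move=> a0 Y0 n0 h; have y0 : 0 <= a `^ (m%:R / n%:R) by exact: powR_ge0.
rewrite -(ler_pXn2r n0) ?nnegrE//; apply: le_trans h.
by rewrite -(powR_mulrn n y0) -powRrM divfK ?pnatr_eq0 -?lt0n// powR_mulrn.
Qed.

Lemma powR3_le : 3 `^ (25 / 16) <= 28 / 5 :> R.
Proof. by apply: (@powR_root_le 3 (28 / 5) 25 16) => //; lra. Qed.

Lemma powR5_le : 5 `^ (25 / 16) <= 62 / 5 :> R.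
Proof. by apply: (@powR_root_le 5 (62 / 5) 25 16) => //; lra. Qed.

Lemma powR7_le : 7 `^ (9 / 16) <= 3 :> R.
Proof. by apply: (@powR_root_le 7 3 9 16) => //; lra. Qed.

End numerical_bounds.

(** * Lower bound for the odd part of the zeta series *)

Section zeta_lower_bound.
Context {R : realType}.
Variable q : R.
Hypothesis q1 : 1 < q.

Let q0 : 0 < q. Proof. exact: lt_trans ltr01 q1. Qed.
Let q20 : 0 < 2 * (q - 1). Proof. by rewrite mulr_gt0// subr_gt0. Qed.
Local Notation S := (fun N => \sum_(n < N) (n.+1%:R : R) `^ (- q)).

Let series_riemann : series (riemannR q) = S.
Proof.
by apply/funext => N; rewrite seriesEord; apply: eq_bigr => n _; rewrite /riemannR powRN.
Qed.

Lemma riemann_cvg : cvgn S.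
Proof.
have H N : S N.+1 <= 1 + (1 + 2 `^ (1 - q) - N.+1%:R `^ (1 - q) - N.+2%:R `^ (1 - q)) / (2 * (q - 1)).
  elim: N => [|N IH].
    by rewrite big_ord1 !powR1; lra.
  rewrite big_ord_recr/=; have y1 : 1 < N.+2%:R :> R by rewrite ltr1n.
  have e1 : N.+2%:R - 1 = N.+1%:R :> R by rewrite -[N.+2%:R]natr1 addrK.
  have := powR_sum_upper q1 y1; rewrite e1 natr1 mulrC -ler_pdivlMr// => h.
  apply: le_trans (lerD IH h) _; rewrite -addrA -mulrDl lerD2l ler_wpM2r//.
    by rewrite invr_ge0 ltW.
  lra.
apply: nondecreasing_is_cvgn.
  apply/nondecreasing_seqP => n; rewrite big_ord_recr/= lerDl; exact: powR_ge0.
exists (1 + (1 + 2 `^ (1 - q)) / (2 * (q - 1))) => _ [[|N] _ <-].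
  by rewrite big_ord0 addr_ge0// divr_ge0 ?(ltW q20)// addr_ge0// powR_ge0.
apply: le_trans (H N) _; rewrite lerD2l ler_wpM2r ?invr_ge0 ?(ltW q20)//.
have := powR_ge0 (N.+1%:R : R) (1 - q); have := powR_ge0 (N.+2%:R : R) (1 - q); lra.
Qed.

(** Removing the even terms from [S M.*2] gives [TE]. The limit is taken in [S M] alone, with the
    odd sum bounded below by its value at [N]. *)
Lemma odd_sum_le_zeta N :
  \sum_(n < N) (n.*2.+1%:R : R) `^ (- q) <= (1 - 1 / 2 `^ q) * zeta q.
Proof.
pose T M := \sum_(n < M) (n.*2.+1%:R : R) `^ (- q).
have b0 : 0 < 2 `^ (- q) :> R by exact: powR_gt0.
have TE M : T M = S M.*2 - 2 `^ (- q) * S M.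
  elim: M => [|M IH]; first by rewrite /T !big_ord0 mulr0 subr0.
  rewrite /T doubleS !big_ord_recr/= -/(T M) IH.
  have -> : M.*2.+2%:R `^ (- q) = 2 `^ (- q) * M.+1%:R `^ (- q) :> R.
    by rewrite -powRM// -natrM mul2n doubleS.
  ring.
have Tm M : (N <= M)%N -> T N <= T M.
  move=> NM; rewrite /T -(subnKC NM) big_split_ord/= lerDl.
  by apply: sumr_ge0 => i _; exact: powR_ge0.
have ndS : nondecreasing_seq S.
  by apply/nondecreasing_seqP => n; rewrite big_ord_recr/= lerDl; exact: powR_ge0.
rewrite div1r -powRN /zeta series_riemann -/(T N).
have h1 : limn S <= (limn S - T N) / 2 `^ (- q).
  apply: limr_le; first exact: riemann_cvg.
  exists N => // M /= NM; rewrite ler_pdivlMr//.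
  have := Tm _ NM; rewrite (TE M); have := nondecreasing_cvgn_le ndS riemann_cvg M.*2.
  rewrite mulrC; lra.
by move: h1; rewrite ler_pdivlMr// mulrBl mul1r mulrC; lra.
Qed.

(** The right-hand side is the sum over the odd integers from 3 on: the terms 3 and 5 are kept, and
    those from 7 on are bounded below by half the integral of t^(-q). *)
Lemma zeta_ge : 3 `^ (- q) + 5 `^ (- q) + 7 `^ (1 - q) / (2 * (q - 1)) <=
  (1 - 1 / 2 `^ q) * zeta q - 1.
Proof.
have H N : 1 + 3 `^ (- q) + 5 `^ (- q) +
    (7 `^ (1 - q) - N.*2.+4.+3%:R `^ (1 - q)) / (2 * (q - 1)) <=
    \sum_(n < N.+3) (n.*2.+1%:R : R) `^ (- q).
  elim: N => [|N IH].
    by rewrite subrr mul0r addr0 !big_ord_recr/= big_ord0 add0r powR1.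
  rewrite big_ord_recr/=; apply: le_trans _ (lerD IH (lexx _)); rewrite -[leRHS]addrA lerD2l.
  have y0 : 0 < N.+3.*2.+1%:R :> R by rewrite ltr0n.
  have := powR_sum_lower q1 y0.
  rewrite mulrC -ler_pdivrMr// => h; apply: le_trans _ (lerD (lexx _) h).
  rewrite -mulrDl ler_wpM2r ?invr_ge0 ?(ltW q20)//.
  rewrite -natrD addn2 !doubleS; lra.
apply/ler_addgt0Pl => e e0.
have qm : 0 < q - 1 by rewrite subr_gt0.
have [d d0 dP] := powR_small qm (mulr_gt0 e0 q20).
pose N := Num.bound d^-1.
have hN : N.*2.+4.+3%:R `^ (1 - q) <= e * (2 * (q - 1)) :> R.
  have n0 : 0 < N.*2.+4.+3%:R :> R by rewrite ltr0n.
  have -> : N.*2.+4.+3%:R `^ (1 - q) = N.*2.+4.+3%:R^-1 `^ (q - 1) :> R.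
    by rewrite -(powR_inv1 (ltW n0)) -powRrM mulN1r opprB.
  apply: dP; first by rewrite invr_ge0 ltW.
  rewrite -[d]invrK lef_pV2 ?posrE ?invr_gt0//.
  have dV : 0 <= d^-1 by rewrite invr_ge0 ltW.
  apply: le_trans (ltW (archi_boundP dV)) _; rewrite ler_nat -/N.
  by rewrite -addnn -!addnS leq_addr.
have := le_trans (H N) (odd_sum_le_zeta _).
rewrite mulrBl; have : N.*2.+4.+3%:R `^ (1 - q) / (2 * (q - 1)) <= e by rewrite ler_pdivrMr.
lra.
Qed.

Hypothesis q2 : q <= 25 / 16.

(** For [q <= 25 / 16] the three terms of [zeta_ge] are at least 5/28, 5/62 and 8/27, whose sum
    exceeds 0.555. *)
Lemma zeta_excess : 545 / 1000 <= (1 - 1 / 2 `^ q) * zeta q - 1.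
Proof.
apply: le_trans zeta_ge.
have aux (b Y : R) : 1 <= b -> 0 < Y -> b `^ (25 / 16) <= Y -> Y^-1 <= b `^ (- q).
  move=> b1 Y0 bY; have b0 : 0 < b by lra.
  rewrite powRN lef_pV2 ?posrE ?powR_gt0//; apply: le_trans bY.
  by apply: ler_powR.
have h3 := aux 3 _ _ _ powR3_le; have h5 := aux 5 _ _ _ powR5_le.
have h7 : 8 / 27 <= 7 `^ (1 - q) / (2 * (q - 1)) :> R.
  rewrite ler_pdivlMr//; have : 3^-1 <= 7 `^ (1 - q) :> R.
    rewrite (_ : 1 - q = - (q - 1)); last by ring.
    rewrite powRN lef_pV2 ?posrE ?powR_gt0//; apply: le_trans powR7_le.
    by apply: ler_powR; [lra|have := q2; lra].
  by have := q2; lra.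
have {}h3 : (28 / 5)^-1 <= 3 `^ (- q) :> R by apply: h3; lra.
have {}h5 : (62 / 5)^-1 <= 5 `^ (- q) :> R by apply: h5; lra.
lra.
Qed.

End zeta_lower_bound.

Section parameter_range.
Context {R : realType}.

(* For [p > 25 / 9] the left-hand side of the equation already exceeds the right
   one, using [pi_p p >= 2] and [pi_p (p / (p - 1)) >= 2 * (p - 1)]. *)
Lemma critical_exponent_le (p : R) : 2 < p ->
  2 * pi_p (p / (p - 1)) / (pi ^+ 2 * (p - 1)) * (2 + pi ^+ 2 / 2 * (p - 2)) *
    ((1 - 1 / 2 `^ (p / (p - 1))) * zeta (p / (p - 1)) - 1) = 8 / (pi * pi_p p) ->
  p <= 25 / 9.
Proof.
move=> p2 E; rewrite leNgt; apply/negP => ph.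
have p0 := pi_gt0 R; have p308 := @pi_gt308 R.
have pm : 0 < p - 1 by lra.
have p1 : 1 < p by lra.
have [q qE] : exists q, p / (p - 1) = q by eexists.
have qd : q = 1 + (p - 1)^-1 by rewrite -qE; field; rewrite gt_eqF.
have q1 : 1 < q by rewrite qd ltrDl invr_gt0.
have qh : q <= 25 / 16.
  have : (p - 1)^-1 <= (16 / 9)^-1 by rewrite lef_pV2 ?posrE//; lra.
  by rewrite qd; lra.
have [Z ZE] : exists Z, (1 - 1 / 2 `^ q) * zeta q - 1 = Z by eexists.
have Z0 := zeta_excess q1 qh; rewrite ZE in Z0.
have [h hE] : exists h : R, 545 / 1000 = h by eexists.
have h0 : 0 <= h by rewrite -hE; lra.
rewrite hE in Z0.
have [P PE] : exists P, pi_p p = P by eexists.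
have [Q QE] : exists Q, pi_p q = Q by eexists.
have P2 : 2 <= P.
  by have [F1 _] := F_p1_ge p1; rewrite -PE /pi_p -[leLHS]mulr1 ler_pM2l.
have Q2 : 2 * (p - 1) <= Q.
  have [_ F1] := F_p1_ge q1; rewrite -QE /pi_p ler_pM2l//; apply: le_trans F1.
  by rewrite [in leRHS]qd addrAC subrr add0r invrK.
rewrite qE ZE PE QE in E.
have [k kE] : exists k : R, pi = k by eexists.
rewrite kE in E p0 p308.
have k2 : 0 < k ^+ 2 * (p - 1) by rewrite mulr_gt0// exprn_gt0.
have E1 : 2 * Q * (2 + k ^+ 2 / 2 * (p - 2)) * Z * (k * P) = 8 * (k ^+ 2 * (p - 1)).
  have aux (u m A z n : R) : m != 0 -> n != 0 -> u / m * A * z = 8 / n -> u * A * z * n = 8 * m.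
    move=> m0 n0 e; transitivity (u / m * A * z * (m * n)); first by field.
    by rewrite e; field.
  apply: aux E; first by rewrite gt_eqF.
  by rewrite gt_eqF// mulr_gt0// (lt_le_trans _ P2).
clear E ZE PE QE kE qE.
(* 7/18 is half of 25/9 - 2. *)
have A0 : 2 + k ^+ 2 * (7 / 18) <= 2 + k ^+ 2 / 2 * (p - 2).
  rewrite lerD2l -mulrA ler_wpM2l//; first exact: sqr_ge0.
  by lra.
have k20 : 0 < k ^+ 2 by rewrite exprn_gt0.
have [A' A'E] : exists A' : R, 2 + k ^+ 2 * (7 / 18) = A' by eexists.
have A'0 : 0 <= A'.
  by rewrite -A'E; apply: addr_ge0 => //; apply: mulr_ge0; [exact: ltW|lra].
rewrite A'E in A0.
have AZ : A' * h <= (2 + k ^+ 2 / 2 * (p - 2)) * Z.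
  exact: (ler_pM A'0 h0 A0 Z0).
(* A quadratic inequality in [k], the value of pi; its larger root lies between 3 and 77/25. *)
have AZ0 : k < A' * h.
  rewrite -A'E -hE.
  by clear -p308; nra.
have PQ : 2 * (2 * (p - 1)) <= P * Q.
  by apply: (ler_pM _ _ P2 Q2) => //; apply: mulr_ge0 => //; exact: ltW.
have L : 2 * (2 * (p - 1)) * k < P * Q * ((2 + k ^+ 2 / 2 * (p - 2)) * Z).
  apply: (@lt_le_trans _ _ (2 * (2 * (p - 1)) * ((2 + k ^+ 2 / 2 * (p - 2)) * Z))).
    rewrite ltr_pM2l; first exact: lt_le_trans AZ.
    by rewrite !mulr_gt0.
  apply: ler_wpM2r => //; apply: le_trans AZ; apply: ltW; exact: lt_trans AZ0.
have : 2 * k * (2 * (2 * (p - 1)) * k) < 2 * k * (P * Q * ((2 + k ^+ 2 / 2 * (p - 2)) * Z)).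
  by rewrite ltr_pM2l// mulr_gt0.
have -> : 2 * k * (P * Q * ((2 + k ^+ 2 / 2 * (p - 2)) * Z)) =
  2 * Q * (2 + k ^+ 2 / 2 * (p - 2)) * Z * (k * P) by ring.
have -> : 2 * k * (2 * (2 * (p - 1)) * k) = 8 * (k ^+ 2 * (p - 1)) by ring.
by rewrite E1 ltxx.
Qed.

Lemma coefficient_condition (p : R) : 2 <= p -> p <= 25 / 9 ->
  ((p - 1) * pi_p p / (2 * pi)) `^ (p / (p - 1)) < 2 / pi.
Proof.
move=> p2 ph; have p0 := pi_gt0 R; have p308 := @pi_gt308 R.
have pm : 0 < p - 1 by lra.
have p1 : 1 < p by lra.
have [k kE] : exists k : R, pi = k by eexists.
rewrite kE in p0 p308 *.
have [F FE] : exists F, F_p p 1 = F by eexists.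
have F1 := F_p1_le p1; have [F0 _] := F_p1_ge p1; rewrite FE in F0 F1.
rewrite /pi_p FE (_ : (p - 1) * (2 * F) / (2 * k) = (p - 1) * F / k); last first.
  by field; rewrite gt_eqF.
have c0 : 0 <= (p - 1) * F by rewrite mulr_ge0 ?(ltW pm)//; lra.
(* [F_p1_le] bounds the product by (p^2 + 1) / (p + 1), which increases on this range and is about
   2.3072 at p = 25/9. *)
have c1 : (p - 1) * F <= 2308 / 1000.
  apply: le_trans (ler_wpM2l (ltW pm) F1) _.
  have pp : 0 < p + 1 by lra.
  rewrite (_ : (p - 1) * _ = (p ^+ 2 + 1) / (p + 1)); last by field; rewrite !gt_eqF.
  rewrite ler_pdivrMr//; have := mulr_ge0 (_ : 0 <= p - 2) (_ : 0 <= 25 / 9 - p).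
  by rewrite !subr_ge0 => /(_ p2 ph); nra.
have q32 : 3 / 2 <= p / (p - 1) by rewrite ler_pdivlMr//; lra.
have [v vE] : exists v : R, 2308 / 1000 = v by eexists.
have v0 : 0 < v by rewrite -vE; lra.
have vk : v <= k by rewrite -vE; lra.
rewrite vE in c1.
have [B BE] : exists B : R, v / k = B by eexists.
have B0 : 0 < B by rewrite -BE divr_gt0.
have Bk : B * k = v by rewrite -BE divfK// gt_eqF.
have B1 : B <= 1 by rewrite -BE ler_pdivrMr// mul1r.
have cB : (p - 1) * F / k <= B by rewrite -BE ler_wpM2r// invr_ge0 ltW.
have q0 : 0 <= p / (p - 1) by apply: le_trans q32; lra.
apply: le_lt_trans (ler_ppowR q0 (divr_ge0 c0 (ltW p0)) cB) _.
(* The base is at most 1, so the exponent may be lowered to 3/2. After squaring, the claim becomes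
   2.308^3 < 4 pi, for which pi > 77/25 suffices. *)
apply: (@le_lt_trans _ _ (B `^ (3 / 2))); first by apply: ger_powR => //; rewrite B0.
have y0 : 0 <= B `^ (3 / 2) by exact: powR_ge0.
have y2 : (B `^ (3 / 2)) ^+ 2 = B ^+ 3.
  by rewrite -(powR_mulrn 2 y0) -powRrM divfK// (powR_mulrn 3 (ltW B0)).
rewrite -(@ltr_pXn2r _ 2)// ?nnegrE ?divr_ge0 ?(ltW p0)// y2.
rewrite expr_div_n ltr_pdivlMr ?exprn_gt0//.
rewrite (_ : B ^+ 3 * k ^+ 2 = (B * k) ^+ 3 / k); last by field; rewrite gt_eqF.
by rewrite Bk ltr_pdivrMr// -vE; lra.
Qed.

End parameter_range.

Theorem corollary2 (R : realType) (p1 : R) (hp1 : 2 < p1)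
  (hp1_eq : let p := p1 in let p' := p / (p - 1) in
     2 * pi_p p' / (pi ^+ 2 * (p - 1)) * (2 + pi ^+ 2 / 2 * (p - 2)) *
       ((1 - 1 / 2 `^ p') * zeta p' - 1) = 8 / (pi * pi_p p))
  (s : R) (hs : 1 < s) (p : R) (hp2 : 2 <= p) (hpp1 : p <= p1) :
  schauder_basis (lebesgue01 R) s
    (fun (n : nat) (x : R) => cos_p p (n%:R * pi_p p * x)).
Proof.
have p_le := le_trans hpp1 (critical_exponent_le hp1 hp1_eq).
have h := cos_p_basis hp2 hs (coefficient_condition hp2 p_le).
exact: h.
Qed.
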